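(* Let $n\ge 1$ be an integer, $\mu>0$ and $\rho=-\frac{\mu-1}{2}$. Let $v_1,v_2\in\mathcal S(\mathbb R^n)$ and assume $v=v(t,x)$ solves the Cauchy problem $$v_{tt}-\Delta v+\frac{\mu}{1+t}v_t=0,\qquad v(0,\cdot)=v_1,\qquad v_t(0,\cdot)=v_2,\qquad x\in\mathbb R^n,\ t\ge 0.$$ Then the partial Fourier transform $\hat v(t,\xi)$ of $v$ with respect to $x$ satisfies, for $t\ge0$ and $\xi\neq 0$, $$\hat v(t,\xi)=\sum_{j=1,2}\Phi_j(t,0,\xi)\,\hat v_j(\xi),$$ where the multipliers $\Phi_j$ are given by $$\Phi_1(t,t_0,\xi)=\frac{i\pi}{4}|\xi|\frac{(1+t)^\rho}{(1+t_0)^{\rho-1}}\begin{vmatrix}\mathcal H^-_{\rho-1}((1+t_0)|\xi|)&\mathcal H^-_\rho((1+t)|\xi|)\\ \mathcal H^+_{\rho-1}((1+t_0)|\xi|)&\mathcal H^+_\rho((1+t)|\xi|)\end{vmatrix}$$ and $$\Phi_2(t,t_0,\xi)=-\frac{i\pi}{4}\frac{(1+t)^\rho}{(1+t_0)^{\rho-1}}\begin{vmatrix}\mathcal H^-_{\rho}((1+t_0)|\xi|)&\mathcal H^-_\rho((1+t)|\xi|)\\ \mathcal H^+_{\rho}((1+t_0)|\xi|)&\mathcal H^+_\rho((1+t)|\xi|)\end{vmatrix}.$$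
   Context: $\mathcal S(\mathbb R^n)$ is the Schwartz space. The Fourier transform is $\hat v(t,\xi)=(2\pi)^{-n/2}\int_{\mathbb R^n}e^{-ix\cdot\xi}v(t,x)\,dx$. $\mathcal H^\pm_\nu(z)=\mathcal J_\nu(z)\pm i\,\mathcal Y_\nu(z)$ are the Hankel functions of order $\nu\in\mathbb R$, with $\mathcal J_\nu$ and $\mathcal Y_\nu$ the Bessel functions of the first and second kind. Vertical bars around a $2\times2$ array denote its determinant. *)

(* Defs.v *)
From HB Require Import structures.
From mathcomp Require Import all_boot all_order all_algebra.
From mathcomp Require Import all_classical all_reals all_analysis.
From mathcomp Require Import complex.
Set Implicit Arguments.
Unset Strict Implicit.
Unset Printing Implicit Defensive.
Import Order.TTheory GRing.Theory Num.Theory numFieldNormedType.Exports.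
Local Open Scope classical_set_scope.
Local Open Scope ring_scope.
Local Open Scope complex_scope.

(* The library has product measures of two factors and a sigma-algebra on
   n.-tuple R; Lebesgue measure on R^n.+1 is the product of Lebesgue measure on
   R and on R^n, transported along (a, x) |-> a :: x. *)
Section LebesgueTuple.
Context {R : realType}.

Definition tcons (n : nat) (p : measurableTypeR R * n.-tuple (measurableTypeR R)) :
  n.+1.-tuple (measurableTypeR R) := [tuple of p.1 :: p.2].

Lemma measurable_tcons (n : nat) : measurable_fun setT (@tcons n).
Proof. exact: measurable_cons. Qed.

Section Step.
Variable n : nat.
Variable mu : {sigma_finite_measure set (n.-tuple (measurableTypeR R)) -> \bar R}.

Definition lebesgue_cons :=
  pushforward (@lebesgue_measure R \x mu)%E (@tcons n).

Let lebesgue_cons0 : lebesgue_cons set0 = 0%E.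
Proof. by rewrite /lebesgue_cons /pushforward preimage_set0 measure0. Qed.

Let lebesgue_cons_ge0 A : (0 <= lebesgue_cons A)%E.
Proof. by rewrite /lebesgue_cons /pushforward measure_ge0. Qed.

Let lebesgue_cons_sigma_additive : semi_sigma_additive lebesgue_cons.
Proof.
move=> F mF tF mUF; rewrite /lebesgue_cons /pushforward preimage_bigcup.
apply: measure_semi_sigma_additive.
- by move=> k; rewrite -[X in measurable X]setTI; exact: measurable_tcons.
- apply/trivIsetP => i j _ _ ij; rewrite -preimage_setI.
  by move/trivIsetP : tF => ->//; rewrite preimage_set0.
- by rewrite -preimage_bigcup -[X in measurable X]setTI; exact: measurable_tcons.
Qed.

HB.instance Definition _ := isMeasure.Build _ _ _ lebesgue_cons
  lebesgue_cons0 lebesgue_cons_ge0 lebesgue_cons_sigma_additive.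

Let lebesgue_cons_sigma_finite : sigma_finite setT lebesgue_cons.
Proof.
have [F TF Foo] : sigma_finite setT (@lebesgue_measure R \x mu)%E.
  have /sigma_finiteP[F [TF ndF Foo]] := sigma_finiteT (@lebesgue_measure R).
  have /sigma_finiteP[G [TG ndG Goo]] := sigma_finiteT mu.
  exists (fun k => F k `*` G k).
    rewrite -setXTT TF TG predeqE => -[x y]; split.
      move=> [/= [k _ Fkx] [l _ Gly]]; exists (maxn k l) => //; split.
      - by move: x Fkx; exact/subsetPset/ndF/leq_maxl.
      - by move: y Gly; exact/subsetPset/ndG/leq_maxr.
    by move=> [k _ []/= ? ?]; split; exists k.
  move=> k; have [? ?] := Foo k; have [? ?] := Goo k.
  split; first exact: measurableX.
  by rewrite product_measure1E// lte_mul_pinfty// ge0_fin_numE.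
pose u (t : n.+1.-tuple (measurableTypeR R)) := (thead t, [tuple of behead t]).
have mu_ : measurable_fun setT u.
  by apply/measurable_fun_pair; [exact: measurable_tnth|exact: measurable_behead].
have uK p : u (tcons p) = p.
  by case: p => a x; congr pair; rewrite ?theadE//; exact/val_inj.
exists (fun k => u @^-1` F k).
  by rewrite -preimage_bigcup -TF preimage_setT.
move=> k; have [mF Fk] := Foo k; split.
  by rewrite -[X in measurable X]setTI; exact: mu_.
rewrite /lebesgue_cons /pushforward.
rewrite (_ : _ @^-1` _ = F k)//.
by apply/seteqP; split => p /=; rewrite uK.
Qed.

HB.instance Definition _ := Measure_isSigmaFinite.Build _ _ _
  lebesgue_cons lebesgue_cons_sigma_finite.

End Step.

Fixpoint lebesgue_tuple (n : nat) :
    {sigma_finite_measure set (n.-tuple (measurableTypeR R)) -> \bar R} :=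
  match n with
  | 0 => \d_([tuple of [::]] : 0.-tuple (measurableTypeR R))
  | n'.+1 => lebesgue_cons (lebesgue_tuple n')
  end.

End LebesgueTuple.

Section FourierSchwartz.
Context {R : realType}.

(* R[i] carries no topology, so analytic operations on complex-valued functions
   act on the real and imaginary parts. *)
Definition componentwise (T : Type) (D : (T -> R) -> T -> R) (f : T -> R[i]) :
    T -> R[i] :=
  fun p => D (fun q => complex.Re (f q)) p +i* D (fun q => complex.Im (f q)) p.

Definition integralRn (n : nat) (f : 'rV[R]_n -> R) : R :=
  (\int[lebesgue_tuple n]_p f (\row_i tnth p i))%R.

Definition integralRnC (n : nat) (f : 'rV[R]_n -> R[i]) : R[i] :=
  integralRn (fun x => complex.Re (f x)) +i*
  integralRn (fun x => complex.Im (f x)).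

Definition dotp (n : nat) (x y : 'rV[R]_n) : R := \sum_i x ord0 i * y ord0 i.

(* The library's norm on 'rV[R]_n is the maximum norm. *)
Definition enorm (n : nat) (x : 'rV[R]_n) : R := Num.sqrt (dotp x x).

Definition expi (a : R) : R[i] := cos a +i* sin a.

Definition fourier (n : nat) (f : 'rV[R]_n -> R[i]) (xi : 'rV[R]_n) : R[i] :=
  ((2 * pi) `^ (- (n%:R / 2)))%:C *
  integralRnC (fun x => expi (- dotp x xi) * f x).

Definition partial (n : nat) (i : 'I_n) (f : 'rV[R]_n -> R) : 'rV[R]_n -> R :=
  fun x => 'D_(delta_mx ord0 i) f x.

(* A differential monomial is given by the list of the coordinates of the
   successive differentiations; every multi-index arises from such a list. *)
Definition partials (n : nat) (s : seq 'I_n) (f : 'rV[R]_n -> R) :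
    'rV[R]_n -> R :=
  foldr (@partial n) f s.

Definition smooth (n : nat) (f : 'rV[R]_n -> R) : Prop :=
  forall s : seq 'I_n, continuous (partials s f) /\
    forall (i : 'I_n) (x : 'rV[R]_n),
      derivable (partials s f) x (delta_mx ord0 i).

Definition schwartz (n : nat) (f : 'rV[R]_n -> R[i]) : Prop :=
  [/\ smooth (fun x => complex.Re (f x)),
      smooth (fun x => complex.Im (f x)) &
      forall (alpha : 'I_n -> nat) (s : seq 'I_n), exists C : R,
        forall x : 'rV[R]_n,
          `|(\prod_i x ord0 i ^+ alpha i)%:C * componentwise (partials s) f x|
            <= C%:C].

End FourierSchwartz.

Section CauchyProblem.
Context {R : realType}.

(* Derivative of a function on [0, +oo[, one-sided at 0. *)
Definition derivable_ge0 (g : R -> R) (t : R) : Prop :=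
  cvg ((g s - g t) / (s - t) @[s --> within [set s | 0 <= s] t^']).

Definition derive_ge0 (g : R -> R) (t : R) : R :=
  lim ((g s - g t) / (s - t) @[s --> within [set s | 0 <= s] t^']).

(* w is of class C^k on [0, +oo[ x R^n, up to the boundary t = 0; the values
   w t x with t < 0 are irrelevant. *)
Fixpoint Ck_ge0 (n k : nat) (w : R -> 'rV[R]_n -> R) : Prop :=
  {within [set p : R * 'rV[R]_n | 0 <= p.1], continuous (fun p => w p.1 p.2)} /\
  if k is k'.+1 then
    [/\ forall t x, 0 <= t -> derivable_ge0 (w ^~ x) t,
        Ck_ge0 k' (fun t x => derive_ge0 (w ^~ x) t),
        forall (i : 'I_n) t x, 0 <= t -> derivable (w t) x (delta_mx ord0 i) &
        forall i : 'I_n, Ck_ge0 k' (fun t x => partial i (w t) x)]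
  else True.

Definition dt (n : nat) (v : R -> 'rV[R]_n -> R[i]) : R -> 'rV[R]_n -> R[i] :=
  fun t x => componentwise derive_ge0 (v ^~ x) t.

Definition laplacian (n : nat) (f : 'rV[R]_n -> R[i]) : 'rV[R]_n -> R[i] :=
  fun x => \sum_i componentwise (partial i) (componentwise (partial i) f) x.

(* Classical solutions; no decay in x is assumed, it follows from that of the
   data by finite speed of propagation. *)
Definition solves_cauchy (n : nat) (mu : R) (v1 v2 : 'rV[R]_n -> R[i])
    (v : R -> 'rV[R]_n -> R[i]) : Prop :=
  [/\ Ck_ge0 2 (fun t x => complex.Re (v t x)),
      Ck_ge0 2 (fun t x => complex.Im (v t x)),
      forall t x, 0 <= t ->
        dt (dt v) t x - laplacian (v t) x + (mu / (1 + t))%:C * dt v t x = 0,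
      forall x, v 0 x = v1 x &
      forall x, dt v 0 x = v2 x].

End CauchyProblem.

Section Hankel.
Context {R : realType}.

(* Gauss's limit.  At the poles x = 0, -1, -2, ... the product eventually
   vanishes, and 0^-1 = 0 makes the value 0, so that (Gamma x)^-1 is the entire
   function 1/Gamma at every real x. *)
Definition Gamma (x : R) : R :=
  limn (fun m : nat =>
    m`!%:R * m%:R `^ x / \prod_(0 <= k < m.+1) (x + k%:R)).

Definition besselJ (nu z : R) : R :=
  limn (series (fun k : nat =>
    (-1) ^+ k / k`!%:R * (Gamma (nu + k%:R + 1))^-1 *
    (z / 2) `^ (2 * k%:R + nu))).

Definition besselY_nonint (nu z : R) : R :=
  (besselJ nu z * cos (nu * pi) - besselJ (- nu) z) / sin (nu * pi).

Definition besselY (nu z : R) : R :=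
  if nu \is a Num.int then lim (besselY_nonint a z @[a --> nu^'])
  else besselY_nonint nu z.

Definition hankel_plus (nu z : R) : R[i] := besselJ nu z +i* besselY nu z.
Definition hankel_minus (nu z : R) : R[i] := besselJ nu z -i* besselY nu z.

Definition det2 (a b c d : R[i]) : R[i] :=
  \det (\matrix_(i < 2, j < 2)
    if i == ord0 then (if j == ord0 then a else b)
    else (if j == ord0 then c else d)).

Definition Phi1 (n : nat) (rho t t0 : R) (xi : 'rV[R]_n) : R[i] :=
  (0 +i* (pi / 4)) * (enorm xi)%:C *
  ((1 + t) `^ rho / (1 + t0) `^ (rho - 1))%:C *
  det2 (hankel_minus (rho - 1) ((1 + t0) * enorm xi))
       (hankel_minus rho ((1 + t) * enorm xi))
       (hankel_plus (rho - 1) ((1 + t0) * enorm xi))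
       (hankel_plus rho ((1 + t) * enorm xi)).

Definition Phi2 (n : nat) (rho t t0 : R) (xi : 'rV[R]_n) : R[i] :=
  - (0 +i* (pi / 4)) *
  ((1 + t) `^ rho / (1 + t0) `^ (rho - 1))%:C *
  det2 (hankel_minus rho ((1 + t0) * enorm xi))
       (hankel_minus rho ((1 + t) * enorm xi))
       (hankel_plus rho ((1 + t0) * enorm xi))
       (hankel_plus rho ((1 + t) * enorm xi)).

End Hankel.

(* Main.v *)
(* Multiplying the equation by cos (x.xi) or sin (x.xi) and integrating turns it
   into the ordinary differential equation
     h'' + mu / (1 + t) h' + |xi|^2 h = 0
   for the real and imaginary parts of the transform; its solutions are
   combinations of (1 + t)^rho J_rho((1 + t)|xi|) and
   (1 + t)^rho Y_rho((1 + t)|xi|), and the Wronskian of J and Y gives the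
   coefficients.

   The integrations by parts need decay of the solution, which is not assumed.
   It is propagated from the data by an energy estimate whose weight is a power
   of Q = 1 + |x|^2 cut off at Q = N exp(-2t): the cutoff retreats fast enough
   for the weight to absorb the energy flux, and N -> oo gives the weighted
   integrability at later times.
   With a cutoff at Q = N the equation for h then holds up to O(1/N).

   For integer rho the function Y_rho is itself a limit of Y_a, a -> rho.
   Rather than differentiating this limit, h is compared with the solution of the
   equation of non-integer order a; by a Gronwall estimate they differ by
   O(1/N + |a - rho|).  The existence of the limit follows from the
   differentiability of 1/Gamma, obtained from Gauss's limit. *)

Require Import Defs.
From mathcomp Require Import all_boot all_order all_algebra.
From mathcomp Require Import all_classical all_reals all_analysis.
From mathcomp Require Import measurable_realfun complex ring lra zify.
Import Order.TTheory GRing.Theory Num.Theory numFieldNormedType.Exports.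
Local Open Scope classical_set_scope.
Local Open Scope ring_scope.

(** * Differential calculus along a direction *)

(** The Wronskian of J and Y supplies both Cauchy data of the combination of the multipliers. Its
    value rests on the reflection formula for 1/Gamma, which is why Euler's product for the sine is
    derived.

    A change of order is a change of damping: (1 + t)^a C_a((1 + t) s), with C_a a Bessel function
    of order a, solves the equation with 1 - 2a in place of mu. In the comparison of orders the
    discrepancy is therefore a forcing term (1 - 2a - mu) / (1 + t) h', and h' is bounded on [0, T]
    uniformly in the cutoff. The multipliers then need to converge in a only at each fixed t.

    The rate in exp(-2t) comes from |grad Q| = 2|x| <= Q: the level Q = N exp(-2t) moves inwards
    with dQ/dt = -2Q, faster than the characteristic cones, for which dQ/dt = -2|x|. The powers of Q
    in the weight cost only a power of exp(t), harmless on [0, T].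

    All cutoffs are squares of positive parts: they are C^1, which is enough since each integration
    by parts puts a single derivative on the cutoff. *)

Section Calculus.
Context {R : realType}.

(* [is_derive] is a type class, whose premises [apply:] would try to infer. *)
Definition has_derive {V : normedModType R} (x v : V) (f : V -> R) (df : R) : Prop :=
  is_derive x v f df.

Section Direction.
Context {V : normedModType R}.
Implicit Types (f g : V -> R) (x v : V).

(** Restriction to a line reduces directional derivatives to one variable, where the chain rule and
    changes of variable are available. *)
Lemma has_derive_line f x v (df : R) :
  has_derive x v f df <-> has_derive (0 : R) (1 : R) (fun h => f (h *: v + x)) df.
Proof.
have E : 'D_v f x = 'D_1 (fun h : R => f (h *: v + x)) 0.
  rewrite /derive; set a := (X in fmap X); set b := (X in _ = lim (fmap X _)).
  suff -> : a = b by [].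
  rewrite /a /b; apply/funext => h /=.
  by rewrite scale0r add0r addr0 scaler1.
split=> -[d1 d2]; split.
- exact: (proj1 (derivable1P f x v) d1).
- by rewrite -E.
- exact: (proj2 (derivable1P f x v) d1).
- by rewrite E.
Qed.

Lemma has_derive_add f g x v (df dg : R) :
  has_derive x v f df -> has_derive x v g dg ->
  has_derive x v (fun y => f y + g y) (df + dg).
Proof. by move=> ? ?; exact: is_deriveD. Qed.

Lemma has_derive_sub f g x v (df dg : R) :
  has_derive x v f df -> has_derive x v g dg ->
  has_derive x v (fun y => f y - g y) (df - dg).
Proof. by move=> ? ?; exact: is_deriveB. Qed.

Lemma has_derive_opp f x v (df : R) :
  has_derive x v f df -> has_derive x v (fun y => - f y) (- df).
Proof. by move=> ?; exact: is_deriveN. Qed.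

Lemma has_derive_mul f g x v (df dg : R) :
  has_derive x v f df -> has_derive x v g dg ->
  has_derive x v (fun y => f y * g y) (f x * dg + g x * df).
Proof. by move=> ? ?; exact: is_deriveM. Qed.

Lemma has_derive_comp (h : R -> R) f x v (a df : R) :
  has_derive (f x) 1 h a -> has_derive x v f df ->
  has_derive x v (fun y => h (f y)) (a * df).
Proof.
move=> hh /has_derive_line hf; apply/has_derive_line.
apply: (@is_derive1_comp _ h (fun t => f (t *: v + x))) => //.
by rewrite scale0r add0r.
Qed.

Lemma has_derive_exp f x v (df : R) n :
  has_derive x v f df ->
  has_derive x v (fun y => f y ^+ n) (n%:R * f x ^+ n.-1 * df).
Proof.
move=> hf; apply: (@has_derive_comp (fun u => u ^+ n)) => //.
split; first exact: exprn_derivable.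
by rewrite exp_derive scaler1.
Qed.

Lemma has_derive_cst (a : R) x v : has_derive x v (fun _ : V => a) 0.
Proof. exact: is_derive_cst. Qed.

Lemma has_derive_eq f x v (df df' : R) :
  has_derive x v f df -> df = df' -> has_derive x v f df'.
Proof. by move=> ? <-. Qed.

Lemma has_derive_inv f x v (df : R) : f x != 0 -> has_derive x v f df ->
  has_derive x v (fun y => (f y)^-1) (- df / f x ^+ 2).
Proof.
move=> fx0 hf; have := has_derive_comp (fun u => u^-1) f x v _ df _ hf.
rewrite mulNr mulrC -mulNr; apply; split.
  by apply: derivableV => //; exact: derivable_id.
by rewrite deriveV ?derive_id ?scaler1//; exact: derivable_id.
Qed.

Lemma has_derive_bigsum (I : Type) (r : seq I) (P : pred I) (f : I -> V -> R)
    (df : I -> R) x v : (forall i, has_derive x v (f i) (df i)) ->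
  has_derive x v (fun y => \sum_(i <- r | P i) f i y) (\sum_(i <- r | P i) df i).
Proof.
move=> fdf; elim: r => [|i r IH].
  rewrite big_nil (_ : (fun y => _) = cst 0); first exact: is_derive_cst.
  by apply/funext => y; rewrite big_nil.
rewrite big_cons; case: ifPn => Pi; last first.
  by rewrite (_ : (fun y => _) = (fun y => \sum_(j <- r | P j) f j y))//;
    apply/funext => y; rewrite big_cons (negPf Pi).
rewrite (_ : (fun y => _) = (fun y => f i y + \sum_(j <- r | P j) f j y)).
  exact: has_derive_add.
by apply/funext => y; rewrite big_cons Pi.
Qed.

End Direction.

Implicit Types (f F : R -> R).

Lemma has_derive_idr (x v : R) : has_derive x v (fun y => y) v.
Proof. exact: is_derive_id. Qed.

Lemma has_derive_cos (x : R) : has_derive x 1 (@cos R) (- sin x).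
Proof. exact: is_derive_cos. Qed.

Lemma has_derive_sin (x : R) : has_derive x 1 (@sin R) (cos x).
Proof. exact: is_derive_sin. Qed.


Lemma has_derive1_continuous f (x df : R) :
  has_derive x 1 f df -> {for x, continuous f}.
Proof.
by move=> [h _]; apply/differentiable_continuous/derivable1_diffP.
Qed.

Lemma MVT_all f (df : R -> R) (a b : R) :
  (forall x : R, has_derive x 1 f (df x)) ->
  exists2 c, Num.min a b <= c <= Num.max a b & f b - f a = df c * (b - a).
Proof.
move=> fdf.
have H (u w : R) : u <= w -> exists2 c, u <= c <= w & f w - f u = df c * (w - u).
  move=> uw; have [||c cuw ->] := @MVT_segment _ f df u w uw.
  - by move=> x _; exact: fdf.
  - by apply: continuous_subspaceT => x; exact: has_derive1_continuous (fdf x).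
  - by exists c => //; rewrite in_itv in cuw.
have [ab|/ltW ba] := leP a b; first exact: H.
have [c cab E] := H b a ba; exists c => //.
by rewrite -[LHS]opprB E -mulrN opprB.
Qed.

Lemma sin_sqr_le (x : R) : sin x ^+ 2 <= x ^+ 2.
Proof.
have [c _] := @MVT_all _ _ 0 x (fun y => has_derive_sin y).
rewrite sin0 !subr0 => ->; rewrite exprMn ler_piMl ?sqr_ge0//.
Qed.

Lemma one_sub_cos_le (x : R) : 1 - cos x <= x ^+ 2 / 2.
Proof.
have -> : cos x = 1 - 2 * sin (x / 2) ^+ 2.
  rewrite {1}(_ : x = (x / 2) *+ 2); last by rewrite mulr2n; lra.
  by have := cos2Dsin2 (x / 2); rewrite cos_mulr2n mulr2n; lra.
have := sin_sqr_le (x / 2); rewrite [(x / 2) ^+ 2]exprMn exprVn; lra.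
Qed.

Lemma integral_FTC2 f F (a b : R) : a < b -> continuous f ->
  (forall t : R, has_derive t 1 F (f t)) ->
  (\int[lebesgue_measure]_(t in `[a, b]) (f t)%:E = (F b - F a)%:E)%E.
Proof.
move=> ab cf dF; rewrite (@continuous_FTC2 _ f F)//.
- exact: continuous_subspaceT.
- split.
  + by move=> x _; case: (dF x).
  + apply: cvg_at_right_filter; exact: has_derive1_continuous (dF a).
  + apply: cvg_at_left_filter; exact: has_derive1_continuous (dF b).
- by move=> x _; rewrite derive1E; case: (dF x).
Qed.

Lemma Rintegral_FTC2 f F (a b : R) : a < b -> continuous f ->
  (forall t : R, has_derive t 1 F (f t)) ->
  (\int[lebesgue_measure]_(t in `[a, b]) f t)%R = F b - F a.
Proof. by move=> ab cf dF; rewrite /Rintegral (integral_FTC2 _ _ _ _ ab cf dF). Qed.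

Lemma continuous_integrable_itv f (a b : R) : continuous f ->
  (@lebesgue_measure R).-integrable `[a, b] (EFin \o f).
Proof.
move=> cf; apply: continuous_compact_integrable; first exact: segment_compact.
exact: continuous_subspaceT.
Qed.

End Calculus.

Ltac derive_step := first
  [ apply: has_derive_cst | apply: has_derive_idr
  | apply: has_derive_add | apply: has_derive_sub | apply: has_derive_opp
  | apply: has_derive_exp | apply: has_derive_mul ].

(** * The reciprocal Gamma function *)

Section GaussLimit.
Context {R : realType}.
Implicit Types (x y : R) (m n : nat).

Definition gauss_seq x m : R :=
  m`!%:R * m%:R `^ x / \prod_(0 <= k < m.+1) (x + k%:R).

Lemma gauss_seqD1 x m : x != 0 -> x + m.+2%:R != 0 ->
  gauss_seq (x + 1) m.+1 = gauss_seq x m.+1 * (x * m.+1%:R / (x + m.+2%:R)).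
Proof.
move=> x0 xm; rewrite /gauss_seq powRD ?pnatr_eq0 ?implybT// powRr1//.
have -> : \prod_(0 <= k < m.+2) (x + 1 + k%:R) =
    \prod_(0 <= k < m.+2) (x + k%:R) * (x + m.+2%:R) / x.
  rewrite -big_nat_recr//= [in RHS]big_nat_recl//= addr0 mulrAC mulfV// mul1r.
  by apply: eq_bigr => i _; rewrite -addrA nat1r.
rewrite !invfM invrK.
have H (a b c d e : R) : c * (d * e) * (a / b * x) = c * d * a * (x * e / b).
  by ring.
exact: H.
Qed.

Lemma cvg_gauss_ratio x : (x + m.+2%:R) / m.+1%:R @[m --> \oo] --> (1 : R).
Proof.
have -> : (fun m => (x + m.+2%:R) / m.+1%:R) =
    (fun m => (x + 1) * (harmonic m : R) + 1).
  apply/funext => m; rewrite /harmonic /=.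
  have -> : m.+2%:R = 1 + m.+1%:R :> R by rewrite nat1r.
  by rewrite addrA mulrDl mulfV ?pnatr_eq0.
rewrite -[X in _ --> X]add0r -[X in _ --> X + _](mulr0 (x + 1)).
by apply: cvgD; [apply: cvgMl_tmp; exact: cvg_harmonic|exact: cvg_cst].
Qed.

Lemma near_natD_neq0 x : \forall m \near \oo, x + m.+2%:R != 0 :> R.
Proof.
near=> m; rewrite gt_eqF// -ltrBlDl sub0r (le_lt_trans (ler_norm _))//.
rewrite normrN (@lt_trans _ _ m%:R) ?ltr_nat//; near: m; exact: nbhs_infty_gtr.
Unshelve. all: by end_near. Qed.

Lemma gauss_seq_cvgD1 x (l : R) : x != 0 -> gauss_seq x @ \oo --> l ->
  gauss_seq (x + 1) @ \oo --> x * l.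
Proof.
move=> x0 cl; rewrite -cvg_shiftS/=.
have H : (fun m => gauss_seq x m.+1 * (x * ((x + m.+2%:R) / m.+1%:R)^-1))
    @ \oo --> l * (x * 1^-1).
  apply: cvgM; first by rewrite (cvg_shiftS (gauss_seq x)).
  by apply: cvgMl_tmp; apply: cvgV => //; exact: cvg_gauss_ratio.
rewrite invr1 mulr1 mulrC in H; apply: cvg_trans H; apply: near_eq_cvg.
have := near_natD_neq0 x; apply: filterS => m xm.
by rewrite gauss_seqD1// invf_div -[x * _ / _]mulrA.
Qed.

Lemma gauss_seq_cvgB1 x (l : R) : x != 0 -> gauss_seq (x + 1) @ \oo --> l ->
  gauss_seq x @ \oo --> l / x.
Proof.
move=> x0 cl; rewrite -cvg_shiftS/=.
have H : (fun m => gauss_seq (x + 1) m.+1 * (x^-1 * ((x + m.+2%:R) / m.+1%:R)))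
    @ \oo --> l * (x^-1 * 1).
  apply: cvgM; first by rewrite (cvg_shiftS (gauss_seq (x + 1))).
  by apply: cvgMl_tmp; exact: cvg_gauss_ratio.
rewrite mulr1 in H; apply: cvg_trans H; apply: near_eq_cvg.
have := near_natD_neq0 x; apply: filterS => m xm.
rewrite gauss_seqD1//; set G := gauss_seq _ _.
have m0 : m.+1%:R != 0 :> R by rewrite pnatr_eq0.
move: m0 xm; move: (m.+1%:R) (x + _) => a b a0 b0; by field; rewrite a0 b0 x0.
Qed.

Lemma gauss_seq0 m : gauss_seq 0 m = 0.
Proof. by rewrite /gauss_seq big_nat_recl//= addr0 mul0r invr0 mulr0. Qed.

Lemma gauss_seq_prod_gt0 x m : 0 < x -> 0 < \prod_(0 <= k < m) (x + k%:R).
Proof. by move=> x0; apply: prodr_gt0 => i _; rewrite ltr_wpDr. Qed.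

Lemma gauss_seq_gt0 x m : 0 < x -> 0 < gauss_seq x m.+1.
Proof.
move=> x0; rewrite /gauss_seq divr_gt0// ?gauss_seq_prod_gt0// mulr_gt0//.
Qed.

Lemma gauss_seqS x m : 0 < x -> gauss_seq x m.+2 =
  gauss_seq x m.+1 * ((1 + m.+1%:R^-1) `^ x / (1 + x / m.+2%:R)).
Proof.
move=> x0; rewrite /gauss_seq big_nat_recr//= factS natrM.
have m10 : 0 < m.+1%:R :> R by rewrite ltr0n.
have m20 : 0 < m.+2%:R :> R by rewrite ltr0n.
have -> : m.+2%:R `^ x = m.+1%:R `^ x * (1 + m.+1%:R^-1) `^ x.
  rewrite -powRM ?ler0n ?addr_ge0 ?invr_ge0//; congr (_ `^ _).
  by rewrite mulrDr mulfV ?gt_eqF// mulr1 natr1.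
have xm : x + m.+2%:R != 0 by rewrite gt_eqF// addr_gt0.
have PP := lt0r_neq0 (gauss_seq_prod_gt0 x m.+2 x0).
set P := \prod_(_ <= _ < _) _ in PP *.
have -> : 1 + x / m.+2%:R = (x + m.+2%:R) / m.+2%:R.
  by rewrite mulrDl mulfV ?gt_eqF// addrC.
move: m20 xm PP; rewrite -natr1; move: (m.+1%:R : R) (x + _) P => a b P.
move=> /lt0r_neq0 a0 b0 P0.
by field; rewrite a0 b0 P0.
Qed.

Lemma powR1D_ge x u : 0 < u -> 0 <= x -> 1 + x * (u / (1 + u)) <= (1 + u) `^ x.
Proof.
move=> u0 x0; have u1 : 0 < 1 + u by rewrite addr_gt0.
rewrite /powR gt_eqF// (le_trans _ (expR_ge1Dx _))// lerD2l ler_wpM2l//.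
have -> : u / (1 + u) = 1 - (1 + u)^-1 by field; rewrite gt_eqF.
have := @le_ln1Dx R ((1 + u)^-1 - 1).
rewrite ltrBDr addNr invr_gt0 u1 addrC subrK => /(_ erefl).
by rewrite lnV ?posrE// => H; rewrite -lerN2 opprB.
Qed.

Lemma powR1D_le x u : 0 <= u -> 0 <= x <= 1 -> (1 + u) `^ x <= 1 + x * u.
Proof.
move=> u0 /andP[x0 x1].
have u1 : 0 < 1 + u by rewrite ltr_pwDl.
have xu1 : 0 < 1 + x * u by rewrite ltr_pwDl// mulr_ge0.
rewrite /powR gt_eqF// -[leRHS]lnK ?posrE// ler_expR.
have H : x * ln (1 + u) + (1 - x) * ln 1 <= ln (x * (1 + u) + (1 - x) * 1).
  exact: concave_ln (Itv01 x0 x1) _ _ u1 ltr01.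
rewrite ln1 mulr0 addr0 in H; apply: le_trans H _.
by rewrite (_ : x * (1 + u) + _ = 1 + x * u)//; ring.
Qed.

(** The ratio of consecutive terms is (1 + 1/(m+1))^x / (1 + x/(m+2)). By [powR1D_ge] it is at least
    1, so the sequence increases; by [powR1D_le] the product with 1 + x/(m+1) decreases, which
    bounds the sequence. *)
Lemma gauss_seq_cvg01 x : 0 < x <= 1 ->
  exists2 l : R, 0 < l & gauss_seq x @ \oo --> l.
Proof.
move=> /andP[x0 x1].
pose v m : R := gauss_seq x m.+1.
have nd : nondecreasing_seq v.
  apply/nondecreasing_seqP => m; rewrite /v gauss_seqS//.
  apply: ler_peMr; first by rewrite ltW ?gauss_seq_gt0.
  rewrite ler_pdivlMr ?mul1r; last first.
    by rewrite addr_gt0// divr_gt0.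
  have := @powR1D_ge x m.+1%:R^-1; rewrite invr_gt0 ltr0n => /(_ erefl (ltW x0)).
  apply: le_trans; rewrite lerD2l ler_wpM2l ?(ltW x0)//.
  rewrite le_eqVlt; apply/orP; left; apply/eqP.
  have -> : m.+2%:R = m.+1%:R + 1 :> R by rewrite natr1.
  have : 0 < m.+1%:R :> R by rewrite ltr0n.
  move: (m.+1%:R : R) => a a0; field; by rewrite !gt_eqF ?addr_gt0.
have ub m : v m * (1 + x / m.+1%:R) <= v 0 * (1 + x).
  elim: m => [|m IH]; first by rewrite divr1.
  apply: le_trans IH; rewrite /v gauss_seqS// -[leLHS]mulrA.
  rewrite ler_wpM2l//; first exact/ltW/gauss_seq_gt0.
  rewrite mulfVK; first by apply: powR1D_le; rewrite ?invr_ge0 ?(ltW x0).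
  by rewrite gt_eqF// addr_gt0// divr_gt0.
have bd : has_ubound (range v).
  exists (v 0 * (1 + x)) => _ [m _ <-]; apply: le_trans (ub m).
  by rewrite ler_peMr ?ltW ?gauss_seq_gt0// ltrDl divr_gt0.
have cv := nondecreasing_cvgn nd bd.
exists (sup (range v)); last by rewrite -cvg_shiftS.
apply: lt_le_trans (gauss_seq_gt0 x 0 x0) _.
by apply: ub_le_sup => //; exists 0%N.
Qed.

(** Convergence on ]0, 1] is carried to the line by integer steps in both directions, through the
    functional equation of the sequence. *)
Lemma gauss_seq_cvg x : cvgn (gauss_seq x).
Proof.
have base y : 0 < y <= 1 -> cvgn (gauss_seq y).
  by move=> /gauss_seq_cvg01[l _] h; apply/cvg_ex; exists l.
have up n y : 0 < y <= 1 -> cvgn (gauss_seq (y + n%:R)).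
  move=> y01; elim: n => [|n /cvg_ex[l IH]]; first by rewrite addr0; exact: base.
  apply/cvg_ex; exists ((y + n%:R) * l); rewrite -natr1 addrA.
  apply: gauss_seq_cvgD1 => //; rewrite gt_eqF// ltr_wpDr//.
  by case/andP : y01.
have down n y : 0 < y <= 1 -> cvgn (gauss_seq (y - n%:R)).
  move=> y01; elim: n => [|n /cvg_ex[l IH]]; first by rewrite subr0; exact: base.
  (* The downward step divides by the argument and breaks down at 0; there the convention 0^-1 = 0
     makes the sequence vanish identically. *)
  have [->|yn] := eqVneq (y - n.+1%:R) 0.
    rewrite (_ : gauss_seq 0 = cst 0); first exact: is_cvg_cst.
    by apply/funext => m; exact: gauss_seq0.
  apply/cvg_ex; exists (l / (y - n.+1%:R)).
  by apply: gauss_seq_cvgB1 => //; rewrite -natr1 opprD addrA subrK.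
have /andP[fx xf] := archimedean.Num.Theory.ceil_itv x.
pose y := x - (Num.ceil x)%:~R + 1.
have y01 : 0 < y <= 1.
  apply/andP; split; last by rewrite gerDr subr_le0.
  by rewrite /y; move: fx; rewrite intrD; lra.
have -> : x = y + (Num.ceil x - 1)%:~R by rewrite /y intrD; ring.
case: (Num.ceil x - 1) => n; first by apply: up.
by rewrite NegzE intrN; exact: down.
Qed.

Definition rGamma x : R := (Gamma x)^-1.

Lemma GammaD1 x : x != 0 -> Gamma (x + 1) = x * Gamma x.
Proof.
move=> x0; apply/cvg_lim => //; apply: gauss_seq_cvgD1 => //.
exact: gauss_seq_cvg.
Qed.

Lemma Gamma0 : Gamma 0 = 0 :> R.
Proof.
rewrite /Gamma -/(gauss_seq 0); apply/cvg_lim => //.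
rewrite (_ : gauss_seq 0 = cst 0); first exact: cvg_cst.
by apply/funext => m; exact: (gauss_seq0 m).
Qed.

(** In contrast to [GammaD1] there is no exceptional point: at x = 0 both sides vanish, because
    [Gamma 0] is 0 by convention. Recurrences in the order can then be used without excluding
    poles. *)
Lemma rGamma_rec x : rGamma x = x * rGamma (x + 1).
Proof.
rewrite /rGamma; have [->|x0] := eqVneq x 0; first by rewrite Gamma0 invr0 mul0r.
by rewrite GammaD1// invfM mulrA mulfV// mul1r.
Qed.

Lemma rGamma_gt0 x : 0 < x -> 0 < rGamma x.
Proof.
move=> x0; rewrite invr_gt0.
have base y : 0 < y <= 1 -> 0 < Gamma y.
  by move=> /gauss_seq_cvg01[l l0 /cvg_lim h]; rewrite /Gamma h.
have up n y : 0 < y <= 1 -> 0 < Gamma (y + n%:R).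
  move=> y01; have y0 : 0 < y by case/andP : y01.
  elim: n => [|n IH]; first by rewrite addr0; exact: base.
  rewrite -natr1 addrA GammaD1 ?mulr_gt0// ?gt_eqF// ltr_wpDr//.
have /andP[fx xf] := archimedean.Num.Theory.ceil_itv x.
pose y := x - (Num.ceil x)%:~R + 1.
have y01 : 0 < y <= 1.
  apply/andP; split; last by rewrite gerDr subr_le0.
  by rewrite /y; move: fx; rewrite intrD; lra.
have -> : x = y + (Num.ceil x - 1)%:~R by rewrite /y intrD; ring.
have : 0 <= Num.ceil x - 1.
  by rewrite subr_ge0 -gtz0_ge1 ceil_gt0.
by case: (Num.ceil x - 1) => // n _; exact: up.
Qed.

End GaussLimit.

(** * Euler's sine product and the reflection formula *)

Section SineProduct.
Context {R : realType}.
Implicit Types (x y t : R) (m n : nat).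

Lemma has_derive_cosM y t : has_derive t 1 (fun s => cos (y * s)) (- (y * sin (y * t))).
Proof.
have d : has_derive t 1 (fun s : R => y * s) (y * 1 + t * 0).
  by apply: has_derive_mul; [exact: has_derive_cst|exact: has_derive_idr].
have := has_derive_comp _ _ _ _ _ _ (has_derive_cos (y * t)) d.
by rewrite mulr0 addr0 mulr1 mulNr mulrC.
Qed.

Lemma has_derive_sinM y t : has_derive t 1 (fun s => sin (y * s)) (y * cos (y * t)).
Proof.
have d : has_derive t 1 (fun s : R => y * s) (y * 1 + t * 0).
  by apply: has_derive_mul; [exact: has_derive_cst|exact: has_derive_idr].
have := has_derive_comp _ _ _ _ _ _ (has_derive_sin (y * t)) d.
by rewrite mulr0 addr0 mulr1 mulrC.
Qed.

Let wallis_fun y n t : R := cos (y * t) * cos t ^+ n.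

Lemma continuous_wallis_fun y n : continuous (wallis_fun y n).
Proof.
move=> t; apply: has_derive1_continuous.
by apply: has_derive_mul; [exact: has_derive_cosM|
  apply: has_derive_exp; exact: has_derive_cos].
Qed.

(** Wallis's integral of cos^n with an additional factor cos(y t). The recursion in n produces the
    factors of the sine product, and the concentration of cos^n near 0 makes the dependence on y
    disappear in the limit. *)
Definition wallis y n : R :=
  (\int[lebesgue_measure]_(t in `[0, pi / 2]) wallis_fun y n t)%R.

Let pihalf_gt0 : 0 < pi / 2 :> R. Proof. by rewrite divr_gt0// pi_gt0. Qed.

(** Integrations by parts on [0, pi/2] are carried out by exhibiting the antiderivative [F] of the
    combined integrand. *)
Lemma wallis_lin y z n m (a b : R) F :
  (forall t : R, has_derive t 1 F (a * wallis_fun y n t + b * wallis_fun z m t)) ->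
  a * wallis y n + b * wallis z m = F (pi / 2) - F 0.
Proof.
move=> dF; rewrite -(Rintegral_FTC2 _ _ _ _ pihalf_gt0 _ dF); last first.
  move=> t; apply: cvgD; apply: cvgMl_tmp; exact: continuous_wallis_fun.
have H (c w : R) k : (@lebesgue_measure R).-integrable `[0, pi / 2]
    (EFin \o (fun t => c * wallis_fun w k t)).
  apply: continuous_integrable_itv => t; apply: cvgMl_tmp; exact: continuous_wallis_fun.
have I w k : (@lebesgue_measure R).-integrable `[0, pi / 2]
    (EFin \o (fun t => wallis_fun w k t)).
  exact/continuous_integrable_itv/continuous_wallis_fun.
by rewrite RintegralD// ?RintegralZl.
Qed.

(** The antiderivative collects the boundary terms of two integrations by parts; it vanishes at 0
    and at pi/2. *)
Lemma wallis_rec y n :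
  (n.+2%:R ^+ 2 - y ^+ 2) * wallis y n.+2 = n.+2%:R * n.+1%:R * wallis y n.
Proof.
have := @wallis_lin y y n.+2 n (y ^+ 2 - n.+2%:R ^+ 2) (n.+2%:R * n.+1%:R)
  (fun t => y * (sin (y * t) * cos t ^+ n.+2) -
    n.+2%:R * (cos (y * t) * (cos t ^+ n.+1 * sin t))).
rewrite mulr0 sin0 cos_pihalf !expr0n/= !(mulr0, mul0r) subrr => H.
apply/eqP; rewrite -subr_eq0 -oppr_eq0 -[X in _ == X]H; last first.
  move=> t; apply: has_derive_eq.
    by repeat first [exact: has_derive_sinM|exact: has_derive_cosM|
      exact: has_derive_cos|exact: has_derive_sin|derive_step].
  rewrite /wallis_fun /= !exprS.
  have : sin t * sin t = 1 - cos t * cos t.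
    by have := @cos2Dsin2 R t; rewrite !expr2 => <-; ring.
  move: (sin t) (cos t) (sin (y * t)) (cos (y * t)) => s c s' c' ss.
  have -> : n.+2%:R = n.+1%:R + 1 :> R by rewrite natr1.
  move: (n.+1%:R : R) (c ^+ n) => N C.
  have -> : s * (N * C * - s) = - (N * C) * (1 - c * c) by rewrite -ss; ring.
  rewrite expr0; ring.
by apply/eqP; ring.
Qed.

Lemma wallis0_rec n : n.+2%:R * wallis 0 n.+2 = n.+1%:R * wallis 0 n.
Proof.
have := wallis_rec 0 n; rewrite expr0n/= subr0 expr2 -!mulrA.
by apply: mulfI; rewrite pnatr_eq0.
Qed.

Lemma wallis00 : wallis 0 0 = pi / 2.
Proof.
have := @wallis_lin 0 0 0 0 1 0 id; rewrite mul1r mul0r addr0 subr0; apply => t.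
apply: has_derive_eq; first exact: has_derive_idr.
by rewrite /wallis_fun !mul0r cos0 expr0 addr0 !mulr1.
Qed.

Lemma wallisy0 y : y * wallis y 0 = sin (y * (pi / 2)).
Proof.
have := @wallis_lin y 0 0 0 y 0 (fun t => sin (y * t)).
rewrite mul0r addr0 mulr0 sin0 subr0; apply => t.
apply: has_derive_eq; first exact: has_derive_sinM.
by rewrite /wallis_fun mul0r addr0 expr0 !mulr1.
Qed.

Lemma wallis0_gt0 m : 0 < wallis 0 m.*2.
Proof.
elim: m => [|m IH]; first by rewrite wallis00.
rewrite doubleS -(pmulr_rgt0 _ (ltr0Sn _ m.*2.+1)) wallis0_rec.
by rewrite mulr_gt0// ltr0n.
Qed.

Lemma mul_cos_le_sin t : 0 <= t <= pi / 2 -> t * cos t <= sin t.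
Proof.
move=> /andP[t0 tpi].
have d (x : R) : has_derive x 1 (fun x => sin x - x * cos x) (x * sin x).
  apply: has_derive_eq.
    by repeat first [exact: has_derive_cos|exact: has_derive_sin|derive_step].
  by rewrite /=; ring.
have [c] := MVT_all _ _ 0 t d.
rewrite min_l// max_r// => /andP[c0 ct]; rewrite sin0 mul0r !subr0 => E.
rewrite -subr_ge0 E !mulr_ge0// sin_ge0_pi// c0/=.
by rewrite (le_trans ct)// (le_trans tpi)// ler_pdivrMr// ler_peMr// ?pi_ge0// ler1n.
Qed.

(** From 1 - cos(y t) <= (y t)^2 / 2 and t cos t <= sin t: the factor t^2 cos^(n+2) is at most sin^2
    cos^n = cos^n - cos^(n+2), so that the error is controlled by Wallis integrals with y = 0. *)
Lemma wallis_near y n :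
  `|wallis 0 n.+2 - wallis y n.+2| <= y ^+ 2 / 2 * (wallis 0 n - wallis 0 n.+2).
Proof.
have ifun w k : (@lebesgue_measure R).-integrable `[0, pi / 2]
    (EFin \o (fun t => wallis_fun w k t)).
  exact/continuous_integrable_itv/continuous_wallis_fun.
have cB w w' k k' : continuous (fun t => wallis_fun w k t - wallis_fun w' k' t).
  by move=> t; apply: cvgB; exact: continuous_wallis_fun.
have -> : wallis 0 n.+2 - wallis y n.+2 = (\int[lebesgue_measure]_(t in `[0, pi / 2])
    (wallis_fun 0 n.+2 t - wallis_fun y n.+2 t))%R by rewrite RintegralB.
have -> : wallis 0 n - wallis 0 n.+2 = (\int[lebesgue_measure]_(t in `[0, pi / 2])
    (wallis_fun 0 n t - wallis_fun 0 n.+2 t))%R by rewrite RintegralB.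
rewrite -RintegralZl//; last exact/continuous_integrable_itv/cB.
have bnd t : 0 <= t <= pi / 2 -> 0 <= wallis_fun 0 n.+2 t - wallis_fun y n.+2 t <=
    y ^+ 2 / 2 * (wallis_fun 0 n t - wallis_fun 0 n.+2 t).
  move=> tI; have ct : 0 <= cos t.
    apply: cos_ge0_pihalf; case/andP : tI => t0 ->; rewrite andbT.
    by rewrite (le_trans _ t0)// oppr_le0 ltW.
  rewrite /wallis_fun mul0r cos0 !mul1r -[X in X - _]mul1r -mulrBl.
  rewrite mulr_ge0 ?subr_ge0 ?cos_le1 ?exprn_ge0//=.
  have /(ler_wpM2r (exprn_ge0 n.+2 ct)) := one_sub_cos_le (y * t).
  move=> /le_trans; apply.
  have : (t * cos t) ^+ 2 <= sin t ^+ 2.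
    rewrite lerXn2r ?nnegrE ?mul_cos_le_sin// ?mulr_ge0//; first by case/andP : tI.
    apply: le_trans (mul_cos_le_sin _ tI); rewrite mulr_ge0//; by case/andP : tI.
  have -> : sin t ^+ 2 = 1 - cos t ^+ 2 by have := cos2Dsin2 t; lra.
  move=> /(ler_wpM2l (sqr_ge0 y)) /(ler_wpM2r (exprn_ge0 n ct)).
  rewrite -[n.+2]addn2 exprD; lra.
have tI t : t \in `[0, pi / 2]%classic -> 0 <= t <= pi / 2.
  by move/set_mem; rewrite /= in_itv.
rewrite ger0_norm; last first.
  by apply: Rintegral_ge0 => t /mem_set /tI /bnd /andP[].
apply: le_Rintegral => //.
- exact/continuous_integrable_itv/cB.
- by apply: continuous_integrable_itv => t; apply: cvgMl_tmp; exact: cB.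
- by move=> t /mem_set /tI /bnd /andP[].
Qed.

(** The recursion for y divided by the one for 0 leaves the factor 1 - y^2 / (2m+2)^2, which is the
    factor of index m + 1 in the product. *)
Lemma wallis_prod y m :
  wallis y m.*2 * \prod_(1 <= k < m.+1) (1 - (y / 2) ^+ 2 / k%:R ^+ 2) =
  wallis 0 m.*2 * (wallis y 0 / (pi / 2)).
Proof.
elim: m => [|m IH].
  by rewrite big_geq// mulr1 wallis00 mulrC mulfVK// gt_eqF.
rewrite big_nat_recr//= doubleS mulrCA.
have N0 : m.*2.+2%:R != 0 :> R by rewrite pnatr_eq0.
have E1 : wallis y m.*2.+2 * (1 - (y / 2) ^+ 2 / m.+1%:R ^+ 2) =
    m.*2.+1%:R / m.*2.+2%:R * wallis y m.*2.
  apply: (mulfI (expf_neq0 2 N0)).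
  transitivity (m.*2.+2%:R * m.*2.+1%:R * wallis y m.*2); last first.
    by rewrite expr2; move: N0; move: (m.*2.+2%:R) => N N0; field.
  rewrite -wallis_rec mulrCA [RHS]mulrC; congr (_ * _).
  have -> : m.*2.+2%:R = 2 * m.+1%:R :> R by rewrite -natrM mul2n doubleS.
  by have : m.+1%:R != 0 :> R; [rewrite pnatr_eq0|move: (m.+1%:R) => N N1; field].
have E2 : wallis 0 m.*2.+2 = m.*2.+1%:R / m.*2.+2%:R * wallis 0 m.*2.
  apply: (mulfI N0); rewrite wallis0_rec.
  by move: N0; move: (m.*2.+2%:R) => N N0; field.
by rewrite E1 E2 -[RHS]mulrA -IH; ring.
Qed.

(** With y = 2x, the quotient of the integrals for y and for 0 tends to 1: by [wallis_near] its
    distance to 1 is at most (y^2 / 2) / (2m + 1). In [wallis_prod] only [wallis y 0], a sine, then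
    remains. *)
Lemma cvg_sine_product x : x != 0 ->
  \prod_(1 <= k < m.+1) (1 - x ^+ 2 / k%:R ^+ 2) @[m --> \oo] -->
  sin (pi * x) / (pi * x).
Proof.
move=> x0; pose y := 2 * x.
have r1 : wallis y m.+1.*2 / wallis 0 m.+1.*2 @[m --> \oo] --> (1 : R).
  apply/cvgrPdist_le => /= e e0.
  near=> m.
  have W0 := wallis0_gt0 m.+1.
  rewrite -(mulfV (lt0r_neq0 W0)) -mulrBl normrM normfV (gtr0_norm W0).
  rewrite ler_pdivrMr//; apply: (le_trans (wallis_near y m.*2)); rewrite -!doubleS.
  have -> : wallis 0 m.*2 = m.*2.+2%:R / m.*2.+1%:R * wallis 0 m.+1.*2.
    apply: (@mulfI _ m.*2.+1%:R); first by rewrite pnatr_eq0.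
    rewrite -wallis0_rec doubleS mulrA; congr (_ * _).
    by rewrite mulrCA mulfV ?mulr1// pnatr_eq0.
  rewrite -[X in _ - X]mul1r -mulrBl mulrA ler_wpM2r//; first exact: ltW.
  have -> : m.*2.+2%:R / m.*2.+1%:R - 1 = m.*2.+1%:R^-1 :> R.
    rewrite -natr1 mulrDl mulfV ?pnatr_eq0// mul1r; ring.
  rewrite ler_pdivrMr// -ler_pdivrMl//.
  apply: (@le_trans _ _ m%:R).
    by near: m; exact: nbhs_infty_ger.
  by rewrite ler_nat -addnn -addnS leq_addr.
have -> : sin (pi * x) / (pi * x) = wallis y 0 / (pi / 2) * 1^-1.
  have -> : wallis y 0 = sin (y * (pi / 2)) / y.
    by rewrite -wallisy0 [y * _]mulrC mulfK// mulf_neq0// pnatr_eq0.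
  rewrite /y (_ : 2 * x * (pi / 2) = pi * x); last by field.
  have : pi != 0 :> R by rewrite gt_eqF ?pi_gt0.
  by move: (pi : R) (sin _) => p q p0; field; rewrite ?p0 ?x0.
rewrite -(cvg_shiftS (fun m => \prod_(1 <= k < m.+1) (1 - x ^+ 2 / k%:R ^+ 2)))/=.
have : wallis y 0 / (pi / 2) * (wallis y m.+1.*2 / wallis 0 m.+1.*2)^-1
    @[m --> \oo] --> wallis y 0 / (pi / 2) * 1^-1.
  by apply: cvgMl_tmp; apply: cvgV => //; rewrite oner_neq0.
apply: cvg_trans; apply: near_eq_cvg; near=> m.
have wy0 : wallis y m.+1.*2 != 0.
  have : 1 / 2 < wallis y m.+1.*2 / wallis 0 m.+1.*2.
    near: m; apply: (cvgr_gt 1) => //; lra.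
  by apply: contraTneq => ->; rewrite mul0r -leNgt divr_ge0.
have := wallis_prod y m.+1; rewrite /y [2 * x / 2](_ : _ = x); last by field.
rewrite -/y => /(canRL (mulKf wy0)) ->.
have := lt0r_neq0 (wallis0_gt0 m.+1).
move: (wallis 0 _) (wallis y m.+1.*2) (wallis y 0 / _) wy0 => a b c b0 a0.
by field; rewrite ?a0 ?b0.
Unshelve. all: by end_near. Qed.

Lemma prod_natD x m : \prod_(0 <= k < m.+1) (x + k%:R) =
  x * (m`!%:R * \prod_(1 <= k < m.+1) (1 + x / k%:R)).
Proof.
rewrite big_nat_recl//= addr0; congr (_ * _).
elim: m => [|m IH]; first by rewrite !big_geq// mulr1.
rewrite big_nat_recr//= IH [in RHS]big_nat_recr//= factS natrM.
have : m.+1%:R != 0 :> R by rewrite pnatr_eq0.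
by move: (m.+1%:R : R) => N N0; field.
Qed.

(** The shift of the index by one leaves the boundary factor m + 1 - x, whose quotient by m tends to
    1. *)
Lemma prod_natDB x m : \prod_(0 <= k < m.+1) (1 - x + k%:R) =
  (m.+1%:R - x) * (m`!%:R * \prod_(1 <= k < m.+1) (1 - x / k%:R)).
Proof.
elim: m => [|m IH].
  by rewrite big_nat1 big_geq// addr0 !mulr1.
rewrite big_nat_recr//= IH [in RHS]big_nat_recr//= factS natrM.
have -> : 1 - x + m.+1%:R = m.+2%:R - x by rewrite -[m.+2%:R]natr1; ring.
have : m.+1%:R != 0 :> R by rewrite pnatr_eq0.
by move: (m.+1%:R : R) => N N0; field.
Qed.

Lemma rGamma_cvg x : 0 < x -> (gauss_seq x m)^-1 @[m --> \oo] --> rGamma x.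
Proof.
move=> x0; apply: cvgV; last exact: gauss_seq_cvg.
by have := rGamma_gt0 _ x0; rewrite /rGamma invr_gt0 => /lt0r_neq0.
Qed.

(** In the product of the reciprocal Gauss sequences of x and 1 - x, the factors 1 + x/k and 1 - x/k
    combine into those of the sine product. *)
Let rGamma_reflection01 x : 0 < x < 1 ->
  rGamma x * rGamma (1 - x) = sin (pi * x) / pi.
Proof.
move=> /andP[x0 x1].
have x1' : 0 < 1 - x by rewrite subr_gt0.
have c1 : (gauss_seq x m)^-1 * (gauss_seq (1 - x) m)^-1 @[m --> \oo] -->
    rGamma x * rGamma (1 - x) by apply: cvgM; exact: rGamma_cvg.
apply: (cvg_unique _ c1) => //=.
rewrite -cvg_shiftS/=.
have E m : (gauss_seq x m.+1)^-1 * (gauss_seq (1 - x) m.+1)^-1 =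
    ((- x + m.+2%:R) / m.+1%:R) *
    (x * \prod_(1 <= k < m.+2) (1 - x ^+ 2 / k%:R ^+ 2)).
  rewrite /gauss_seq prod_natD prod_natDB.
  have -> : \prod_(1 <= k < m.+2) (1 - x ^+ 2 / k%:R ^+ 2) =
      \prod_(1 <= k < m.+2) (1 + x / k%:R) * \prod_(1 <= k < m.+2) (1 - x / k%:R).
    rewrite -big_split/=; apply: eq_bigr => k _.
    by rewrite -exprVn -exprMn expr2; ring.
  rewrite !invfM !invrK.
  have -> : (m.+1%:R `^ (1 - x))^-1 = m.+1%:R `^ x / m.+1%:R :> R.
    by rewrite powRB ?pnatr_eq0 ?implybT// powRr1// invf_div.
  have : m.+1%:R `^ x != 0 :> R by rewrite gt_eqF// powR_gt0.
  have : m.+1`!%:R != 0 :> R by rewrite pnatr_eq0 -lt0n fact_gt0.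
  have : m.+1%:R != 0 :> R by rewrite pnatr_eq0.
  move: (m.+1%:R `^ x) (m.+1`!%:R : R) (m.+1%:R : R) => a b c c0 b0 a0.
  by field; rewrite a0 b0 c0.
under eq_fun do rewrite E.
have -> : sin (pi * x) / pi = 1 * (x * (sin (pi * x) / (pi * x))).
  have : pi != 0 :> R by rewrite gt_eqF ?pi_gt0.
  by move: (pi : R) (sin _) (lt0r_neq0 x0) => p q x00 p0; field; rewrite ?p0 ?x00.
apply: cvgM; first exact: cvg_gauss_ratio.
apply: cvgMl_tmp; rewrite (cvg_shiftS (fun m => \prod_(1 <= k < m.+1) (1 - x ^+ 2 / k%:R ^+ 2))).
by apply: cvg_sine_product; rewrite gt_eqF.
Qed.

(** Both sides change sign under x -> x + 1, so that the identity on [0, 1[ spreads to the line. *)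
Let reflectionD1 x : rGamma x * rGamma (1 - x) = sin (pi * x) / pi <->
  rGamma (x + 1) * rGamma (1 - (x + 1)) = sin (pi * (x + 1)) / pi.
Proof.
have -> : rGamma (x + 1) * rGamma (1 - (x + 1)) = - (rGamma x * rGamma (1 - x)).
  rewrite (rGamma_rec x) (_ : 1 - (x + 1) = - x); last by ring.
  by rewrite (rGamma_rec (- x)) (_ : - x + 1 = 1 - x); ring.
rewrite mulrDr mulr1 sinDpi mulNr; split => [->//|].
by move/oppr_inj.
Qed.

Lemma rGamma_reflection x : rGamma x * rGamma (1 - x) = sin (pi * x) / pi.
Proof.
have base y : 0 <= y < 1 -> rGamma y * rGamma (1 - y) = sin (pi * y) / pi.
  move=> /andP[]; rewrite le_eqVlt => /predU1P[<- _|y0 y1].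
    by rewrite rGamma_rec !mul0r mulr0 sin0 mul0r.
  by apply: rGamma_reflection01; rewrite y0.
pose y := x - (Num.floor x)%:~R.
have y01 : 0 <= y < 1.
  have /andP[] := archimedean.Num.Theory.floor_itv x; rewrite intrD /y; lra.
have -> : x = y + (Num.floor x)%:~R by rewrite /y subrK.
case: (Num.floor x) => n.
  elim: n => [|n IH]; first by rewrite addr0; exact: base.
  have -> : y + n.+1%:~R = y + n%:~R + 1 by rewrite -addn1 PoszD intrD addrA.
  exact: (proj1 (reflectionD1 _)).
rewrite NegzE intrN.
elim: n.+1 => [|k IH]; first by rewrite subr0; exact: base.
apply: (proj2 (reflectionD1 _)); rewrite (_ : y - _ + 1 = y - k%:~R)//.
by rewrite -addn1 PoszD intrD; ring.
Qed.

End SineProduct.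

(** * Differentiability of the reciprocal Gamma function at 1 and 2 *)

Section RGammaDerivative.
Context {R : realType}.
Implicit Types (x y h t : R) (m n : nat).

(** Its limit is Euler's constant, the derivative of 1/Gamma at 1. *)
Definition euler_seq m : R := \sum_(1 <= k < m.+1) k%:R^-1 - ln m%:R.

Lemma ln1D_near h : `|h| <= 1 / 2 -> `|ln (1 + h) - h| <= 2 * h ^+ 2.
Proof.
rewrite ler_norml => /andP[h1 h2].
have p1 : 0 < 1 + h by lra.
have ub : ln (1 + h) <= h by apply: le_ln1Dx; lra.
have lb : h - 2 * h ^+ 2 <= ln (1 + h).
  rewrite -[leRHS]opprK -lnV ?posrE// lerNr opprB.
  have -> : (1 + h)^-1 = 1 + (- h / (1 + h)) by field; rewrite gt_eqF.
  apply: le_trans (le_ln1Dx _) _.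
    by rewrite ltr_pdivlMr//; lra.
  rewrite ler_pdivrMr//; nra.
rewrite ler_norml; apply/andP; split; lra.
Qed.

Lemma sum_inv_sqr_le2 m : \sum_(1 <= k < m.+1) (k%:R ^+ 2)^-1 <= 2 :> R.
Proof.
suff : \sum_(1 <= k < m.+2) (k%:R ^+ 2)^-1 <= 2 - m.+1%:R^-1 :> R.
  rewrite big_nat_recr//= => H; apply: (le_trans _ (le_trans H _)).
    by rewrite lerDl invr_ge0 sqr_ge0.
  by rewrite gerBl invr_ge0.
elim: m => [|m IH]; first by rewrite big_nat1 expr1n invr1; lra.
rewrite big_nat_recr//=.
apply: le_trans (lerD IH (lexx _)) _.
have m0 : 0 < m.+1%:R :> R by rewrite ltr0n.
rewrite -[m.+2%:R]natr1; move: (m.+1%:R : R) m0 => a a0.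
rewrite -subr_ge0.
have -> : 2 - (a + 1)^-1 - (2 - a^-1 + ((a + 1) ^+ 2)^-1) =
   (a * (a + 1) ^+ 2)^-1.
  by field; rewrite !gt_eqF ?addr_gt0.
by rewrite invr_ge0 mulr_ge0 ?sqr_ge0// ltW.
Qed.

Lemma euler_seq_cvg : cvgn (euler_seq \o S).
Proof.
apply: nonincreasing_is_cvgn.
  apply/nonincreasing_seqP => m; rewrite /euler_seq /= big_nat_recr//=.
  have m0 : 0 < m.+1%:R :> R by rewrite ltr0n.
  rewrite -[m.+2%:R]natr1; move: (m.+1%:R : R) m0 => a a0.
  have a1 : 0 < a + 1 by rewrite addr_gt0.
  have := @le_ln1Dx R (- (a + 1)^-1).
  have -> : 1 + - (a + 1)^-1 = a / (a + 1) by field; rewrite gt_eqF.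
  rewrite ln_div ?posrE// => H.
  have : ln a - ln (a + 1) <= - (a + 1)^-1.
    by apply: H; rewrite ltrN2 invf_lt1// ltrDr.
  lra.
have K m : ln m.+1%:R <= \sum_(1 <= k < m.+1) k%:R^-1 :> R.
  elim: m => [|m IH]; first by rewrite big_geq// ln1.
  rewrite big_nat_recr//=; apply: le_trans (lerD IH (lexx _)).
  have m0 : 0 < m.+1%:R :> R by rewrite ltr0n.
  rewrite -[m.+2%:R]natr1; move: (m.+1%:R : R) m0 => a a0.
  have a1 : 0 < a + 1 by rewrite addr_gt0.
  have := @le_ln1Dx R (a^-1).
  have -> : 1 + a^-1 = (a + 1) / a by field; rewrite gt_eqF.
  rewrite ln_div ?posrE// => H.
  have : ln (a + 1) - ln a <= a^-1.
    by apply: H; rewrite (@lt_trans _ _ 0)// ?invr_gt0// oppr_lt0.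
  by rewrite lerBlDl.
exists 0 => _ [m _ <-]; rewrite /euler_seq /= subr_ge0.
by apply: le_trans (K m.+1); rewrite ler_ln ?posrE ?ltr0n// ler_nat.
Qed.

Lemma ln_prod_nat (f : nat -> R) m n : (forall k, (m <= k)%N -> 0 < f k) ->
  ln (\prod_(m <= k < n) f k) = \sum_(m <= k < n) ln (f k).
Proof.
move=> f0; elim: n => [|n IH]; first by rewrite !big_geq// ln1.
have [mn|nm] := leqP m n; last by rewrite !big_geq// ln1.
rewrite !big_nat_recr//= lnM ?posrE ?IH ?f0//.
by rewrite big_nat_cond; apply: prodr_gt0 => k /andP[/andP[mk _] _]; exact: f0.
Qed.

(** Logarithm of Weierstrass's product: ln (1/Gamma(1 + h)) - g h is the sum of ln(1 + h/k) - h/k.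
    Each term is at most 2 h^2 / k^2, and the sum of 1/k^2 is at most 2, whence the constant 4. *)
Lemma ln_rGamma_near : exists g : R, forall h, `|h| <= 1 / 2 ->
  `|ln (rGamma (1 + h)) - g * h| <= 4 * h ^+ 2.
Proof.
exists (limn (euler_seq \o S)) => h h12.
have hh := h12; move: hh; rewrite ler_norml => /andP[h1 h2].
have p1 : 0 < 1 + h by lra.
have G0 := rGamma_gt0 _ p1.
have cL : ln ((gauss_seq (1 + h) m.+1)^-1) @[m --> \oo] --> ln (rGamma (1 + h)).
  apply: continuous_cvg; first exact: continuous_ln.
  by rewrite (cvg_shiftS (fun m => (gauss_seq (1 + h) m)^-1)); exact: rGamma_cvg.
have c2 : ln ((h + m.+2%:R) / m.+1%:R) @[m --> \oo] --> (0 : R).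
  rewrite -ln1; apply: continuous_cvg; first exact: continuous_ln.
  exact: cvg_gauss_ratio.
have hk k : (1 <= k)%N -> `|h / k%:R| <= 1 / 2.
  move=> k1; apply: le_trans h12; rewrite normrM ler_piMr//.
  by rewrite normfV normr_nat invf_le1 ?ltr0n// ler1n.
have E m : ln ((gauss_seq (1 + h) m.+1)^-1) -
    ln ((h + m.+2%:R) / m.+1%:R) - h * euler_seq m.+1 =
    \sum_(1 <= k < m.+2) (ln (1 + h / k%:R) - h / k%:R).
  rewrite sumrB -ln_prod_nat; last first.
    by move=> k /hk; rewrite ler_norml => /andP[]; lra.
  have P0 : 0 < \prod_(1 <= k < m.+2) (1 + h / k%:R).
    rewrite big_nat_cond; apply: prodr_gt0 => k /andP[/andP[/hk + _] _].
    by rewrite ler_norml => /andP[]; lra.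
  rewrite /gauss_seq -[1 + h]/(1 + h).
  have -> : \prod_(0 <= k < m.+2) (1 + h + k%:R) =
      (m.+2%:R + h) * (m.+1`!%:R * \prod_(1 <= k < m.+2) (1 + h / k%:R)).
    have := prod_natDB (- h) m.+1; rewrite opprK => ->; congr (_ * (_ * _)).
    by apply: eq_bigr => k _; rewrite mulNr opprK.
  have m0 : 0 < m.+1%:R :> R by rewrite ltr0n.
  have mh : 0 < h + m.+2%:R by rewrite -natr1; lra.
  have mp : 0 < m.+1%:R `^ h by rewrite powR_gt0.
  have -> : (m.+1`!%:R * m.+1%:R `^ (1 + h) / ((m.+2%:R + h) *
      (m.+1`!%:R * \prod_(1 <= k < m.+2) (1 + h / k%:R))))^-1 =
      (h + m.+2%:R) / m.+1%:R * (\prod_(1 <= k < m.+2) (1 + h / k%:R) / m.+1%:R `^ h).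
    rewrite powRD ?pnatr_eq0 ?implybT// powRr1 ?ltW//.
    have f0 : m.+1`!%:R != 0 :> R by rewrite pnatr_eq0 -lt0n fact_gt0.
    rewrite [m.+2%:R + h]addrC.
    move: (\prod_(_ <= _ < _) _) P0 (m.+1%:R `^ h) mp (m.+1`!%:R : R) f0.
    move: (h + _) mh (m.+1%:R : R) m0 => a a0 b b0 c c0 d d0 e e0.
    by field; rewrite e0 !gt_eqF.
  rewrite lnM ?posrE ?divr_gt0// [ln (\prod_(_ <= _ < _) _ / _)]ln_div ?posrE// ln_powR.
  rewrite -mulr_sumr /euler_seq; ring.
have c3 : `|ln ((gauss_seq (1 + h) m.+1)^-1) -
    ln ((h + m.+2%:R) / m.+1%:R) - h * euler_seq m.+1| @[m --> \oo] -->
    `|ln (rGamma (1 + h)) - limn (euler_seq \o succn) * h|.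
  apply: cvg_norm; rewrite -[X in _ --> X - _]subr0 [X in _ --> _ - X]mulrC.
  apply: cvgB; first exact: cvgB.
  by apply: cvgMl_tmp; exact: euler_seq_cvg.
apply: (cvgr_to_le c3).
apply: nearW => m; rewrite E.
apply: le_trans (ler_norm_sum _ _ _) _.
apply: (@le_trans _ _ (\sum_(1 <= k < m.+2) (2 * h ^+ 2 * (k%:R ^+ 2)^-1))).
  rewrite big_nat_cond [leRHS]big_nat_cond; apply: ler_sum => k /andP[/andP[/hk k1 _] _].
  by apply: le_trans (ln1D_near _ k1) _; rewrite exprMn exprVn mulrA.
rewrite -mulr_sumr; have := sum_inv_sqr_le2 m.+1.
have : 0 <= h ^+ 2 by rewrite sqr_ge0.
move: (\sum_(_ <= _ < _) _) (h ^+ 2) => S H; nra.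
Qed.

(** Derivatives with respect to the order are obtained from quadratic remainder bounds, because
    these survive limits and sums of series without any exchange of limit and derivative. *)
Lemma has_derive_quad (f : R -> R) x d C :
  (forall h, `|h| <= 1 / 2 -> `|f (x + h) - f x - d * h| <= C * h ^+ 2) ->
  has_derive x 1 f d.
Proof.
move=> H.
have cv : h^-1 *: (f (h *: 1 + x) - f x) @[h --> (0 : R)^'] --> d.
  apply/cvgrPdist_le => /= e e0.
  have C1 : 0 < `|C| + 1 by rewrite ltr_wpDl.
  near=> h.
  have h0 : h != 0 by near: h; exact: nbhs_dnbhs_neq.
  have hle : `|h| <= 1 / 2.
    by near: h; apply: dnbhs0_le; lra.
  have he : `|h| <= e / (`|C| + 1).
    by near: h; apply: dnbhs0_le; exact: divr_gt0.
  have -> : d - h^-1 *: (f (h *: 1 + x) - f x) = - (f (x + h) - f x - d * h) / h.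
    rewrite /GRing.scale /= mulr1 [h + x]addrC; by field.
  rewrite normrM normrN normfV ler_pdivrMr ?normr_gt0//.
  apply: le_trans (H _ hle) _.
  rewrite -(real_normK (num_real h)) expr2 mulrA ler_wpM2r//.
  apply: (@le_trans _ _ ((`|C| + 1) * `|h|)).
    by rewrite ler_wpM2r// (le_trans (ler_norm C))// lerDl.
  by rewrite mulrC -ler_pdivlMr.
by split; [exact: (cvgP _ cv)|exact: cvg_lim cv].
Unshelve. all: by end_near. Qed.

Lemma near_eq_has_derive (f g : R -> R) x d :
  (\forall y \near x, f y = g y) -> has_derive x 1 f d -> has_derive x 1 g d.
Proof.
by move=> fg; apply: near_eq_is_derive; rewrite ?oner_neq0.
Qed.

Lemma rGamma1 : rGamma 1 = 1 :> R.
Proof.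
have [g /(_ 0)] := ln_rGamma_near; rewrite normr0 addr0 mulr0 subr0 expr0n/= mulr0.
move=> /(_ ltac:(lra)); rewrite normr_le0 ln_eq0 ?rGamma_gt0// => /eqP//.
Qed.

Lemma rGamma_derivable1 : exists d : R, has_derive (1 : R) 1 rGamma d.
Proof.
have [g H] := ln_rGamma_near.
have d1 : has_derive (1 : R) 1 (fun x => ln (rGamma x)) g.
  by apply: (@has_derive_quad _ _ _ 4) => h /H; rewrite rGamma1 ln1 subr0.
eexists; apply: (@near_eq_has_derive (fun x => expR (ln (rGamma x)))).
  near=> y; rewrite lnK// posrE rGamma_gt0//; near: y.
  exact: lt_nbhsr.
by apply: has_derive_comp d1; exact: is_derive_expR.
Unshelve. all: by end_near. Qed.

(** The points 1 and 2 correspond to the orders 0 and 1 of [besselJ], from which the three-term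
    recurrence reaches every integer order. *)
Lemma rGamma_derivable2 : exists d : R, has_derive (2 : R) 1 rGamma d.
Proof.
have [d H] := rGamma_derivable1.
eexists; apply: (@near_eq_has_derive (fun x => (x - 1)^-1 * rGamma (x - 1))).
  near=> y; have y1 : y - 1 != 0.
    rewrite gt_eqF// subr_gt0; near: y; apply: lt_nbhsr; lra.
  by rewrite (rGamma_rec (y - 1)) mulKf// subrK.
have dB : has_derive (2 : R) 1 (fun y => y - 1) (1 - 0).
  by apply: has_derive_sub; [exact: has_derive_idr|exact: has_derive_cst].
apply: has_derive_mul.
  by apply: has_derive_inv dB; rewrite gt_eqF// subr_gt0 ltr1n.
apply: has_derive_comp dB.
by rewrite (_ : 2 - 1 = 1); [exact: H|lra].
Unshelve. all: by end_near. Qed.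

End RGammaDerivative.

(** * Bessel functions *)

Section Bessel.
Context {R : realType}.
Implicit Types (a b x y z q h t : R) (m n k : nat).

Lemma is_cvg_pseries_fact (c : nat -> R) (M : R) q :
  (forall k, `|c k| <= M / k`!%:R) -> cvgn (pseries c q).
Proof.
move=> cM; apply: normed_cvg.
have M0 : 0 <= M by have := cM 0%N; rewrite fact0 divr1; exact: le_trans.
apply: (@series_le_cvg _ _ (fun k => M * exp_coeff `|q| k)) => [k|k|k|].
- exact: normr_ge0.
- by rewrite mulr_ge0// /exp_coeff/= divr_ge0// exprn_ge0.
- rewrite /exp_coeff/= normrM normrX mulrCA [leRHS]mulrC.
  by rewrite ler_wpM2r// exprn_ge0.
- exact/is_cvg_seriesZ/is_cvg_series_exp_coeff.
Qed.

Definition bessel_coef a k : R := (-1) ^+ k / k`!%:R * rGamma (a + k%:R + 1).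

(** Up to the sign of q this is the Bessel-Clifford function: what remains of J_a(z) once (z/2)^a is
    factored out, with q = z^2 / 4. It is entire in q and can therefore be evaluated at q = 0. *)
Definition besselF a q : R := limn (pseries (bessel_coef a) q).

(** From an index K > |a| on, each step of [rGamma_rec] divides by a number at least 1; the finitely
    many earlier values are bounded by their sum. *)
Lemma rGamma_bounded a : exists M, forall k, `|rGamma (a + k%:R + 1)| <= M.
Proof.
pose K := (Num.truncn `|a|).+1.
have aK : 0 < a + K%:R.
  have := truncnS_gt `|a|; rewrite -/K => H.
  by rewrite -ltrBlDl sub0r (le_lt_trans _ H)// -normrN ler_norm.
exists (\sum_(0 <= i < K.+1) `|rGamma (a + i%:R + 1)|) => k.
have le_sum j : (j <= K)%N -> `|rGamma (a + j%:R + 1)| <=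
    \sum_(0 <= i < K.+1) `|rGamma (a + i%:R + 1)|.
  move=> jK; rewrite big_mkord (bigD1 (Ordinal (jK : (j < K.+1)%N)))//= lerDl.
  exact: sumr_ge0.
have [kK|/ltnW] := leqP k K; first exact: le_sum.
elim: k => [|k IH]; first by rewrite leqn0 => /eqP K0; apply: le_sum; rewrite K0.
rewrite leq_eqVlt => /predU1P[<-|]; first exact: le_sum.
rewrite ltnS => Kk; apply: le_trans (IH Kk).
have ak : 0 < a + k%:R by rewrite (lt_le_trans aK)// lerD2l ler_nat.
rewrite [X in _ <= `|X|]rGamma_rec normrM.
have -> : a + k%:R + 1 + 1 = a + k.+1%:R + 1 by rewrite -natr1; ring.
by rewrite ler_peMl// ger0_norm//; lra.
Qed.

Lemma bessel_coef_bounded a : exists M, forall k, `|bessel_coef a k| <= M / k`!%:R.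
Proof.
have [M HM] := rGamma_bounded a; exists M => k.
rewrite /bessel_coef normrM normf_div normrX normrN normr1 expr1n.
by rewrite normr_nat mulrC mul1r ler_wpM2r.
Qed.

Lemma is_cvg_besselF a q : cvgn (pseries (bessel_coef a) q).
Proof. by have [M] := bessel_coef_bounded a; exact: is_cvg_pseries_fact. Qed.

Lemma bessel_coef_diffs a : pseries_diffs (bessel_coef a) = - bessel_coef (a + 1).
Proof.
apply/funext => k; rewrite /pseries_diffs /bessel_coef fctE factS natrM exprS.
have -> : a + k.+1%:R + 1 = a + 1 + k%:R + 1 by rewrite -natr1; ring.
have : k`!%:R != 0 :> R by rewrite pnatr_eq0 -lt0n fact_gt0.
have : k.+1%:R != 0 :> R by rewrite pnatr_eq0.
move: (k.+1%:R : R) (k`!%:R : R) => u w u0 w0; by field; rewrite u0 w0.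
Qed.

Lemma limn_pseriesN (c : nat -> R) q : cvgn (pseries c q) ->
  limn (pseries (- c) q) = - limn (pseries c q).
Proof.
have -> : pseries (- c) q = - pseries c q.
  apply/funext => m.
  transitivity (- \sum_(0 <= k < m) c k * q ^+ k); last by [].
  by rewrite -sumrN; apply: eq_bigr => k _; rewrite -mulNr.
by move=> cc; apply: limN.
Qed.

Lemma has_derive_besselF a q : has_derive q 1 (besselF a) (- besselF (a + 1) q).
Proof.
have cN b u : cvgn (pseries (- bessel_coef b) u).
  have [M HM] := bessel_coef_bounded b; apply: (is_cvg_pseries_fact _ M) => k.
  by rewrite fctE normrN.
rewrite /besselF -limn_pseriesN -?bessel_coef_diffs; last exact: is_cvg_besselF.
apply: (@pseries_snd_diffs _ _ (`|q| + 1)).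
- exact: is_cvg_besselF.
- by rewrite bessel_coef_diffs.
- rewrite bessel_coef_diffs pseries_diffsN bessel_coef_diffs opprK.
  exact: is_cvg_besselF.
- by rewrite [ltRHS]ger0_norm ?addr_ge0// ltrDl.
Qed.

Lemma besselF_rec a q : besselF (a - 1) q = a * besselF a q - q * besselF (a + 1) q.
Proof.
apply/cvg_lim => //.
have -> : pseries (bessel_coef (a - 1)) q = (fun n => a * pseries (bessel_coef a) q n +
    q * series (fun i => i%:R * bessel_coef a i * q ^+ i.-1) n).
  apply/funext => n; rewrite /pseries /series /= !mulr_sumr -big_split/=.
  apply: eq_bigr => k _; rewrite /bessel_coef.
  have -> : a - 1 + k%:R + 1 = a + k%:R by ring.
  rewrite (rGamma_rec (a + _)).
  case: k => [|k]; first by rewrite expr0 !mul0r mulr0 !addr0 !mulr1; ring.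
  by rewrite -pred_Sn [q ^+ k.+1]exprS; move: (_ / _) (q ^+ k) => u w; ring.
apply: cvgD; first by apply: cvgMl_tmp; exact: is_cvg_besselF.
rewrite -mulrN; apply: cvgMl_tmp; rewrite /besselF -limn_pseriesN -?bessel_coef_diffs.
  apply: pseries_diffs_equiv; rewrite bessel_coef_diffs.
  have [M HM] := bessel_coef_bounded (a + 1); apply: (is_cvg_pseries_fact _ M) => k.
  by rewrite fctE normrN.
exact: is_cvg_besselF.
Qed.

Lemma besselF0 a : besselF a 0 = rGamma (a + 1).
Proof.
apply/cvg_lim => //; rewrite -cvg_shiftS/=.
rewrite (_ : (fun n => _) = cst (rGamma (a + 1))); first exact: cvg_cst.
apply/funext => n; rewrite /pseries /series /= big_nat_recl//= big1 ?addr0.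
  by rewrite /bessel_coef expr0 fact0 divr1 addr0 !mul1r mulr1.
by move=> i _; rewrite exprS mul0r mulr0.
Qed.

(** By the recurrence the left-hand side has derivative 0 in q; its value at q = 0 is the reflection
    formula. *)
Lemma besselF_wronskian a q :
  q * (besselF a q * besselF (1 - a) q) + besselF (- a) q * besselF (a - 1) q =
  sin (pi * a) / pi.
Proof.
pose w q := q * (besselF a q * besselF (1 - a) q) + besselF (- a) q * besselF (a - 1) q.
have w0 : w 0 = sin (pi * a) / pi.
  rewrite /w mul0r add0r !besselF0 -rGamma_reflection subrK mulrC.
  by congr (_ * rGamma _); ring.
rewrite -w0 -/(w q).
suff dw (x : R) : has_derive x 1 w 0 by exact: (is_derive_0_is_cst q 0 dw).
apply: has_derive_eq.
  by repeat first [exact: has_derive_besselF|derive_step].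
rewrite subrK (_ : - a + 1 = 1 - a); last by ring.
rewrite (besselF_rec a x) /=.
have := besselF_rec (1 - a) x; rewrite (_ : 1 - a - 1 = - a); last by ring.
rewrite (_ : 1 - a + 1 = 2 - a); last by ring.
move=> ->.
move: (besselF _ _) (besselF _ _) (besselF _ _) (besselF _ _) => A B C D; ring.
Qed.

Lemma besselJE a z : 0 < z -> besselJ a z = (z / 2) `^ a * besselF a (z ^+ 2 / 4).
Proof.
move=> z0; have z2 : 0 < z / 2 by rewrite divr_gt0.
rewrite /besselJ /besselF; apply/cvg_lim => //.
have -> : series (fun k : nat => (-1) ^+ k / k`!%:R * (Gamma (a + k%:R + 1))^-1 *
    (z / 2) `^ (2 * k%:R + a)) =
    (fun n => (z / 2) `^ a * pseries (bessel_coef a) (z ^+ 2 / 4) n).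
  apply/funext => n; rewrite /pseries /series /= mulr_sumr; apply: eq_bigr => k _.
  rewrite /bessel_coef /rGamma powRD ?(lt0r_neq0 z2) ?implybT// powRrM powR_mulrn ?powR_ge0//.
  have -> : (z / 2) `^ 2 = z ^+ 2 / 4.
    by rewrite powR_mulrn ?ltW// expr_div_n -natrX.
  by ring.
by apply: cvgMl_tmp; exact: is_cvg_besselF.
Qed.

Lemma powR_half a z : 0 < z -> (z / 2) `^ a = z / 2 * (z / 2) `^ (a - 1).
Proof.
move=> z0; have z2 : 0 < z / 2 by rewrite divr_gt0.
have -> : z / 2 * (z / 2) `^ (a - 1) = (z / 2) `^ 1 * (z / 2) `^ (a - 1).
  by rewrite powRr1 ?ltW.
by rewrite -powRD ?(lt0r_neq0 z2) ?implybT//; congr (_ `^ _); ring.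
Qed.

Lemma besselJ_rec a z : 0 < z ->
  besselJ (a - 1) z = 2 * a / z * besselJ a z - besselJ (a + 1) z.
Proof.
move=> z0; rewrite !besselJE// besselF_rec (powR_half (a + 1))// addrK.
rewrite [in RHS](powR_half a)//.
by field; rewrite gt_eqF.
Qed.

Lemma has_derive_besselJ a z : 0 < z ->
  has_derive z 1 (besselJ a) (besselJ (a - 1) z - a / z * besselJ a z).
Proof.
move=> z0; rewrite besselJ_rec//.
apply: (@near_eq_has_derive _ (fun z => (z / 2) `^ a * besselF a (z ^+ 2 / 4))).
  by near=> y; rewrite besselJE//; near: y; exact: lt_nbhsr.
have dz : has_derive z 1 (fun y : R => y / 2) (z * 0 + 2^-1 * 1).
  by apply: has_derive_mul; [exact: has_derive_idr|exact: has_derive_cst].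
have dq : has_derive z 1 (fun y : R => y ^+ 2 / 4)
    (z ^+ 2 * 0 + 4^-1 * (2%:R * z ^+ 1 * 1)).
  by repeat derive_step.
apply: has_derive_eq.
  apply: has_derive_mul.
    apply: (has_derive_comp (fun u => u `^ a)) dz.
    by apply: is_derive1_powR; rewrite divr_gt0.
  exact: has_derive_comp (has_derive_besselF _ _) dq.
rewrite !besselJE// (powR_half (a + 1))// addrK [(z / 2) `^ a]powR_half//.
move: (besselF _ _) (besselF _ _) (_ `^ _) => A B C.
by rewrite expr1; field; rewrite gt_eqF.
Unshelve. all: by end_near. Qed.

(* [C] and [D] stand for cylinder functions of orders [a] and [a - 1]. *)
Definition cylinder a (C D : R -> R) := forall z, 0 < z ->
  has_derive z 1 C (D z - a / z * C z) /\
  has_derive z 1 D ((a - 1) / z * D z - C z).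

Lemma cylinder_besselJ a : cylinder a (besselJ a) (besselJ (a - 1)).
Proof.
move=> z z0; split; first exact: has_derive_besselJ.
apply: has_derive_eq; first exact: has_derive_besselJ.
rewrite (besselJ_rec (a - 1))// subrK; field; by rewrite gt_eqF.
Qed.

(** Passing to the order -a exchanges the raising and the lowering operator; the minus sign of the
    companion restores the pattern of [cylinder]. *)
Lemma cylinder_besselJN a : cylinder a (besselJ (- a)) (fun z => - besselJ (1 - a) z).
Proof.
move=> z z0; have N1 : 1 - a = - a + 1 by rewrite addrC.
split.
  apply: has_derive_eq; first exact: has_derive_besselJ.
  by rewrite (besselJ_rec (- a))// N1; field; rewrite gt_eqF.
apply: has_derive_eq; first by apply: has_derive_opp; exact: has_derive_besselJ.
by rewrite (_ : 1 - a - 1 = - a); [field; rewrite gt_eqF|ring].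
Qed.

Lemma cylinder_lin a (c d : R) C D C' D' : cylinder a C D -> cylinder a C' D' ->
  cylinder a (fun z => c * C z + d * C' z) (fun z => c * D z + d * D' z).
Proof.
move=> h h' z z0; have [h1 h2] := h z z0; have [h3 h4] := h' z z0.
by split; (apply: has_derive_eq;
  [by repeat first [exact: h1|exact: h2|exact: h3|exact: h4|derive_step]|rewrite /=; ring]).
Qed.

Lemma cylinder_eq a C D C' D' : (forall z, 0 < z -> C z = C' z) ->
  (forall z, 0 < z -> D z = D' z) -> cylinder a C D -> cylinder a C' D'.
Proof.
move=> CC DD h z z0; rewrite -CC// -DD//; have [h1 h2] := h z z0; split.
  apply: near_eq_has_derive h1; near=> y; apply: CC; near: y; exact: lt_nbhsr.
apply: near_eq_has_derive h2; near=> y; apply: DD; near: y; exact: lt_nbhsr.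
Unshelve. all: by end_near. Qed.

Lemma sinBpi x : sin (x - pi) = - sin x.
Proof. by rewrite -[in RHS](subrK pi x) sinDpi opprK. Qed.

Lemma cosBpi x : cos (x - pi) = - cos x.
Proof. by rewrite -[in RHS](subrK pi x) cosDpi opprK. Qed.

Lemma besselY_nonintE a z : sin (a * pi) != 0 ->
  besselY_nonint a z = cos (a * pi) / sin (a * pi) * besselJ a z -
    (sin (a * pi))^-1 * besselJ (- a) z.
Proof. by move=> s0; rewrite /besselY_nonint; field. Qed.

Lemma besselY_nonintBE a z : sin (a * pi) != 0 ->
  besselY_nonint (a - 1) z = cos (a * pi) / sin (a * pi) * besselJ (a - 1) z -
    (sin (a * pi))^-1 * - besselJ (1 - a) z.
Proof.
move=> s0; rewrite /besselY_nonint (_ : (a - 1) * pi = a * pi - pi); last by ring.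
rewrite sinBpi cosBpi.
rewrite (_ : - (a - 1) = 1 - a); [by field|by ring].
Qed.

Lemma cylinder_besselY a : sin (a * pi) != 0 ->
  cylinder a (besselY_nonint a) (besselY_nonint (a - 1)).
Proof.
move=> s0; apply: cylinder_eq (cylinder_lin _ (cos (a * pi) / sin (a * pi))
  (- (sin (a * pi))^-1) _ _ _ _ (cylinder_besselJ a) (cylinder_besselJN a)).
  by move=> z _; rewrite besselY_nonintE// mulNr.
by move=> z _; rewrite besselY_nonintBE// mulNr.
Qed.

(** Only the J_{-a} component of Y_a contributes. The Wronskian of J_a and J_{-a} carries a factor
    sin(a pi), which the denominator in Y_a cancels. *)
Lemma bessel_wronskian a z : 0 < z -> sin (a * pi) != 0 ->
  besselJ a z * besselY_nonint (a - 1) z - besselJ (a - 1) z * besselY_nonint a z =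
  2 / (pi * z).
Proof.
move=> z0 s0; rewrite (besselY_nonintE a)// besselY_nonintBE//.
have z2 : 0 < z / 2 by rewrite divr_gt0.
have W : besselJ a z * besselJ (1 - a) z + besselJ (a - 1) z * besselJ (- a) z =
    2 * sin (a * pi) / (pi * z).
  have := besselF_wronskian a (z ^+ 2 / 4); rewrite [pi * a]mulrC => Wr.
  rewrite !besselJE// (powR_half a)// (powR_half (1 - a))//.
  have u : (z / 2) `^ (a - 1) * (z / 2) `^ (- a) = (z / 2)^-1.
    have -> : (z / 2)^-1 = (z / 2) `^ (-1) by rewrite powR_inv1 ?ltW.
    by rewrite -powRD ?(lt0r_neq0 z2) ?implybT//; congr (_ `^ _); ring.
  rewrite (_ : 1 - a - 1 = - a); last by ring.
  have p0 : pi != 0 :> R by rewrite gt_eqF ?pi_gt0.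
  transitivity ((z / 2) `^ (a - 1) * (z / 2) `^ (- a) * (sin (a * pi) / pi)).
    rewrite -Wr; move: (_ `^ _) (_ `^ _) => b c.
    by move: (besselF _ _) (besselF _ _) (besselF _ _) (besselF _ _) => A B C D; field.
  rewrite u; move: (sin (a * pi)) (pi : R) p0 (lt0r_neq0 z0) => S p p0 z00.
  by field; rewrite p0 z00.
have -> : 2 / (pi * z) = (sin (a * pi))^-1 * (2 * sin (a * pi) / (pi * z)).
  have : pi != 0 :> R by rewrite gt_eqF ?pi_gt0.
  move=> p0; move: (pi : R) p0 (sin (a * pi)) s0 (lt0r_neq0 z0) => p p0 q q0 z00.
  by field; rewrite q0 p0 z00.
rewrite -W; ring.
Qed.

(** * Integer orders and differentiability in the order *)

Lemma int_ind2 (P : R -> Prop) : P 0 -> P 1 ->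
  (forall x, P (x - 1) -> P x -> P (x + 1)) ->
  (forall x, P x -> P (x + 1) -> P (x - 1)) -> forall n : int, P n%:~R.
Proof.
move=> P0 P1 up down.
have A n : P n%:R /\ P (n%:R + 1).
  elim: n => [|n [IH1 IH2]]; first by rewrite add0r.
  rewrite -natr1; split=> //; apply: up => //; by rewrite addrK.
have B n : P (- n%:R) /\ P (- n%:R + 1).
  elim: n => [|n [IH1 IH2]]; first by rewrite oppr0 add0r.
  by rewrite -natr1 opprD subrK; split=> //; exact: down.
by case=> n; [exact: (A n).1|rewrite NegzE intrN; exact: (B n.+1).1].
Qed.

(** The numerator of [besselY_nonint] therefore vanishes at integer orders, and Y becomes a quotient
    of the form 0/0. Both sides satisfy the same three-term recurrence, and they agree at 0 and
    1. *)
Lemma besselJN_int z (n : int) : 0 < z ->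
  besselJ n%:~R z * cos (n%:~R * pi) = besselJ (- n%:~R) z.
Proof.
move=> z0; pose P x := besselJ x z * cos (x * pi) = besselJ (- x) z.
have cS x : cos ((x + 1) * pi) = - cos (x * pi) by rewrite mulrDl mul1r cosDpi.
have cP x : cos ((x - 1) * pi) = - cos (x * pi) by rewrite mulrBl mul1r cosBpi.
have J1 x : besselJ (x + 1) z = 2 * x / z * besselJ x z - besselJ (x - 1) z.
  by rewrite besselJ_rec//; ring.
apply: (int_ind2 P); rewrite /P.
- by rewrite mul0r cos0 mulr1 oppr0.
- have := besselJ_rec 0 z z0; rewrite sub0r add0r => ->.
  by rewrite mulr0 !mul0r sub0r mul1r cospi mulrN1.
- move=> x; rewrite cP opprB cS J1 => H1 H2.
  rewrite opprD (besselJ_rec (- x))// [- x + 1]addrC -H1 -H2; ring.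
- move=> x; rewrite cP cS => H1 H2.
  rewrite (_ : - (x - 1) = - x + 1); last by ring.
  rewrite (besselJ_rec x)// (J1 (- x)) -H1 -opprD -H2; ring.
Qed.

(** Reciprocal of the rising factorial (a+1)...(a+k). Once 1/Gamma(a+1) is factored out of the
    series, the order enters the coefficients only through these rational functions. *)
Definition rising_inv k a : R := \prod_(1 <= j < k.+1) (a + j%:R)^-1.

Lemma rGamma_rising a k : -1 < a ->
  rGamma (a + k%:R + 1) = rGamma (a + 1) * rising_inv k a.
Proof.
move=> a1; rewrite /rising_inv; elim: k => [|k IH].
  by rewrite addr0 big_geq// mulr1.
rewrite big_nat_recr//= mulrA -IH.
have -> : a + k.+1%:R + 1 = a + k%:R + 1 + 1 by rewrite -natr1; ring.
have -> : a + k.+1%:R = a + k%:R + 1 by rewrite -natr1; ring.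
have a0 : a + k%:R + 1 != 0.
  by rewrite gt_eqF// addrAC ltr_wpDr// -ltrBlDr sub0r.
by rewrite [in RHS]rGamma_rec mulrC mulKf.
Qed.

(** Induction by the product rule. Since a + k + 1 >= 1 and |h| <= 1/2, the new factor is at most 2,
    and with e = 8^k the remainder grows to at most 2e + e + 2(1 + e) <= 8e. This geometric growth
    is harmless against the 1/k! of the series. *)
Lemma rising_inv_quad a k : 0 <= a -> exists2 d : R, `|d| <= 8 ^+ k &
  forall h, `|h| <= 1 / 2 ->
    `|rising_inv k (a + h) - rising_inv k a - d * h| <= 8 ^+ k * h ^+ 2.
Proof.
move=> a0; elim: k => [|k [d d8 IH]].
  exists 0 => [|h _]; first by rewrite normr0 expr0.
  by rewrite /rising_inv !big_geq// mul0r subrr subr0 normr0 mul1r sqr_ge0.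
have p01 : 0 <= rising_inv k a <= 1.
  elim: {IH d d8} k => [|k /andP[p0 p1]].
    by rewrite /rising_inv big_geq// ler01 lexx.
  rewrite /rising_inv big_nat_recr//= -/(rising_inv k a).
  have b1 : 1 <= a + k.+1%:R by rewrite -natr1 addrA lerDr addr_ge0.
  have i0 : 0 <= (a + k.+1%:R)^-1 by rewrite invr_ge0 (le_trans _ b1).
  rewrite mulr_ge0//= mulr_ile1// invf_le1//; exact: lt_le_trans b1.
have b1 : 1 <= a + k.+1%:R by rewrite -natr1 addrA lerDr addr_ge0.
have e1 : 1 <= 8 ^+ k :> R by rewrite exprn_ege1// ler1n.
have rS x : rising_inv k.+1 x = rising_inv k x / (x + k.+1%:R).
  by rewrite /rising_inv big_nat_recr.
have [b0 ib0 ib1] : [/\ 0 < a + k.+1%:R, 0 <= (a + k.+1%:R)^-1 & (a + k.+1%:R)^-1 <= 1].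
  have b0 : 0 < a + k.+1%:R by exact: lt_le_trans b1.
  by rewrite b0 invr_ge0 ltW// invf_le1.
move: p01; set p := rising_inv k a => /andP[p0 p1].
set b := a + k.+1%:R in b0 ib0 ib1 b1 *; set e : R := 8 ^+ k in d8 IH e1 *.
have pb : `|p * b^-1 ^+ 2| <= 1.
  by rewrite ger0_norm ?mulr_ge0 ?sqr_ge0// mulr_ile1 ?sqr_ge0// expr_le1.
have db : `|d / b| <= e.
  rewrite normrM (ger0_norm ib0); apply: le_trans d8.
  by rewrite ler_piMr.
exists (d / b - p * b^-1 ^+ 2).
  rewrite [8 ^+ k.+1]exprS -/e; apply: le_trans (ler_normB _ _) _.
  apply: le_trans (lerD db pb) _; lra.
move=> h h12; rewrite !rS [8 ^+ k.+1]exprS -/e -/p [a + h + _]addrAC -/b.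
have := h12; rewrite ler_norml => /andP[h1 h2].
have bh : 1 / 2 <= b + h by lra.
have bh0 : 0 < b + h by lra.
have u2 : 0 <= (b + h)^-1 <= 2.
  by rewrite invr_ge0 ltW//= -[2]invrK lef_pV2 ?posrE//; lra.
have hh : 0 <= h ^+ 2 by rewrite sqr_ge0.
set r := rising_inv k (a + h) - p - d * h.
have {IH} rb : `|r| <= e * h ^+ 2 by exact: IH.
have -> : rising_inv k (a + h) / (b + h) - p / b - (d / b - p * b^-1 ^+ 2) * h =
    r * (b + h)^-1 - h ^+ 2 * (d / b * b^-1) +
    (p + d * h) * (h ^+ 2 * (b^-1 ^+ 2 * (b + h)^-1)).
  rewrite /r; move: (rising_inv _ _) => P.
  by field; rewrite !gt_eqF.
have T1 : `|r * (b + h)^-1| <= 2 * (e * h ^+ 2).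
  case/andP: u2 => u0 u2; rewrite normrM (ger0_norm u0) mulrC.
  by apply: ler_pM.
have T2 : `|h ^+ 2 * (d / b * b^-1)| <= e * h ^+ 2.
  rewrite normrM (ger0_norm hh) mulrC ler_wpM2r// normrM (ger0_norm ib0).
  by apply: le_trans db; rewrite ler_piMr.
have T3 : `|(p + d * h) * (h ^+ 2 * (b^-1 ^+ 2 * (b + h)^-1))| <=
    (1 + e) * (h ^+ 2 * 2).
  rewrite normrM; apply: ler_pM => //.
    apply: le_trans (ler_normD _ _) _; apply: lerD; first by rewrite ger0_norm.
    rewrite normrM -[leRHS]mulr1; apply: ler_pM => //; lra.
  case/andP: u2 => u0 u2; rewrite ger0_norm; last first.
    by apply: mulr_ge0 => //; apply: mulr_ge0 => //; exact: sqr_ge0.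
  rewrite ler_wpM2l// -[leRHS]mul1r; apply: ler_pM => //; rewrite ?sqr_ge0//.
  by rewrite expr_le1.
apply: le_trans (ler_normD _ _) _; apply: le_trans (lerD (ler_normB _ _) T3) _.
apply: le_trans (lerD (lerD T1 T2) (lexx _)) _.
move: (h ^+ 2) hh e e1 {d8 db rb T1 T2 T3} => H H0 E E1; nra.
Qed.

Lemma normr_series_le (c : nat -> R) (C q : R) :
  (forall k, `|c k| <= 8 ^+ k / k`!%:R * `|q| ^+ k * C) ->
  cvgn (series c) /\ `|limn (series c)| <= expR (8 * `|q|) * C.
Proof.
move=> cC.
have C0 : 0 <= C by have := cC 0%N; rewrite !expr0 fact0 divr1 !mul1r; exact: le_trans.
have cE : cvgn (series (fun k => C * exp_coeff (8 * `|q|) k)).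
  exact/is_cvg_seriesZ/is_cvg_series_exp_coeff.
have cN : cvgn [normed series c].
  apply: series_le_cvg cE => [k|k|k].
  - exact: normr_ge0.
  - by rewrite mulr_ge0// exp_coeff_ge0// mulr_ge0.
  - apply: le_trans (cC k) _; rewrite /exp_coeff/= exprMn; move: (_^-1) => u.
    by rewrite le_eqVlt; apply/orP; left; apply/eqP; ring.
split; first exact: normed_cvg.
apply: le_trans (lim_series_norm cN) _.
rewrite mulrC -[leRHS](lim_seriesZ C (is_cvg_series_exp_coeff _)).
apply: lim_series_le => // k.
apply: le_trans (cC k) _; rewrite fctE /exp_coeff/= /GRing.scale/= exprMn.
by move: (_^-1) => u; rewrite le_eqVlt; apply/orP; left; apply/eqP; ring.
Qed.

Definition risingS q a : R := limn (series (fun k => (- q) ^+ k / k`!%:R * rising_inv k a)).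

Lemma cvg_risingS q a : -1 < a ->
  series (fun k => (- q) ^+ k / k`!%:R * rising_inv k a) @ \oo -->
  (rGamma (a + 1))^-1 * besselF a q.
Proof.
move=> a1; have r0 : rGamma (a + 1) != 0.
  by rewrite gt_eqF// rGamma_gt0// -ltrBlDr sub0r.
have -> : series (fun k => (- q) ^+ k / k`!%:R * rising_inv k a) =
    (fun n => (rGamma (a + 1))^-1 * pseries (bessel_coef a) q n).
  apply/funext => n; rewrite /pseries /series/= mulr_sumr; apply: eq_bigr => k _.
  rewrite /bessel_coef rGamma_rising// [(- q) ^+ k]exprNn.
  move: (_`!%:R^-1 : R) (rGamma _) r0 => u r r0; by field.
by apply: cvgMl_tmp; exact: is_cvg_besselF.
Qed.

Lemma besselF_rising a q : -1 < a -> besselF a q = rGamma (a + 1) * risingS q a.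
Proof.
move=> a1; rewrite /risingS (cvg_lim _ (cvg_risingS q a a1))// mulVKf//.
by rewrite gt_eqF// rGamma_gt0// -ltrBlDr sub0r.
Qed.

(** The remainders of the terms are at most 8^k |q|^k h^2 / k!, and add up to at most exp(8|q|)
    h^2. *)
Lemma risingS_derivable q a : 0 <= a -> exists d : R, has_derive a 1 (risingS q) d.
Proof.
move=> a0.
have cdP k : exists d : R, `|d| <= 8 ^+ k /\
  forall h, `|h| <= 1 / 2 ->
    `|rising_inv k (a + h) - rising_inv k a - d * h| <= 8 ^+ k * h ^+ 2.
  by have [d d1 d2] := rising_inv_quad a k a0; exists d.
have [d /all_and2[d8 dh]] := choice cdP.
pose c k := (- q) ^+ k / k`!%:R.
have cE k : `|c k| = `|q| ^+ k / k`!%:R.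
  by rewrite /c normf_div normrX normrN normr_nat.
have [|cD _] := @normr_series_le (fun k => c k * d k) 1 q.
  move=> k; rewrite normrM cE; apply: le_trans (ler_wpM2l _ (d8 k)) _.
    by rewrite divr_ge0// exprn_ge0.
  move: (_`!%:R^-1 : R) => u; rewrite le_eqVlt; apply/orP; left; apply/eqP; ring.
exists (limn (series (fun k => c k * d k))).
apply: (@has_derive_quad _ _ _ _ (expR (8 * `|q|))) => h h12.
have ah : -1 < a + h by move: h12; rewrite ler_norml => /andP[]; lra.
have a1 : -1 < a by exact: lt_le_trans a0.
have [|cr rle] := @normr_series_le (fun k => c k *
    (rising_inv k (a + h) - rising_inv k a - d k * h)) (h ^+ 2) q.
  move=> k; rewrite normrM cE; apply: le_trans (ler_wpM2l _ (dh k h h12)) _.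
    by rewrite divr_ge0// exprn_ge0.
  move: (_`!%:R^-1 : R) => u; rewrite le_eqVlt; apply/orP; left; apply/eqP; ring.
apply: le_trans rle; rewrite le_eqVlt; apply/orP; left; apply/eqP; congr `|_|.
apply/esym/cvg_lim => //.
have -> : series (fun k => c k * (rising_inv k (a + h) - rising_inv k a - d k * h)) =
   (fun n => series (fun k => c k * rising_inv k (a + h)) n -
     series (fun k => c k * rising_inv k a) n -
     series (fun k => c k * d k) n * h).
  apply/funext => n; rewrite /series/= mulr_suml -!sumrB.
  by apply: eq_bigr => k _; ring.
apply: cvgB; last by apply: cvgMr_tmp.
by apply: cvgB; apply: cvgP; exact: cvg_risingS.
Qed.

Definition derivable_order (F : R -> R) a := exists d : R, has_derive a 1 F d.

(** Only the orders 0 and 1 are treated through the series. The three-term recurrence, read as an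
    identity between functions of the order, carries differentiability to the other integers. *)
Lemma besselJ_derivable_order z (n : int) : 0 < z ->
  derivable_order (fun a => besselJ a z) n%:~R.
Proof.
move=> z0; have z2 : 0 < z / 2 by rewrite divr_gt0.
have base b : 0 <= b -> derivable_order rGamma (b + 1) ->
    derivable_order (fun a => besselJ a z) b.
  move=> b0 [d1 h1]; have [d2 h2] := risingS_derivable (z ^+ 2 / 4) b b0.
  eexists; apply: (@near_eq_has_derive _ (fun a => expR (a * ln (z / 2)) *
      (rGamma (a + 1) * risingS (z ^+ 2 / 4) a))).
    near=> a; rewrite besselJE// /powR gt_eqF// besselF_rising//.
    near: a; apply: lt_nbhsr; exact: lt_le_trans b0.
  apply: has_derive_mul.
    apply: (has_derive_comp expR (fun a => a * ln (z / 2))); first exact: is_derive_expR.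
    by repeat derive_step.
  apply: has_derive_mul; last exact: h2.
  apply: (has_derive_comp rGamma (fun a => a + 1)); first exact: h1.
  by repeat derive_step.
have shift b c : derivable_order (fun a => besselJ a z) (b + c) ->
    derivable_order (fun a => besselJ (a + c) z) b.
  move=> [d hd]; eexists.
  apply: (has_derive_comp (fun a => besselJ a z) (fun a => a + c)); first exact: hd.
  by repeat derive_step.
apply: (int_ind2 (derivable_order (fun a => besselJ a z))).
- by apply: base => //; rewrite add0r; exact: rGamma_derivable1.
- by apply: base => //; rewrite (_ : 1 + 1 = 2); [exact: rGamma_derivable2|lra].
- move=> x [d1 h1] [d2 h2].
  have [e1 k1] := shift (x + 1) (- 2) ltac:(by exists d1; rewrite (_ : x + 1 - 2 = x - 1); [|ring]).
  have [e2 k2] := shift (x + 1) (- 1) ltac:(by exists d2; rewrite addrK).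
  eexists; apply: (@near_eq_has_derive _ (fun a => (2 / z) * (a - 1) * besselJ (a - 1) z -
      besselJ (a - 2) z)).
    near=> a; have := besselJ_rec (a - 1) z z0.
    rewrite (_ : a - 1 - 1 = a - 2); last by ring.
    by rewrite subrK => ->; ring.
  by repeat first [exact: k1|exact: k2|derive_step].
- move=> x [d1 h1] [d2 h2].
  have [e1 k1] := shift (x - 1) 2 ltac:(by exists d2; rewrite (_ : x - 1 + 2 = x + 1); [|ring]).
  have [e2 k2] := shift (x - 1) 1 ltac:(by exists d1; rewrite subrK).
  eexists; apply: (@near_eq_has_derive _ (fun a => (2 / z) * (a + 1) * besselJ (a + 1) z -
      besselJ (a + 2) z)).
    near=> a; have := besselJ_rec (a + 1) z z0.
    rewrite (_ : a + 1 + 1 = a + 2); last by ring.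
    by rewrite addrK => ->; ring.
  by repeat first [exact: k1|exact: k2|derive_step].
Unshelve. all: by end_near. Qed.

Lemma has_derive_slope (F : R -> R) x d : has_derive x 1 F d ->
  (F a - F x) / (a - x) @[a --> x^'] --> d.
Proof.
move=> /is_derive1_caratheodory[g [Fg cg gx]].
have : g a @[a --> x^'] --> d by rewrite -gx; exact: cvg_within_filter.
apply: cvg_trans; apply: near_eq_cvg; near=> a.
rewrite Fg mulfK// subr_eq0; near: a; exact: nbhs_dnbhs_neq.
Unshelve. all: by end_near. Qed.

Lemma sin_intpi (n : int) : sin (n%:~R * pi) = 0 :> R.
Proof.
apply: (int_ind2 (fun x => sin (x * pi) = 0)).
- by rewrite mul0r sin0.
- by rewrite mul1r sinpi.
- by move=> x _ h; rewrite mulrDl mul1r sinDpi h oppr0.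
- by move=> x h _; rewrite mulrBl mul1r sinBpi h oppr0.
Qed.

(** The limit is the definition of [besselY] at an integer, so that only its existence is at stake.
    It follows as in l'Hopital's rule: numerator and denominator both vanish at n and are
    differentiable there, and the derivative of the denominator, pi cos(n pi), is not 0. *)
Lemma besselY_nonint_cvg z (n : int) : 0 < z ->
  besselY_nonint a z @[a --> (n%:~R : R)^'] --> besselY n%:~R z.
Proof.
move=> z0; rewrite /besselY intr_int.
set x : R := n%:~R.
suff [l hl] : exists l : R, besselY_nonint a z @[a --> x^'] --> l by apply: cvgP hl.
have [d1 h1] := besselJ_derivable_order z n z0.
have [d2 h2] := besselJ_derivable_order z (- n) z0.
rewrite intrN -/x in h2; rewrite -/x in h1.
pose N a := besselJ a z * cos (a * pi) - besselJ (- a) z.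
have N0 : N x = 0 by rewrite /N besselJN_int// subrr.
have sx : sin (x * pi) = 0 by exact: sin_intpi.
have cx : cos (x * pi) != 0.
  apply: contra_eq_neq (cos2Dsin2 (x * pi)) => ->.
  by rewrite sx !expr0n/= addr0 eq_sym oner_neq0.
have hpi (a : R) : has_derive a 1 (fun a => a * pi) (a * 0 + pi * 1).
  by repeat derive_step.
have [d3 h3] : derivable_order N x.
  eexists; apply: has_derive_sub.
    apply: has_derive_mul; first exact: h1.
    by apply: (has_derive_comp cos) (hpi x); exact: has_derive_cos.
  apply: (has_derive_comp (fun a => besselJ a z) (fun a => - a)); first exact: h2.
  by repeat derive_step.
have h4 : has_derive x 1 (fun a => sin (a * pi)) (cos (x * pi) * pi).
  apply: has_derive_eq.
    by apply: (has_derive_comp sin) (hpi x); exact: has_derive_sin.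
  by rewrite mulr0 add0r mulr1.
exists (d3 / (cos (x * pi) * pi)).
have c4 : cos (x * pi) * pi != 0 by rewrite mulf_neq0// gt_eqF// pi_gt0.
have : (N a - N x) / (a - x) * ((sin (a * pi) - sin (x * pi)) / (a - x))^-1
    @[a --> x^'] --> d3 / (cos (x * pi) * pi).
  by apply: cvgM; [exact: has_derive_slope|apply: cvgV => //; exact: has_derive_slope].
apply: cvg_trans; apply: near_eq_cvg; near=> a.
have ax : a - x != 0 by rewrite subr_eq0; near: a; exact: nbhs_dnbhs_neq.
by rewrite N0 sx !subr0 invf_div mulrA mulfVK.
Unshelve. all: by end_near. Qed.

Lemma besselJ_cvg z (n : int) : 0 < z ->
  besselJ a z @[a --> (n%:~R : R)^'] --> besselJ n%:~R z.
Proof.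
move=> z0; have [d /has_derive1_continuous] := besselJ_derivable_order z n z0.
exact: cvg_within_filter.
Qed.

End Bessel.

(** * The ordinary differential equation of the multipliers *)

Section OscillatorStability.
Context {R : realType}.
Implicit Types (f h k m r : R -> R) (T M s e t : R).

Lemma derive_le0_nincr f (df : R -> R) (a b : R) : a <= b ->
  {within `[a, b], continuous f} ->
  (forall t, a < t < b -> has_derive t 1 f (df t) /\ df t <= 0) -> f b <= f a.
Proof.
rewrite le_eqVlt => /predU1P[->//|ab] cf fdf.
have [||c cab] := @MVT _ f df a b ab.
- by move=> x xab; have [] := fdf x; first by rewrite in_itv in xab.
- exact: cf.
move: cab; rewrite in_itv/= => cab.
have [_ d0] := fdf c cab => E.
by rewrite -subr_le0 E mulr_le0_ge0// subr_ge0 ltW.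
Qed.

(** Gronwall's argument for k^2 + s^2 h^2, multiplied by exp(-c t) and diminished by e^2 t. In c =
    2M + 1 the part 2M absorbs the damping, of either sign, and 1 comes from 2 k r <= k^2 + r^2. *)
Lemma oscillator_stability T M s e h k m r : 0 <= T -> 0 <= M ->
  {within `[0, T], continuous h} -> {within `[0, T], continuous k} ->
  (forall t, 0 < t < T -> has_derive t 1 h (k t) /\
     has_derive t 1 k (- (m t) * k t - s ^+ 2 * h t + r t)) ->
  (forall t, 0 < t < T -> `|m t| <= M) -> (forall t, 0 < t < T -> `|r t| <= e) ->
  s ^+ 2 * h T ^+ 2 <=
    expR ((2 * M + 1) * T) * (k 0 ^+ 2 + s ^+ 2 * h 0 ^+ 2 + e ^+ 2 * T).
Proof.
move=> T0 M0 ch ck dhk mM re.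
pose c := 2 * M + 1.
pose G t := expR (- c * t) * (k t ^+ 2 + s ^+ 2 * h t ^+ 2) - e ^+ 2 * t.
have GT : G T <= G 0.
  pose dG t := (- c * expR (- c * t) *
    (k t ^+ 2 + s ^+ 2 * h t ^+ 2) + expR (- c * t) * (2 * k t *
    (- (m t) * k t - s ^+ 2 * h t + r t) + s ^+ 2 * (2 * h t * k t)) - e ^+ 2).
  apply: (derive_le0_nincr G dG 0 T T0).
    have cX (f : R -> R) : {within `[0, T], continuous f} ->
        {within `[0, T], continuous (fun t => f t ^+ 2)}.
      move=> cf x; rewrite (_ : (fun t => f t ^+ 2) = (fun t => f t * f t)); last first.
        by apply/funext => y; rewrite expr2.
      by apply: cvgM; exact: cf.
    move=> x; apply: cvgB.
      apply: cvgM.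
        apply: (continuous_subspaceT (f := fun t : R => expR (- c * t))) => y.
        apply: (@continuous_comp _ _ _ (fun t => - c * t) expR).
          by apply: cvgMl_tmp; exact: cvg_id.
        exact: continuous_expR.
      apply: cvgD; first exact: cX ck x.
      by apply: cvgMl_tmp; exact: cX ch x.
    apply: (continuous_subspaceT (f := fun t : R => e ^+ 2 * t)) => y.
    by apply: cvgMl_tmp; exact: cvg_id.
  move=> t tT; have [dh dk] := dhk t tT; rewrite /dG; split.
    apply: has_derive_eq.
      apply: has_derive_sub.
        apply: has_derive_mul.
          apply: (has_derive_comp expR (fun t => - c * t)).
            exact: is_derive_expR.
          by repeat derive_step.
        by repeat first [exact: dh|exact: dk|derive_step].
      by repeat derive_step.
    rewrite /= !expr1; move: (expR _) => E; ring.
  have E0 : 0 <= expR (- c * t) <= 1.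
    rewrite expR_ge0 expR_le1 mulNr oppr_le0 mulr_ge0//; last by case/andP : tT => /ltW.
    by rewrite addr_ge0// mulr_ge0.
  have := mM t tT; have := re t tT; rewrite !ler_norml => /andP[r1 r2] /andP[m1 m2].
  have e0 : 0 <= e by lra.
  set E := expR _ in E0 *; case/andP : E0 => E0 E1.
  have H1 : 2 * k t * (- (m t) * k t - s ^+ 2 * h t + r t) + s ^+ 2 * (2 * h t * k t) <=
     c * (k t ^+ 2 + s ^+ 2 * h t ^+ 2) + e ^+ 2.
    have -> : 2 * k t * (- (m t) * k t - s ^+ 2 * h t + r t) + s ^+ 2 * (2 * h t * k t) =
      - 2 * (m t * k t ^+ 2) + 2 * (k t * r t) by ring.
    have K1 : - (m t * k t ^+ 2) <= M * k t ^+ 2.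
      by rewrite -mulNr ler_wpM2r ?sqr_ge0//; lra.
    have K2 : 2 * (k t * r t) <= k t ^+ 2 + r t ^+ 2.
      by have := sqr_ge0 (k t - r t); rewrite sqrrB; lra.
    have K3 : r t ^+ 2 <= e ^+ 2 by nra.
    have K4 : 0 <= s ^+ 2 * h t ^+ 2 by rewrite mulr_ge0 ?sqr_ge0.
    have K5 : 0 <= M * (s ^+ 2 * h t ^+ 2) by rewrite mulr_ge0.
    rewrite /c; lra.
  have H2 := ler_wpM2l E0 H1.
  have H3 : E * e ^+ 2 <= 1 * e ^+ 2 by rewrite ler_wpM2r ?sqr_ge0.
  lra.
move: GT; rewrite /G !mulr0 expR0 mul1r subr0 => GT.
have E0 : 0 < expR (c * T) by exact: expR_gt0.
have : expR (- c * T) * (k T ^+ 2 + s ^+ 2 * h T ^+ 2) <=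
    k 0 ^+ 2 + s ^+ 2 * h 0 ^+ 2 + e ^+ 2 * T by lra.
move=> /(ler_wpM2l (ltW E0)); rewrite mulrA -expRD -mulrDl addrN mul0r expR0 mul1r.
by apply: le_trans; rewrite lerDr sqr_ge0.
Qed.

End OscillatorStability.

(** * The multipliers as solutions of the oscillator equation *)

Section Multipliers.
Context {R : realType}.
Implicit Types (a rho s t z : R).

(** Real form of the multiplier at t_0 = 0: a determinant of Hankel functions is 2i times the
    corresponding determinant of J and Y, so that i pi / 4 becomes -pi / 2. The opposite sign of the
    second multiplier gives pi / 2 in [phi2]. *)
Definition phi1 rho s t : R := - (pi / 2 * s * (1 + t) `^ rho *
  (besselJ (rho - 1) s * besselY rho ((1 + t) * s) -
   besselY (rho - 1) s * besselJ rho ((1 + t) * s))).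

Definition phi2 rho s t : R := pi / 2 * (1 + t) `^ rho *
  (besselJ rho s * besselY rho ((1 + t) * s) -
   besselY rho s * besselJ rho ((1 + t) * s)).

Lemma sin_pi_neq0 a : a \isn't a Num.int -> sin (a * pi) != 0.
Proof.
move=> aN; pose f := a - (Num.floor a)%:~R.
have fE : a = f + (Num.floor a)%:~R by rewrite /f subrK.
have f01 : 0 < f < 1.
  have /andP[f0 f1] := archimedean.Num.Theory.floor_itv a.
  rewrite lt_neqAle; apply/andP; split; last by rewrite /f; move: f1; rewrite intrD; lra.
  rewrite subr_ge0 f0 andbT; apply: contra aN => /eqP f00.
  by rewrite fE -f00 add0r intr_int.
have sf : sin (f * pi) != 0.
  have /andP[f0 f1] := f01.
  by rewrite gt_eqF// sin_gt0_pi// mulr_gt0 ?pi_gt0//= gtr_pMl ?pi_gt0.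
rewrite fE; pose P x := sin ((f + x) * pi) != 0.
apply: (int_ind2 P); rewrite /P ?addr0//.
- by rewrite mulrDl mul1r sinDpi oppr_eq0.
- by move=> x _ h; rewrite addrA mulrDl mul1r sinDpi oppr_eq0.
- by move=> x h _; rewrite addrA mulrBl mul1r sinBpi oppr_eq0.
Qed.

Lemma has_derive_cylinder rho s t C D : 0 < s -> -1 < t -> cylinder rho C D ->
  has_derive t 1 (fun t => (1 + t) `^ rho * C ((1 + t) * s))
    (s * ((1 + t) `^ rho * D ((1 + t) * s))) /\
  has_derive t 1 (fun t => s * ((1 + t) `^ rho * D ((1 + t) * s)))
    ((2 * rho - 1) / (1 + t) * (s * ((1 + t) `^ rho * D ((1 + t) * s))) -
      s ^+ 2 * ((1 + t) `^ rho * C ((1 + t) * s))).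
Proof.
move=> s0 t1 CD; have t0 : 0 < 1 + t by lra.
have [dC dD] := CD _ (mulr_gt0 t0 s0).
have dp : has_derive t 1 (fun t : R => (1 + t) `^ rho) (rho / (1 + t) * (1 + t) `^ rho).
  apply: has_derive_eq.
    apply: (has_derive_comp (fun u => u `^ rho) (fun t => 1 + t)).
      exact: is_derive1_powR.
    by repeat derive_step.
  rewrite powRB ?(lt0r_neq0 t0) ?implybT// powRr1 ?(ltW t0)//.
  by field; rewrite gt_eqF.
have ds : has_derive t 1 (fun t : R => (1 + t) * s) s.
  by apply: has_derive_eq; [repeat derive_step|rewrite /=; ring].
have dCs := has_derive_comp C (fun t => (1 + t) * s) t 1 _ _ dC ds.
have dDs := has_derive_comp D (fun t => (1 + t) * s) t 1 _ _ dD ds.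
split.
  apply: has_derive_eq; first by apply: has_derive_mul; [exact: dp|exact: dCs].
  by rewrite /=; move: (_ `^ _) (C _) (D _) => P c d; field; rewrite !gt_eqF.
apply: has_derive_eq.
  apply: has_derive_mul; first exact: has_derive_cst.
  by apply: has_derive_mul; [exact: dp|exact: dDs].
by rewrite /=; move: (_ `^ _) (C _) (D _) => P c d; field; rewrite !gt_eqF.
Qed.

(** Collecting the coefficients of Y and J exhibits the combination as (1 + t)^rho times a cylinder
    function. Its derivative [z] is explicit through the companion of order rho - 1, and at t = 0
    both values reduce to the Wronskian. *)
Lemma multiplier_ode rho s h0 h1 : rho \isn't a Num.int -> 0 < s ->
  exists z : R -> R,
  [/\ phi1 rho s 0 * h0 + phi2 rho s 0 * h1 = h0, z 0 = h1 &
   forall t, -1 < t ->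
   has_derive t 1 (fun t => phi1 rho s t * h0 + phi2 rho s t * h1) (z t) /\
   has_derive t 1 z ((2 * rho - 1) / (1 + t) * z t -
     s ^+ 2 * (phi1 rho s t * h0 + phi2 rho s t * h1))].
Proof.
move=> rN s0; have sr := sin_pi_neq0 _ rN.
have rN1 : rho - 1 \isn't a Num.int by rewrite rpredBr ?rpred1.
have YE z : besselY rho z = besselY_nonint rho z by rewrite /besselY (negPf rN).
have Y1E z : besselY (rho - 1) z = besselY_nonint (rho - 1) z.
  by rewrite /besselY (negPf rN1).
pose A := - (pi / 2 * s * besselJ (rho - 1) s) * h0 + pi / 2 * besselJ rho s * h1.
pose B := pi / 2 * s * besselY (rho - 1) s * h0 - pi / 2 * besselY rho s * h1.
have CY := cylinder_lin _ A B _ _ _ _ (cylinder_besselY _ sr) (cylinder_besselJ rho).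
have W := bessel_wronskian _ _ s0 sr.
set C := (fun z => A * _ + _) in CY; set D := (fun z => A * besselY_nonint (rho - 1) z + _) in CY.
have yE t : phi1 rho s t * h0 + phi2 rho s t * h1 = (1 + t) `^ rho * C ((1 + t) * s).
  rewrite /phi1 /phi2 /C !YE !Y1E /A /B !YE !Y1E.
  move: (besselJ (rho - 1) s) (besselY_nonint (rho - 1) s) (besselJ rho s)
    (besselY_nonint rho s) (besselJ rho _) (besselY_nonint rho _) (_ `^ _).
  by move=> c1 c2 c3 c4 c5 c6 c7; ring.
exists (fun t => s * ((1 + t) `^ rho * D ((1 + t) * s))).
have p0 : pi != 0 :> R by rewrite gt_eqF ?pi_gt0.
split.
- rewrite yE addr0 powR1 !mul1r /C /A /B YE Y1E.
  have -> : (- (pi / 2 * s * besselJ (rho - 1) s) * h0 + pi / 2 * besselJ rho s * h1) *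
    besselY_nonint rho s + (pi / 2 * s * besselY_nonint (rho - 1) s * h0 -
    pi / 2 * besselY_nonint rho s * h1) * besselJ rho s =
    pi / 2 * s * h0 * (besselJ rho s * besselY_nonint (rho - 1) s -
      besselJ (rho - 1) s * besselY_nonint rho s) by ring.
  by rewrite W; move: (pi : R) p0 (lt0r_neq0 s0) => q q0 s00; field; rewrite ?q0 ?s00.
- rewrite addr0 powR1 !mul1r /D /A /B YE Y1E.
  have -> : s * ((- (pi / 2 * s * besselJ (rho - 1) s) * h0 + pi / 2 * besselJ rho s * h1) *
    besselY_nonint (rho - 1) s + (pi / 2 * s * besselY_nonint (rho - 1) s * h0 -
    pi / 2 * besselY_nonint rho s * h1) * besselJ (rho - 1) s) =
    pi / 2 * s * h1 * (besselJ rho s * besselY_nonint (rho - 1) s -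
      besselJ (rho - 1) s * besselY_nonint rho s) by ring.
  by rewrite W; move: (pi : R) p0 (lt0r_neq0 s0) => q q0 s00; field; rewrite ?q0 ?s00.
- move=> t t1; rewrite (_ : (fun t => _) = (fun t => (1 + t) `^ rho * C ((1 + t) * s))).
    by rewrite yE; exact: has_derive_cylinder.
  by apply/funext => u; exact: yE.
Qed.

Lemma near_nonint (n : int) : \forall a \near (n%:~R : R)^', a \isn't a Num.int.
Proof.
have b1 : \forall a \near (n%:~R : R), `|a - n%:~R| < 1.
  by apply/nbhs_ballP; exists 1 => //= a; rewrite /ball/= distrC.
near=> a; apply/negP => /intrP[k ak].
have an : a != n%:~R by near: a; exact: nbhs_dnbhs_neq.
have : `|a - n%:~R| < 1 by near: a; exact: cvg_within.
rewrite ak -intrB -intr_norm -[X in _ < X]/(1%:~R) ltr_int => H.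
by move: an; rewrite ak eqr_int; lia.
Unshelve. all: by end_near. Qed.

Lemma phi_cvg (n : int) s t : 0 < s -> 0 <= t ->
  phi1 a s t @[a --> (n%:~R : R)^'] --> phi1 n%:~R s t /\
  phi2 a s t @[a --> (n%:~R : R)^'] --> phi2 n%:~R s t.
Proof.
move=> s0 t0; have ts : 0 < (1 + t) * s by rewrite mulr_gt0//; lra.
have cp : (1 + t) `^ a @[a --> (n%:~R : R)^'] --> (1 + t) `^ n%:~R.
  apply: cvg_within_filter; rewrite /powR gt_eqF; last by lra.
  apply: (@continuous_comp _ _ _ (fun a => a * ln (1 + t)) expR).
    by apply: cvgMr_tmp; exact: cvg_id.
  exact: continuous_expR.
have nint := near_nonint n.
have cY z : 0 < z -> besselY a z @[a --> (n%:~R : R)^'] --> besselY n%:~R z.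
  move=> z0; apply: cvg_trans (besselY_nonint_cvg z n z0).
  by apply: near_eq_cvg; apply: filterS nint => a aN; rewrite /besselY (negPf aN).
have dnbhsB (f : R -> R) (l : R) : f a @[a --> ((n - 1)%:~R : R)^'] --> l ->
    f (a - 1) @[a --> (n%:~R : R)^'] --> l.
  move=> fl; apply: (cvg_comp (fun a => a - 1) f _ fl).
  move=> P /nbhs_ballP[e /= e0 eP]; apply/nbhs_ballP; exists e => //= a ae an.
  apply: eP; first by move: ae; rewrite /ball/= intrD opprB addrA addrNK.
  by apply: contra an => /eqP /(canRL (subrK _)) ->; rewrite intrD subrK.
have nB : (n - 1)%:~R = n%:~R - 1 :> R by rewrite intrD.
have cY1 z : 0 < z -> besselY (a - 1) z @[a --> (n%:~R : R)^'] --> besselY (n%:~R - 1) z.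
  move=> z0; apply: (@cvg_trans _ (besselY_nonint (a - 1) z @[a --> (n%:~R : R)^'])).
    apply: near_eq_cvg; apply: filterS nint => a aN; rewrite /besselY.
    by rewrite -[a - 1 \is a _]/(_ \in _) rpredBr ?rpred1// (negPf aN).
  by rewrite -nB; apply: (dnbhsB (besselY_nonint ^~ z)); exact: besselY_nonint_cvg.
have cJ1 z : 0 < z -> besselJ (a - 1) z @[a --> (n%:~R : R)^'] --> besselJ (n%:~R - 1) z.
  by move=> z0; rewrite -nB; apply: (dnbhsB (besselJ ^~ z)); exact: besselJ_cvg.
split.
  apply: cvgN; apply: cvgM; first by apply: cvgMl_tmp.
  apply: cvgB; apply: cvgM.
  - exact: cJ1 s0.
  - exact: cY ts.
  - exact: cY1 s0.
  - exact: besselJ_cvg ts.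
apply: cvgM; first by apply: cvgMl_tmp.
apply: cvgB; apply: cvgM.
- exact: besselJ_cvg s0.
- exact: cY ts.
- exact: cY s0.
- exact: besselJ_cvg ts.
Unshelve. all: by end_near. Qed.

End Multipliers.

(** * Integration over R^n *)

Section Continuity.
Set Implicit Arguments.
Unset Strict Implicit.
Context {R : realType}.

Section TopologicalDomain.
Context {T : topologicalType}.
Implicit Types f g : T -> R.

Lemma contD f g : continuous f -> continuous g -> continuous (fun x => f x + g x).
Proof. by move=> cf cg x; apply: cvgD; [exact: cf|exact: cg]. Qed.

Lemma contB f g : continuous f -> continuous g -> continuous (fun x => f x - g x).
Proof. by move=> cf cg x; apply: cvgB; [exact: cf|exact: cg]. Qed.

Lemma contN f : continuous f -> continuous (fun x => - f x).
Proof. by move=> cf x; apply: cvgN; exact: cf. Qed.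

Lemma contM f g : continuous f -> continuous g -> continuous (fun x => f x * g x).
Proof. by move=> cf cg x; apply: cvgM; [exact: cf|exact: cg]. Qed.

Lemma contV f : (forall x, f x != 0) -> continuous f -> continuous (fun x => (f x)^-1).
Proof. by move=> f0 cf x; apply: cvgV; [exact: f0|exact: cf]. Qed.

Lemma contC (a : R) : continuous (fun _ : T => a).
Proof. by move=> x; exact: cvg_cst. Qed.

Lemma contX f n : continuous f -> continuous (fun x => f x ^+ n).
Proof.
move=> cf; elim: n => [|n IH]; first exact: contC.
by under eq_fun do rewrite exprS; exact: contM.
Qed.

Lemma contComp (h : R -> R) f :
  continuous h -> continuous f -> continuous (fun x => h (f x)).
Proof. by move=> ch cf x; apply: continuous_comp; [exact: cf|exact: ch]. Qed.

Lemma contSum (I : Type) (r : seq I) (P : pred I) (f : I -> T -> R) :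
  (forall i, continuous (f i)) -> continuous (fun x => \sum_(i <- r | P i) f i x).
Proof.
move=> cf; elim: r => [|i r IH].
  by under eq_fun do rewrite big_nil; exact: contC.
by under eq_fun do rewrite big_cons; case: (P i) => //; exact: contD.
Qed.

Lemma contProd (I : Type) (r : seq I) (P : pred I) (f : I -> T -> R) :
  (forall i, continuous (f i)) -> continuous (fun x => \prod_(i <- r | P i) f i x).
Proof.
move=> cf; elim: r => [|i r IH].
  by under eq_fun do rewrite big_nil; exact: contC.
by under eq_fun do rewrite big_cons; case: (P i) => //; exact: contM.
Qed.

End TopologicalDomain.

Lemma contT (T U : topologicalType) (h : T -> U) (g : U -> R) :
  continuous h -> continuous g -> continuous (fun x => g (h x)).
Proof. by move=> ch cg x; apply: continuous_comp; [exact: ch|exact: cg]. Qed.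

Lemma contCst (T U : topologicalType) (a : U) : continuous (fun _ : T => a).
Proof. by move=> x; exact: cvg_cst. Qed.

Lemma contId (T : topologicalType) : continuous (fun x : T => x).
Proof. by move=> x; exact: cvg_id. Qed.

Lemma contPair (T U V : topologicalType) (f : T -> U) (g : T -> V) :
  continuous f -> continuous g -> continuous (fun x => (f x, g x)).
Proof. by move=> cf cg x; apply: cvg_pair; [exact: cf|exact: cg]. Qed.

End Continuity.

(** * Integration by parts and parameter integrals over row vectors *)

Section RowVectorIntegral.
Set Implicit Arguments.
Unset Strict Implicit.
Context {R : realType}.
Local Notation mT n := (n.-tuple (measurableTypeR R)).

Definition rowt n (p : mT n) : 'rV[R]_n := \row_i tnth p i.

Lemma continuous_ext (T U : topologicalType) (f g : T -> U) :
  (forall x, f x = g x) -> continuous f -> continuous g.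
Proof. by move=> /funext ->. Qed.

Lemma continuous_rV (T : topologicalType) n (f : T -> 'rV[R]_n) :
  (forall i, continuous (fun t => f t ord0 i)) -> continuous f.
Proof.
move=> cf t; apply/cvg_ballP => e e0.
have : \forall u \near t, forall i, ball (f t ord0 i) e (f u ord0 i).
  by apply: filter_forall => i; apply: (cvg_ball (cf i t)).
by apply: filterS => u fu; split => // j i; rewrite !ord1.
Qed.

(** The sigma-algebra on tuples comes from the coordinates, not from the topology of row vectors.
    The link is that an open set is the countable union of the boxes with rational centres and radii
    1/(m+1) that it contains. *)
Lemma measurable_rowt n (V : set 'rV[R]_n) : open V -> measurable (@rowt n @^-1` V).
Proof.
move=> oV.
pose box (c : 'rV[rat]_n * nat) : set (mT n) :=
  \bigcap_(i in [set: 'I_n]) [set p | `|tnth p i - ratr (c.1 ord0 i)| < c.2.+1%:R^-1].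
have mbox c : measurable (box c).
  apply: fin_bigcap_measurable => [|i _]; first exact: finite_finset.
  have mf : measurable_fun setT (fun p : mT n => `|tnth p i - ratr (c.1 ord0 i)| : R).
    apply: measurableT_comp; first by apply: continuous_measurable_fun; exact: norm_continuous.
    apply: measurable_funB; last exact: measurable_cst.
    exact: measurable_tnth.
  have := mf measurableT `]-oo, c.2.+1%:R^-1[%classic (measurable_itv _).
  by rewrite setTI; congr (measurable _); apply/seteqP; split => p /=; rewrite in_itv.
pose F c := if `[< forall p, box c p -> V (rowt p) >] then box c else set0.
have -> : @rowt n @^-1` V = \bigcup_c F c.
  apply/seteqP; split=> [p /= Vp|p [c _]]; last first.
    by rewrite /F; case: asboolP => // h /h.
  have /nbhs_ballP[e /= e0 eV] : nbhs (rowt p) V by exact: open_nbhs_nbhs.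
  (* Two points of a box of radius 1/(m+1) differ by less than 2/(m+1) in each coordinate, which has
     to stay below e. *)
  pose m := Num.truncn (2 / e).
  have m2e : 2 * m.+1%:R^-1 < e.
    by rewrite ltr_pdivrMr// mulrC -ltr_pdivrMr// truncnS_gt.
  have m0 : 0 < m.+1%:R^-1 :> R by rewrite invr_gt0.
  have /choice[c cP] : forall i : 'I_n, exists q : rat,
      `|tnth p i - ratr q| < m.+1%:R^-1.
    move=> i; have [] := @dense_rat R (ball (tnth p i) m.+1%:R^-1).
    - by exists (tnth p i); exact: ballxx.
    - exact: ball_open.
    by move=> x [bx [q _ qx]]; exists q; rewrite qx.
  exists (\row_i c i, m) => //; rewrite /F; case: asboolP => [_ i _/=|[]].
    by rewrite mxE; exact: cP.
  move=> q bq; apply: eV; split => // j i; rewrite ord1 !mxE /ball/=.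
  apply: lt_trans m2e; rewrite -(subrK (ratr (c i)) (tnth p i)) -addrA.
  apply: le_lt_trans (ler_normD _ _) _; rewrite mulr2n mulrDl mul1r ltrD//.
  by have := bq i I; rewrite /= mxE distrC.
apply: countable_bigcupT_measurable; first exact: countableP.
by move=> c; rewrite /F; case: ifP => _ //; exact: measurable0.
Qed.

Lemma continuous_measurable_rowt n (f : 'rV[R]_n -> R) : continuous f ->
  measurable_fun setT (fun p : mT n => f (rowt p)).
Proof.
move=> /continuousP cf; apply: (measurability _ (RGenOpens.measurableE R)).
move=> _ [_ [a [b ->] <-]]; rewrite setTI.
by apply: (measurable_rowt (V := f @^-1` `]a, b[)); apply: cf; exact: interval_open.
Qed.

(** The dominating function of all later integrals. Its product form lets its integral be computed
    one coordinate at a time, each factor contributing a finite arctangent integral. *)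
Definition wprod n (x : 'rV[R]_n) : R := \prod_i (1 + x ord0 i ^+ 2)^-1.

Lemma wprod_gt0 n (x : 'rV[R]_n) : 0 < wprod x.
Proof. by apply: prodr_gt0 => i _; rewrite invr_gt0 ltr_pwDl// sqr_ge0. Qed.

Lemma continuous_coord n (i : 'I_n) : continuous (fun x : 'rV[R]_n => x ord0 i).
Proof. by move=> x; exact: coord_continuous. Qed.

Lemma continuous_wprod n : continuous (@wprod n).
Proof.
apply: contProd => i; apply: contV => [x|].
  by rewrite gt_eqF// ltr_pwDl// sqr_ge0.
by apply: contD; [exact: contC|apply: contX; exact: continuous_coord].
Qed.

Lemma integral_oneDsqr_lty :
  (\int[@lebesgue_measure R]_x ((1 + x ^+ 2)^-1)%:E < +oo)%E.
Proof.
rewrite (@ge0_symfun_integralT _ (fun x : R => (1 + x ^+ 2)^-1)).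
- by rewrite -set_itvcy integral0y_oneDsqr -EFinM ltry.
- by move=> x; rewrite invr_ge0 addr_ge0// sqr_ge0.
- exact: continuous_oneDsqrV.
- by move=> x /=; rewrite sqrrN.
Qed.

Lemma integral_wprod_lty n :
  (\int[lebesgue_tuple n]_p (wprod (rowt p))%:E < +oo)%E.
Proof.
elim: n => [|n IH].
  rewrite /= integral_dirac//.
    by rewrite diracT mul1e ltry.
  by apply/measurable_EFinP; exact: (continuous_measurable_rowt (@continuous_wprod 0)).
have mw := continuous_measurable_rowt (@continuous_wprod n.+1).
rewrite /= /lebesgue_cons.
rewrite ge0_integral_pushforward//; last 3 first.
- exact: measurable_tcons.
- exact/measurable_EFinP.
- by move=> p _; rewrite lee_fin ltW// wprod_gt0.
rewrite preimage_setT fubini_tonelli1//=; last 2 first.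
- apply: measurableT_comp; last exact: measurable_tcons.
  by apply/measurable_EFinP; exact: mw.
- by move=> p; rewrite lee_fin ltW// wprod_gt0.
have E (a : R) (p : mT n) : wprod (rowt (tcons (a, p))) = (1 + a ^+ 2)^-1 * wprod (rowt p).
  rewrite /wprod big_ord_recl; congr (_ * _); first by rewrite mxE tnth0.
  by apply: eq_bigr => i _; rewrite !mxE tnthS.
rewrite /fubini_F; under eq_integral => a _.
  under eq_integral do rewrite /comp E EFinM.
  rewrite ge0_integralZl_EFin//; last 3 first.
  - by move=> p _; rewrite lee_fin ltW// wprod_gt0.
  - by apply/measurable_EFinP; exact: (continuous_measurable_rowt (@continuous_wprod n)).
  - by rewrite invr_ge0 addr_ge0// sqr_ge0.
  over.
have I0 : (0 <= \int[lebesgue_tuple n]_p (wprod (rowt p))%:E)%E.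
  by apply: integral_ge0 => p _; rewrite lee_fin ltW// wprod_gt0.
rewrite ge0_integralZr//; last first.
- by move=> a _; rewrite lee_fin invr_ge0 addr_ge0// sqr_ge0.
- have m1 : measurable_fun setT (fun x : R => (1 + x ^+ 2)^-1).
    by apply: continuous_measurable_fun; exact: continuous_oneDsqrV.
  by apply/measurable_EFinP; exact: m1.
apply: lte_mul_pinfty => //.
- by apply: integral_ge0 => a _; rewrite lee_fin invr_ge0 addr_ge0// sqr_ge0.
- rewrite ge0_fin_numE ?integral_oneDsqr_lty//.
  by apply: integral_ge0 => a _; rewrite lee_fin invr_ge0 addr_ge0// sqr_ge0.
Qed.

Lemma integrable_wprod n :
  (lebesgue_tuple n).-integrable setT (EFin \o (fun p => wprod (rowt p))).
Proof.
apply/integrableP; split.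
  by apply/measurable_EFinP; exact: (continuous_measurable_rowt (@continuous_wprod n)).
under eq_integral do rewrite /= ger0_norm ?(ltW (wprod_gt0 _))//.
exact: integral_wprod_lty.
Qed.

Lemma integrable_cont_le n (f : 'rV[R]_n -> R) (g : mT n -> R) : continuous f ->
  (forall p, `|f (rowt p)| <= g p) ->
  (lebesgue_tuple n).-integrable setT (EFin \o g) ->
  (lebesgue_tuple n).-integrable setT (EFin \o (fun p => f (rowt p))).
Proof.
move=> cf fg; apply: le_integrable => //.
  by apply/measurable_EFinP; exact: continuous_measurable_rowt.
by move=> p _; rewrite /= lee_fin (le_trans (fg p))// ler_norm.
Qed.

Lemma integrable_wprod_le n (f : 'rV[R]_n -> R) (C : R) : continuous f ->
  (forall x, `|f x| <= C * wprod x) ->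
  (lebesgue_tuple n).-integrable setT (EFin \o (fun p => f (rowt p))).
Proof.
move=> cf fC; apply: (integrable_cont_le (g := fun p => C * wprod (rowt p))) => //.
by apply: (integrableZl measurableT _ (integrable_wprod n)).
Qed.

Definition consv n (a : R) (x : 'rV[R]_n) : 'rV[R]_n.+1 :=
  \row_i (if unlift ord0 i is Some j then x ord0 j else a).

Lemma rowt_tcons n (a : R) (p : mT n) : rowt (tcons (a, p)) = consv a (rowt p).
Proof.
apply/rowP => i; rewrite !mxE; case: unliftP => [j ->|->]; last by rewrite tnth0.
by rewrite tnthS mxE.
Qed.

Lemma continuous_consv n (x : 'rV[R]_n) : continuous (fun a => consv a x).
Proof.
apply: continuous_rV => i; under eq_fun do rewrite mxE.
by case: (unlift ord0 i) => [j|]; [exact: contC|move=> a; exact: cvg_id].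
Qed.

Lemma continuous_consvr n (a : R) : continuous (@consv n a).
Proof.
apply: continuous_rV => i; under eq_fun do rewrite mxE.
by case: (unlift ord0 i) => [j|]; [exact: continuous_coord|exact: contC].
Qed.

Lemma fubini_rowt n (f : 'rV[R]_n.+1 -> R) (C : R) : continuous f ->
  (forall x, `|f x| <= C * wprod x) ->
  (\int[lebesgue_tuple n.+1]_p (f (rowt p))%:E =
   \int[@lebesgue_measure R]_a \int[lebesgue_tuple n]_p (f (consv a (rowt p)))%:E)%E /\
  (\int[lebesgue_tuple n.+1]_p (f (rowt p))%:E =
   \int[lebesgue_tuple n]_p \int[@lebesgue_measure R]_a (f (consv a (rowt p)))%:E)%E.
Proof.
move=> cf fC.
have If : (lebesgue_tuple n.+1).-integrable setT (EFin \o (fun p => f (rowt p))).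
  exact: integrable_wprod_le fC.
have mf : measurable_fun setT (fun p : mT n.+1 => (f (rowt p))%:E).
  by apply/measurable_EFinP; exact: continuous_measurable_rowt.
have I2 : (@lebesgue_measure R \x lebesgue_tuple n)%E.-integrable setT
    ((fun p => (f (rowt p))%:E) \o @tcons R n).
  apply/integrableP; split; first by apply: measurableT_comp => //; exact: measurable_tcons.
  have /integrableP[_] := If; rewrite /= /lebesgue_cons ge0_integral_pushforward//.
  - exact: measurable_tcons.
  - apply/measurable_EFinP; apply: measurableT_comp.
      by apply: continuous_measurable_fun; exact: norm_continuous.
    exact: continuous_measurable_rowt.
rewrite /= /lebesgue_cons integral_pushforward//; last exact: measurable_tcons.
rewrite preimage_setT; split.
  rewrite -(integral12_prod_meas1 I2) /fubini_F; apply: eq_integral => a _.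
  by apply: eq_integral => p _; rewrite /= rowt_tcons.
rewrite -(integral21_prod_meas1 I2) /fubini_G; apply: eq_integral => a _.
by apply: eq_integral => p _; rewrite /= rowt_tcons.
Qed.

Definition box n (B : R) : set 'rV[R]_n := [set x | forall i, `|x ord0 i| <= B].

Lemma compact_box n B : compact (@box n B).
Proof.
have := @rV_compact R n (fun _ => `[- B, B]%classic) (fun _ => @segment_compact R _ _).
by congr compact; apply/seteqP; split => x h i; have := h i; rewrite /= in_itv/= ler_norml.
Qed.

Lemma continuous_box_bounded n (f : 'rV[R]_n -> R) B : continuous f ->
  exists C, forall x, box B x -> `|f x| <= C.
Proof.
move=> cf; have : compact (f @` @box n B).
  apply: (@continuous_compact _ _ f (@box n B)); last exact: compact_box.
  exact: continuous_subspaceT.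
move=> /compact_bounded[C [Cr CP]]; exists (C + 1) => x Bx.
by apply: (CP (C + 1)); [rewrite ltrDl|exists x].
Qed.

Definition supported n B (f : 'rV[R]_n -> R) := forall x, ~ box B x -> f x = 0.

Lemma supported_wprod n (f : 'rV[R]_n -> R) B : continuous f -> supported B f ->
  exists C, forall x, `|f x| <= C * wprod x.
Proof.
move=> cf sf.
have [C HC] := continuous_box_bounded (f := fun x => f x / wprod x) B
  (contM cf (contV (fun x => lt0r_neq0 (wprod_gt0 x)) (@continuous_wprod n))).
exists (Num.max 0 C) => x; have w0 := wprod_gt0 x.
have [Bx|/sf ->] := pselect (box B x); last first.
  by rewrite normr0 mulr_ge0 ?(ltW w0)// le_max lexx.
rewrite -ler_pdivrMr// -[X in _ / X](gtr0_norm w0) -normf_div.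
by rewrite le_max HC// orbT.
Qed.

(** By Fubini the first coordinate is integrated last when it is not the differentiated one, and the
    induction hypothesis applies to the slices; otherwise it is integrated first, by the fundamental
    theorem of calculus. *)
Lemma integral_partial0 n (i : 'I_n) (f g : 'rV[R]_n -> R) B : continuous g ->
  (forall x, has_derive x (delta_mx ord0 i) f (g x)) ->
  supported B f -> supported B g ->
  (\int[lebesgue_tuple n]_p (g (rowt p))%:E = 0)%E.
Proof.
elim: n i f g B => [[]//|n IH] i f g B cg fg sf sg.
have [C gC] := supported_wprod cg sg.
have [F1 F2] := fubini_rowt cg gC.
case: (unliftP ord0 i) fg => [j ->|->] fg.
  rewrite F1 integral0_eq// => a _.
  apply: (IH j (fun x => f (consv a x)) (fun x => g (consv a x)) B).
  - exact: contT (@continuous_consvr n a) cg.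
  - move=> x; apply/has_derive_line; have /has_derive_line := fg (consv a x).
    rewrite (_ : (fun h => f (h *: _ + consv a x)) =
      (fun h => f (consv a (h *: delta_mx ord0 j + x))))//.
    apply/funext => h; congr f; apply/rowP => k; rewrite !mxE.
    case: unliftP => [l ->|->]; last by rewrite mulr0 add0r.
    by rewrite !mxE (inj_eq lift_inj).
  - move=> x nb; apply: sf => b; apply: nb => k.
    by have := b (lift ord0 k); rewrite mxE liftK.
  - move=> x nb; apply: sg => b; apply: nb => k.
    by have := b (lift ord0 k); rewrite mxE liftK.
rewrite F2 integral0_eq// => p _.
(* Strictly beyond B, so that f vanishes at both endpoints; the maximum with 0 is there because B
   has no prescribed sign. *)
pose B' := Num.max B 0 + 1.
have BB : B < B' by rewrite /B' ltr_pwDr// le_max lexx.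
have B0 : 0 < B' by rewrite /B' ltr_wpDl// le_max lexx orbT.
have nbox a : B < `|a| -> ~ box B (consv a (rowt p)).
  by move=> aB /(_ ord0); rewrite mxE unlift_none leNgt aB.
transitivity (\int[@lebesgue_measure R]_(a in `[(- B')%R, B'%R]) (g (consv a (rowt p)))%:E)%E.
  rewrite [RHS]integral_mkcond; apply: eq_integral => a _; rewrite patchE.
  case: ifPn => // /negP aI; rewrite sg//; apply: nbox.
  rewrite ltNge; apply/negP => aB; apply: aI; rewrite inE/= in_itv/= -ler_norml.
  by rewrite (le_trans aB)// ltW.
rewrite (@integral_FTC2 R (fun a => g (consv a (rowt p))) (fun a => f (consv a (rowt p)))).
- by rewrite !sf ?subrr//; apply: nbox; rewrite ?normrN gtr0_norm.
- by rewrite gtrN.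
- exact: (@contT R R 'rV[R]_n.+1 (fun a => consv a (rowt p)) g
    (@continuous_consv n (rowt p)) cg).
- move=> a; apply/has_derive_line; have /has_derive_line := fg (consv a (rowt p)).
  rewrite (_ : (fun h => f (h *: _ + consv a (rowt p))) =
    (fun h => f (consv (h *: 1 + a) (rowt p))))//.
  apply/funext => h; congr f; apply/rowP => k; rewrite !mxE.
  case: unliftP => [l ->|->]; rewrite ?mxE/=; last by [].
  by rewrite mulr0 add0r.
Qed.

Definition integrableRn n (f : 'rV[R]_n -> R) : Prop :=
  (lebesgue_tuple n).-integrable setT (EFin \o (fun p => f (rowt p))).

Lemma integrableRnD n (f g : 'rV[R]_n -> R) : integrableRn f -> integrableRn g ->
  integrableRn (fun x => f x + g x).
Proof. by move=> If Ig; exact: (integrableD measurableT If Ig). Qed.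

Lemma integrableRnZ n (a : R) (f : 'rV[R]_n -> R) : integrableRn f ->
  integrableRn (fun x => a * f x).
Proof. by move=> If; exact: (integrableZl measurableT a If). Qed.

Lemma integrableRnB n (f g : 'rV[R]_n -> R) : integrableRn f -> integrableRn g ->
  integrableRn (fun x => f x - g x).
Proof. by move=> If Ig; exact: (integrableB measurableT If Ig). Qed.

Lemma integralRnD n (f g : 'rV[R]_n -> R) : integrableRn f -> integrableRn g ->
  integralRn (fun x => f x + g x) = integralRn f + integralRn g.
Proof. by move=> If Ig; rewrite /integralRn RintegralD. Qed.

Lemma integralRnB n (f g : 'rV[R]_n -> R) : integrableRn f -> integrableRn g ->
  integralRn (fun x => f x - g x) = integralRn f - integralRn g.
Proof. by move=> If Ig; rewrite /integralRn RintegralB. Qed.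

Lemma integralRnZ n (a : R) (f : 'rV[R]_n -> R) : integrableRn f ->
  integralRn (fun x => a * f x) = a * integralRn f.
Proof. by move=> If; rewrite /integralRn RintegralZl. Qed.

Lemma integrableRn_sum n (I : Type) (r : seq I) (f : I -> 'rV[R]_n -> R) :
  (forall i, integrableRn (f i)) -> integrableRn (fun x => \sum_(i <- r) f i x).
Proof.
move=> If; elim: r => [|i r IH].
  under eq_fun do rewrite big_nil.
  by apply: (integrable_wprod_le (C := 0)) => [|x]; [exact: contC|rewrite normr0 mul0r].
by under eq_fun do rewrite big_cons; exact: integrableRnD.
Qed.

Lemma integralRn_sum n (I : Type) (r : seq I) (f : I -> 'rV[R]_n -> R) :
  (forall i, integrableRn (f i)) ->
  integralRn (fun x => \sum_(i <- r) f i x) = \sum_(i <- r) integralRn (f i).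
Proof.
move=> If; elim: r => [|i r IH].
  under eq_fun do rewrite big_nil; rewrite big_nil /integralRn.
  by rewrite /Rintegral integral0_eq.
under eq_fun do rewrite big_cons; rewrite big_cons integralRnD ?IH//.
exact: integrableRn_sum.
Qed.

Lemma le_integralRn n (f g : 'rV[R]_n -> R) : integrableRn f -> integrableRn g ->
  (forall x, f x <= g x) -> integralRn f <= integralRn g.
Proof. by move=> If Ig fg; apply: le_Rintegral. Qed.

Lemma normr_integralRn n (f g : 'rV[R]_n -> R) : integrableRn f -> integrableRn g ->
  (forall x, `|f x| <= g x) -> `|integralRn f| <= integralRn g.
Proof.
move=> If Ig fg; apply: le_trans (le_normr_Rintegral measurableT If) _.
apply: le_Rintegral => //; exact: (integrable_norm If).
Qed.

Lemma eq_integralRn n (f g : 'rV[R]_n -> R) : (forall x, f x = g x) ->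
  integralRn f = integralRn g.
Proof. by move=> /funext ->. Qed.

Lemma integralRn_partial0 n (i : 'I_n) (f g : 'rV[R]_n -> R) B : continuous g ->
  (forall x, has_derive x (delta_mx ord0 i) f (g x)) ->
  supported B f -> supported B g -> integralRn g = 0.
Proof.
move=> cg fg sf sg; rewrite /integralRn /Rintegral.
by have := integral_partial0 cg fg sf sg; rewrite /rowt => ->.
Qed.

Lemma integrableRn_supported n (f : 'rV[R]_n -> R) B :
  continuous f -> supported B f -> integrableRn f.
Proof. by move=> cf sf; have [C] := supported_wprod cf sf; exact: integrable_wprod_le. Qed.

Definition jcontinuous n (g : R -> 'rV[R]_n -> R) : Prop :=
  continuous (fun p : R * 'rV[R]_n => g p.1 p.2).

Lemma jcontinuous_x n (g : R -> 'rV[R]_n -> R) t : jcontinuous g -> continuous (g t).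
Proof.
move=> cg; apply: (contT (h := fun x : 'rV[R]_n => (t, x)) (g := fun p => g p.1 p.2)) cg.
exact: contPair (@contCst _ _ t) (@contId _).
Qed.

Lemma jcontinuous_t n (g : R -> 'rV[R]_n -> R) x : jcontinuous g -> continuous (g ^~ x).
Proof.
move=> cg; apply: (contT (h := fun t : R => (t, x)) (g := fun p => g p.1 p.2)) cg.
exact: contPair (@contId _) (@contCst _ _ x).
Qed.

Lemma jcontinuous_wprod n (g : R -> 'rV[R]_n -> R) B (u v : R) : jcontinuous g ->
  (forall t, supported B (g t)) ->
  exists2 C, 0 <= C & forall t x, u <= t <= v -> `|g t x| <= C * wprod x.
Proof.
move=> cg sg; pose h (p : R * 'rV[R]_n) := g p.1 p.2 / wprod p.2.
have ch : continuous h.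
  apply: contM cg (contV _ _) => [p|]; first by rewrite gt_eqF// wprod_gt0.
  by apply: (contT (h := @snd R 'rV[R]_n) _ (@continuous_wprod n)) => p; exact: cvg_snd.
have : compact (h @` (`[u, v]%classic `*` @box n B)).
  apply: (@continuous_compact _ _ h); first exact: continuous_subspaceT.
  by apply: compact_setX; [exact: segment_compact|exact: compact_box].
move=> /compact_bounded[C [Cr CP]].
exists (Num.max 0 (C + 1)) => [|t x tuv]; first by rewrite le_max lexx.
have w0 := wprod_gt0 x.
have [Bx|/sg ->] := pselect (box B x); last first.
  by rewrite normr0 mulr_ge0 ?(ltW w0)// le_max lexx.
rewrite -ler_pdivrMr// -[X in _ / X](gtr0_norm w0) -normf_div le_max.
apply/orP; right; apply: (CP (C + 1)); first by rewrite ltrDl.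
by exists (t, x).
Qed.

Lemma integralRn_continuous n (g : R -> 'rV[R]_n -> R) B : jcontinuous g ->
  (forall t, supported B (g t)) -> continuous (fun t => integralRn (g t)).
Proof.
move=> cg sg t.
have [C C0 gC] := jcontinuous_wprod (t - 1) (t + 1) cg sg.
have := @continuity_under_integral R _ _ (lebesgue_tuple n)
  (fun t p => g t (rowt p)) setT measurableT (t - 1) (t + 1) _ _
  (fun p => C * wprod (rowt p)) _ _ t.
apply.
- by move=> s _; apply: (integrableRn_supported (jcontinuous_x (t := s) cg) (sg s)).
- by apply: aeW => p _ s _; exact: jcontinuous_t.
- exact: (integrableRnZ C (integrable_wprod n)).
- move=> s /= /[!in_itv]/= /andP[s1 s2]; apply: aeW => p _; apply: gC.
  by rewrite !ltW.
- by rewrite inE/= in_itv/=; apply/andP; split; lra.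
Qed.

Lemma cvg_has_derive (f : R -> R) (x d : R) :
  h^-1 *: (f (h *: 1 + x) - f x) @[h --> (0 : R)^'] --> d -> has_derive x 1 f d.
Proof. by move=> cv; split; [exact: (cvgP _ cv)|exact: cvg_lim cv]. Qed.

(** The derivative is asked for on ]u, v[ only: with u = 0 this fits functions that are
    differentiable in time for t > 0. *)
Lemma integralRn_derive n (g g' : R -> 'rV[R]_n -> R) B (u v t : R) : u < t < v ->
  jcontinuous g -> jcontinuous g' ->
  (forall s, supported B (g s)) -> (forall s, supported B (g' s)) ->
  (forall (s : R) x, u < s < v -> has_derive s 1 (g ^~ x) (g' s x)) ->
  has_derive t 1 (fun t => integralRn (g t)) (integralRn (g' t)).
Proof.
move=> tuv cg cg' sg sg' gg'.
have [C C0 gC] := jcontinuous_wprod u v cg' sg'.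
have It : `]u, v[%classic t by rewrite /= in_itv.
have d1 s x : `]u, v[%classic s -> partial1of2 (fun t p => g t (rowt p)) s x = g' s (rowt x).
  rewrite /= in_itv/= => suv; rewrite /partial1of2 derive1E.
  by case: (gg' s (rowt x) suv).
have uvt s : `]u, v[%classic s -> u <= s <= v.
  by rewrite /= in_itv/= => /andP[us sv]; rewrite !ltW.
have cv : h^-1 *: (integralRn (g (h + t)) - integralRn (g t)) @[h --> (0 : R)^'] -->
    integralRn (g' t).
  rewrite (_ : integralRn (g' t) =
    \int[lebesgue_tuple n]_(p in setT) partial1of2 (fun t p => g t (rowt p)) t p); last first.
    by rewrite /integralRn; apply: eq_Rintegral => p _; rewrite d1.
  apply: (@cvg_differentiation_under_integral R _ _ (lebesgue_tuple n)
    (fun t p => g t (rowt p)) setT measurableT t u v It _ _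
    (fun p => C * wprod (rowt p)) _ _ _).
  - by move=> s _; apply: (integrableRn_supported (jcontinuous_x (t := s) cg) (sg s)).
  - by move=> s p; rewrite /= in_itv/= => suv _; case: (gg' s (rowt p) suv).
  - by move=> p; rewrite mulr_ge0// ltW// wprod_gt0.
  - exact: (integrableRnZ C (integrable_wprod n)).
  - by move=> s p sI _; rewrite d1//; exact/gC/uvt.
by apply: (@cvg_has_derive (fun t => integralRn (g t))); under eq_fun do rewrite [_ *: 1]mulr1.
Qed.

End RowVectorIntegral.

(** * The weighted energy *)

Section Weights.
Set Implicit Arguments.
Unset Strict Implicit.
Context {R : realType}.

(** It serves twice: its square is C^1 and gives the cutoffs, and composition with it in time
    extends functions given for t >= 0 to the whole line. *)
Definition pos (y : R) := Num.max 0 y.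

Lemma pos_ge0 y : 0 <= pos y.
Proof. by rewrite le_max lexx. Qed.

Lemma pos_sqr y : pos y * y = pos y ^+ 2.
Proof. by rewrite /pos; case: (leP 0 y) => y0; rewrite ?expr2// mul0r mulr0. Qed.

Lemma continuous_pos : continuous pos.
Proof. by move=> y; apply: (@continuous_max R R (cst 0) id y); [exact: cvg_cst|exact: cvg_id]. Qed.

Lemma has_derive_pos_sqr (y : R) : has_derive y 1 (fun y => pos y ^+ 2) (2 * pos y).
Proof.
apply: (@has_derive_quad _ _ _ _ 1) => h _; rewrite ler_norml /pos.
by case: (leP 0 (y + h)) => yh; case: (leP 0 y) => y0; apply/andP; split; nra.
Qed.

Lemma has_derive_coord n (i j : 'I_n) (x : 'rV[R]_n) :
  has_derive x (delta_mx ord0 i) (fun x => x ord0 j) (i == j)%:R.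
Proof.
apply/has_derive_line.
rewrite (_ : (fun h => _) = (fun h : R => h * (i == j)%:R + x ord0 j)); last first.
  by apply/funext => h; rewrite !mxE eqxx/= eq_sym.
apply: has_derive_eq; first by repeat derive_step.
by rewrite /= mulr0 add0r addr0 mulr1.
Qed.

Definition bracket n (x : 'rV[R]_n) : R := 1 + \sum_i x ord0 i ^+ 2.

Lemma bracket_ge1 n (x : 'rV[R]_n) : 1 <= bracket x.
Proof. by rewrite lerDl sumr_ge0// => i _; exact: sqr_ge0. Qed.

Lemma bracket_gt0 n (x : 'rV[R]_n) : 0 < bracket x.
Proof. exact: lt_le_trans ltr01 (bracket_ge1 x). Qed.

Lemma coord_sqr_le_bracket n (x : 'rV[R]_n) i : 1 + x ord0 i ^+ 2 <= bracket x.
Proof.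
rewrite lerD2l (bigD1 i)//= lerDl sumr_ge0// => j _; exact: sqr_ge0.
Qed.

Lemma continuous_bracket n : continuous (@bracket n).
Proof.
apply: contD; first exact: contC.
by apply: contSum => i; apply: contX; exact: continuous_coord.
Qed.

Lemma has_derive_bracket n (i : 'I_n) (x : 'rV[R]_n) :
  has_derive x (delta_mx ord0 i) (@bracket n) (2 * x ord0 i).
Proof.
apply: has_derive_eq.
  apply: has_derive_add; first exact: has_derive_cst.
  by apply: has_derive_bigsum => j; apply: has_derive_exp; exact: has_derive_coord.
rewrite add0r (bigD1 i)//= eqxx mulr1 expr1 big1 ?addr0// => j ji.
by rewrite eq_sym (negPf ji) mulr0.
Qed.

Lemma bracket_expn_wprod n (x : 'rV[R]_n) : (bracket x ^+ n)^-1 <= wprod x.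
Proof.
have b0 := bracket_gt0 x.
have -> : wprod x = (\prod_i (1 + x ord0 i ^+ 2))^-1 by rewrite /wprod prodfV.
rewrite lef_pV2 ?posrE ?exprn_gt0//; last first.
  by apply: prodr_gt0 => i _; rewrite ltr_pwDl// sqr_ge0.
rewrite -[X in _ ^+ X](card_ord n) -prodr_const; apply: ler_prod => i _.
by rewrite coord_sqr_le_bracket addr_ge0// sqr_ge0.
Qed.

Lemma box_bracket n (x : 'rV[R]_n) N : bracket x <= N -> box N x.
Proof.
move=> xN i; apply: le_trans xN; apply: le_trans (coord_sqr_le_bracket x i).
rewrite ler_norml; apply/andP; split; nra.
Qed.

(* With Q = bracket x and u = exp(-2t), this weight psi has compact support and
   satisfies psi_t <= - 2 Q |dpsi/dQ| - 2 psi, so that it absorbs the energy flux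
   whatever the growth of the solution. *)
Section ConeWeight.
Variables (n k : nat).
Implicit Types (u N : R) (x : 'rV[R]_n).

Definition cone_weight N u x : R :=
  u ^+ k.+2 * bracket x ^+ k.+1 * pos (u * N - bracket x) ^+ 2.

(** Derivative of the weight in t along u' = -2u, rather than in u; the next function is its
    derivative in Q. *)
Definition cone_weight_u N u x : R :=
  - 2 * (k.+2%:R * cone_weight N u x +
    2 * (u * N) * u ^+ k.+2 * bracket x ^+ k.+1 * pos (u * N - bracket x)).

Definition cone_weight_q N u x : R :=
  u ^+ k.+2 * (k.+1%:R * bracket x ^+ k * pos (u * N - bracket x) ^+ 2 -
    2 * bracket x ^+ k.+1 * pos (u * N - bracket x)).

Lemma cone_weight_ge0 N u x : 0 <= u -> 0 <= cone_weight N u x.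
Proof.
move=> u0; have b0 := ltW (bracket_gt0 x).
by apply: mulr_ge0; [apply: mulr_ge0; exact: exprn_ge0|exact: sqr_ge0].
Qed.

Lemma has_derive_cone_weight_t N (u : R -> R) (t : R) x :
  has_derive t 1 u (- 2 * u t) ->
  has_derive t 1 (fun t => cone_weight N (u t) x) (cone_weight_u N (u t) x).
Proof.
move=> du; apply: has_derive_eq.
  apply: has_derive_mul.
    apply: has_derive_mul; first by apply: has_derive_exp du.
    exact: has_derive_cst.
  apply: (has_derive_comp (fun y => pos y ^+ 2) (fun t => u t * N - bracket x)).
    exact: has_derive_pos_sqr.
  by repeat first [exact: du|derive_step].
rewrite /cone_weight_u /cone_weight [in u t ^+ k.+2]exprS /= !exprS; ring.
Qed.

Lemma has_derive_cone_weight_x N u x (i : 'I_n) :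
  has_derive x (delta_mx ord0 i) (cone_weight N u) (2 * x ord0 i * cone_weight_q N u x).
Proof.
have dQ := has_derive_bracket i x.
apply: has_derive_eq.
  apply: has_derive_mul.
    apply: has_derive_mul; first exact: has_derive_cst.
    by apply: has_derive_exp dQ.
  apply: (has_derive_comp (fun y => pos y ^+ 2) (fun x => u * N - bracket x)).
    exact: has_derive_pos_sqr.
  by repeat first [exact: dQ|derive_step].
rewrite /cone_weight_q /= !exprS; ring.
Qed.

(** With p the positive part of uN - Q, one has uN = Q + p wherever p is not 0. Differentiating the
    power of u pays for the derivative of Q^(k+1), and the retreat of the cutoff cancels the
    derivative of p^2 in Q. What remains is -4 times the weight. *)
Lemma cone_weight_decay N u x : 0 <= u ->
  cone_weight_u N u x + 2 * bracket x * `|cone_weight_q N u x| +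
    2 * cone_weight N u x <= 0.
Proof.
move=> u0; rewrite /cone_weight_u /cone_weight_q /cone_weight.
have := pos_sqr (u * N - bracket x); have := pos_ge0 (u * N - bracket x).
set p := pos _ => p0 pE; set a := u ^+ k.+2; set q := bracket x ^+ k.
have a0 : 0 <= a by exact: exprn_ge0.
have Q0 := ltW (bracket_gt0 x).
have q0 : 0 <= q by exact: exprn_ge0.
rewrite [bracket x ^+ k.+1]exprS -/q [_ * q]mulrC.
have le1 : `|a * (k.+1%:R * q * p ^+ 2 - 2 * (q * bracket x) * p)| <=
    a * (k.+1%:R * q * p ^+ 2 + 2 * (q * bracket x) * p).
  rewrite normrM (ger0_norm a0) ler_wpM2l//.
  apply: le_trans (ler_normB _ _) _.
  by rewrite !ger0_norm// ?mulr_ge0 ?sqr_ge0.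
apply: (@le_trans _ _ (- 4 * (a * q * bracket x * p ^+ 2))); last first.
  have := mulr_ge0 (mulr_ge0 (mulr_ge0 a0 q0) Q0) (sqr_ge0 p).
  lra.
have le2 := ler_wpM2l (mulr_ge0 (ler0n R 2) Q0) le1.
apply: le_trans (lerD (lerD (lexx _) le2) (lexx _)) _.
rewrite le_eqVlt; apply/orP; left; apply/eqP.
rewrite -[k.+2%:R]natr1.
have -> : p ^+ 2 = p * (u * N - bracket x) by [].
ring.
Qed.

Lemma supported_cone_weight N u (f : 'rV[R]_n -> R) : 0 <= N -> 0 <= u <= 1 ->
  supported N (fun x => cone_weight N u x * f x).
Proof.
move=> N0 /andP[u0 u1] x nB; rewrite /cone_weight /pos.
case: leP => [uQ|_]; last by rewrite expr0n mulr0 mul0r.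
case: nB; apply: box_bracket; rewrite subr_ge0 in uQ.
by apply: le_trans uQ _; rewrite ler_piMl.
Qed.

Lemma supported_cone_weight_u N u (f : 'rV[R]_n -> R) : 0 <= N -> 0 <= u <= 1 ->
  supported N (fun x => cone_weight_u N u x * f x).
Proof.
move=> N0 /andP[u0 u1] x nB; rewrite /cone_weight_u /cone_weight /pos.
case: leP => [uQ|_]; last by rewrite expr0n !mulr0 addr0 mulr0 mul0r.
case: nB; apply: box_bracket; rewrite subr_ge0 in uQ.
by apply: le_trans uQ _; rewrite ler_piMl.
Qed.

Lemma supported_cone_weight_q N u (f : 'rV[R]_n -> R) : 0 <= N -> 0 <= u <= 1 ->
  supported N (fun x => cone_weight_q N u x * f x).
Proof.
move=> N0 /andP[u0 u1] x nB; rewrite /cone_weight_q /pos.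
case: leP => [uQ|_]; last by rewrite expr0n !mulr0 subr0 mulr0 mul0r.
case: nB; apply: box_bracket; rewrite subr_ge0 in uQ.
by apply: le_trans uQ _; rewrite ler_piMl.
Qed.

End ConeWeight.

Lemma supportedD n B (f g : 'rV[R]_n -> R) : supported B f -> supported B g ->
  supported B (fun x => f x + g x).
Proof. by move=> sf sg x nB; rewrite sf// sg// addr0. Qed.

Lemma jcontinuous_cstt n (f : 'rV[R]_n -> R) :
  continuous f -> continuous (fun p : R * 'rV[R]_n => f p.2).
Proof. by move=> cf; apply: (contT (h := snd)) cf => p; exact: cvg_snd. Qed.

Lemma jcontinuous_cstx n (f : R -> R) :
  continuous f -> continuous (fun p : R * 'rV[R]_n => f p.1).
Proof. by move=> cf; apply: (contT (h := fst)) cf => p; exact: cvg_fst. Qed.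

(** The positive part keeps the values in [0, 1] at negative times too, so that the support stays in
    one box for all t. *)
Definition shrink (t : R) := expR (- 2 * pos t).

Lemma continuous_shrink : continuous shrink.
Proof.
apply: (contComp (h := expR)); first exact: continuous_expR.
by apply: contM; [exact: contC|exact: continuous_pos].
Qed.

Lemma shrink_itv t : 0 <= shrink t <= 1.
Proof.
by rewrite expR_ge0 /= -expR0 ler_expR mulNr oppr_le0 mulr_ge0// pos_ge0.
Qed.

Lemma has_derive_shrink (t : R) : 0 < t ->
  has_derive t 1 shrink (- 2 * shrink t).
Proof.
move=> t0; have pE s : 0 <= s -> pos s = s by move=> s0; exact/max_idPr.
apply: (@near_eq_has_derive _ (fun s => expR (- 2 * s))).
  near=> s; rewrite /shrink pE//; near: s.
  by apply: filterS (lt_nbhsr t0) => s /ltW.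
rewrite /shrink pE; last exact: ltW.
apply: has_derive_eq.
  apply: (@has_derive_comp R R expR (fun s => - 2 * s) t 1); first exact: is_derive_expR.
  by repeat derive_step.
by rewrite /= mulr0 addr0 mulr1 mulrC.
Unshelve. all: by end_near. Qed.

End Weights.

Ltac cont_step :=
  lazymatch goal with
  | |- continuous ?h =>
    lazymatch h with
    | (fun x => @?f x + - @?g x) => refine (@contB _ _ f g _ _)
    | (fun x => @?f x + @?g x) => refine (@contD _ _ f g _ _)
    | (fun x => - @?f x) => refine (@contN _ _ f _)
    | (fun x => @?f x * @?g x) => refine (@contM _ _ f g _ _)
    | (fun x => @?f x ^+ ?n) => refine (@contX _ _ f n _)
    | (fun x => \sum_(i <- ?r | @?P i) @?f x i) =>
        refine (@contSum _ _ _ r P (fun i x => f x i) _) => ?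
    | (fun _ => ?a) => refine (@contC _ _ a)
    end
  end; cbv beta.

(** * The energy inequality with the retreating weight *)

Section Energy.
Set Implicit Arguments.
Unset Strict Implicit.
Context {R : realType}.

(** Continuity is required for all t, but the time derivatives and the equation only for t > 0: this
    fits a solution on t >= 0 extended by its values at t = 0. The field [Wtx] is both the
    t-derivative of [Wx] and the x-derivative of [Wt]. *)
Record wave_solution n (mu : R) (W Wt Wtt : R -> 'rV[R]_n -> R)
    (Wx Wtx Wxx : 'I_n -> R -> 'rV[R]_n -> R) : Prop := WaveSolution {
  wave_cont : jcontinuous W;
  wave_cont_t : jcontinuous Wt;
  wave_cont_tt : jcontinuous Wtt;
  wave_cont_x : forall i, jcontinuous (Wx i);
  wave_cont_tx : forall i, jcontinuous (Wtx i);
  wave_cont_xx : forall i, jcontinuous (Wxx i);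
  wave_dt : forall (t : R) x, 0 < t -> has_derive t 1 (W ^~ x) (Wt t x);
  wave_dtt : forall (t : R) x, 0 < t -> has_derive t 1 (Wt ^~ x) (Wtt t x);
  wave_dtx : forall i (t : R) x, 0 < t -> has_derive t 1 (Wx i ^~ x) (Wtx i t x);
  wave_dx : forall i t x, has_derive x (delta_mx ord0 i) (W t) (Wx i t x);
  wave_dxt : forall i t x, has_derive x (delta_mx ord0 i) (Wt t) (Wtx i t x);
  wave_dxx : forall i t x, has_derive x (delta_mx ord0 i) (Wx i t) (Wxx i t x);
  wave_eq : forall t x, 0 < t -> Wtt t x = \sum_i Wxx i t x - mu / (1 + t) * Wt t x
}.

Variables (n : nat) (mu : R) (W Wt Wtt : R -> 'rV[R]_n -> R).
Variables (Wx Wtx Wxx : 'I_n -> R -> 'rV[R]_n -> R).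
Hypothesis mu0 : 0 < mu.
Hypothesis HW : wave_solution mu W Wt Wtt Wx Wtx Wxx.

Let cW := wave_cont HW.
Let cWt := wave_cont_t HW.
Let cWtt := wave_cont_tt HW.
Let cWx := wave_cont_x HW.
Let cWtx := wave_cont_tx HW.
Let cWxx := wave_cont_xx HW.

(** The usual wave energy controls derivatives only; W^2 is added because the decay of W itself is
    needed. *)
Definition energy t x : R := Wt t x ^+ 2 + \sum_i Wx i t x ^+ 2 + W t x ^+ 2.

Definition energy_t t x : R :=
  2 * Wt t x * Wtt t x + \sum_i 2 * Wx i t x * Wtx i t x + 2 * W t x * Wt t x.

Lemma energy_ge0 t x : 0 <= energy t x.
Proof.
by rewrite !addr_ge0 ?sqr_ge0// sumr_ge0// => i _; exact: sqr_ge0.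
Qed.

Lemma jcontinuous_energy : jcontinuous energy.
Proof. by rewrite /jcontinuous /energy; repeat cont_step; [exact: cWt|exact: cWx|exact: cW]. Qed.

Lemma jcontinuous_energy_t : jcontinuous energy_t.
Proof.
rewrite /jcontinuous /energy_t; repeat cont_step.
- exact: cWt.
- exact: cWtt.
- exact: cWx.
- exact: cWtx.
- exact: cW.
- exact: cWt.
Qed.

Lemma has_derive_energy (t : R) x : 0 < t -> has_derive t 1 (energy ^~ x) (energy_t t x).
Proof.
move=> t0; apply: has_derive_eq.
  apply: has_derive_add; last by apply: has_derive_exp; exact: wave_dt HW _ _ t0.
  apply: has_derive_add; first by apply: has_derive_exp; exact: wave_dtt HW _ _ t0.
  by apply: has_derive_bigsum => i; apply: has_derive_exp; exact: wave_dtx HW _ _ _ t0.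
rewrite /energy_t /= !expr1; congr (_ + _).
Qed.

Variable k : nat.
Local Notation w N t x := (cone_weight k N (shrink t) x).
Local Notation wu N t x := (cone_weight_u k N (shrink t) x).
Local Notation wq N t x := (cone_weight_q k N (shrink t) x).

Let cu : continuous (fun p : R * 'rV[R]_n => shrink p.1).
Proof. exact: jcontinuous_cstx continuous_shrink. Qed.

Let cb : continuous (fun p : R * 'rV[R]_n => bracket p.2).
Proof. exact: jcontinuous_cstt (@continuous_bracket R n). Qed.

Let cp N : continuous (fun p : R * 'rV[R]_n => pos (shrink p.1 * N - bracket p.2)).
Proof.
apply: (contComp (h := pos)); first exact: continuous_pos.
by repeat cont_step; [exact: cu|exact: cb].
Qed.

Lemma jcontinuous_cone_weight N : continuous (fun p : R * 'rV[R]_n => w N p.1 p.2).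
Proof.
by rewrite /cone_weight; repeat cont_step; [exact: cu|exact: cb|exact: cp].
Qed.

Lemma jcontinuous_cone_weight_u N : continuous (fun p : R * 'rV[R]_n => wu N p.1 p.2).
Proof.
rewrite /cone_weight_u; repeat cont_step.
- exact: jcontinuous_cone_weight.
- exact: cu.
- exact: cu.
- exact: cb.
- exact: cp.
Qed.

Lemma jcontinuous_cone_weight_q N : continuous (fun p : R * 'rV[R]_n => wq N p.1 p.2).
Proof.
rewrite /cone_weight_q; repeat cont_step.
- exact: cu.
- exact: cb.
- exact: cp.
- exact: cb.
- exact: cp.
Qed.

(* The derivative of [w Wt Wx_i] along the i-th axis, whose integral vanishes. *)
Let flux (N : R) (i : 'I_n) (t : R) (x : 'rV[R]_n) : R :=
  2 * x ord0 i * wq N t x * (Wt t x * Wx i t x) +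
  w N t x * (Wtx i t x * Wx i t x + Wt t x * Wxx i t x).

(** After the equation is inserted, three terms remain besides the derivative of the weight. The
    damping has a favourable sign. The gradient of the weight is paired with 2 |x_i Wt Wx_i| <=
    x_i^2 Wt^2 + Wx_i^2, whose sum is at most Q times the energy. The term 2 W Wt is at most the
    energy. [cone_weight_decay] absorbs the last two. *)
Let energy_flux_le N t x : 0 < t ->
  wu N t x * energy t x + w N t x * energy_t t x <= \sum_i 2 * flux N i t x.
Proof.
move=> t0; have /andP[u0 u1] := shrink_itv t.
have := cone_weight_decay k N x u0.
have := cone_weight_ge0 k N x u0.
rewrite /flux; set W0 := w N t x; set W1 := wu N t x; set W2 := wq N t x => w0 decay.
have S0 := energy_ge0 t x; have Q1 := bracket_ge1 x.
have m0 : 0 <= mu / (1 + t) by rewrite divr_ge0 ?ltW//; lra.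
have le1 : - (\sum_i 2 * x ord0 i * W2 * (Wt t x * Wx i t x)) <=
    `|W2| * (bracket x * energy t x).
  apply: (@le_trans _ _ (\sum_i `|W2| * (x ord0 i ^+ 2 * Wt t x ^+ 2 + Wx i t x ^+ 2))).
    rewrite -sumrN; apply: ler_sum => i _.
    apply: le_trans (ler_norm _) _.
    rewrite (_ : - _ = W2 * (- (2 * (x ord0 i * Wt t x * Wx i t x)))); last by ring.
    rewrite normrM ler_wpM2l// ler_norml; apply/andP; split.
      by have := sqr_ge0 (x ord0 i * Wt t x - Wx i t x); rewrite -exprMn; nra.
    by have := sqr_ge0 (x ord0 i * Wt t x + Wx i t x); rewrite -exprMn; nra.
  rewrite -mulr_sumr ler_wpM2l// big_split/= -mulr_suml /bracket /energy.
  have : 0 <= \sum_i x ord0 i ^+ 2 by apply: sumr_ge0 => i _; exact: sqr_ge0.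
  have : 0 <= \sum_i Wx i t x ^+ 2 by apply: sumr_ge0 => i _; exact: sqr_ge0.
  move: (\sum_i x ord0 i ^+ 2) (\sum_i Wx i t x ^+ 2) => A B B0 A0.
  have := sqr_ge0 (Wt t x); have := sqr_ge0 (W t x); nra.
rewrite -mulr_sumr big_split/= -mulr_sumr big_split/= -mulr_sumr.
rewrite /energy_t (wave_eq HW _ t0).
have -> : \sum_i 2 * Wx i t x * Wtx i t x = 2 * \sum_i Wtx i t x * Wx i t x.
  by rewrite mulr_sumr; apply: eq_bigr => i _; ring.
move: (\sum_i _ * (_ * _)) le1 => Z le1.
move: (\sum_i Wtx i t x * Wx i t x) (\sum_i Wxx i t x) => P L.
have E0 : Wt t x ^+ 2 + W t x ^+ 2 <= energy t x.
  by rewrite /energy lerD2r lerDl; apply: sumr_ge0 => i _; exact: sqr_ge0.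
have h1 := mulr_le0_ge0 decay S0.
have h2 := mulr_ge0 w0 (sqr_ge0 (Wt t x - W t x)).
have h3 := ler_wpM2l w0 E0.
have h4 := mulr_ge0 w0 S0.
have h5 := mulr_ge0 w0 (mulr_ge0 m0 (sqr_ge0 (Wt t x))).
move: (energy t x) (mu / (1 + t)) (Wt t x) (W t x) (bracket x) `|W2| h1 h2 h3 h4 h5 le1.
move=> E m a b Q z h1 h2 h3 h4 h5 le1.
nra.
Qed.

Lemma weighted_energy_nincr N T : 0 <= N -> 0 <= T ->
  integralRn (fun x => w N T x * energy T x) <=
  integralRn (fun x => w N 0 x * energy 0 x).
Proof.
move=> N0 T0.
have sw t f := supported_cone_weight (n := n) k f N0 (shrink_itv t).
have swu t f := supported_cone_weight_u (n := n) k f N0 (shrink_itv t).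
have swq t f := supported_cone_weight_q (n := n) k f N0 (shrink_itv t).
pose g t x := w N t x * energy t x.
pose g' t x := wu N t x * energy t x + w N t x * energy_t t x.
have cg : jcontinuous g.
  rewrite /jcontinuous /g; repeat cont_step; [exact: jcontinuous_cone_weight|].
  exact: jcontinuous_energy.
have cg' : jcontinuous g'.
  rewrite /jcontinuous /g'; repeat cont_step.
  - exact: jcontinuous_cone_weight_u.
  - exact: jcontinuous_energy.
  - exact: jcontinuous_cone_weight.
  - exact: jcontinuous_energy_t.
have sg' t : supported N (g' t) by exact: supportedD (swu t _) (sw t _).
have cfl i : jcontinuous (flux N i).
  have cx : continuous (fun p : R * 'rV[R]_n => p.2 ord0 i).
    exact: jcontinuous_cstt (@continuous_coord R n i).
  rewrite /jcontinuous /flux; repeat cont_step.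
  - exact: cx.
  - exact: jcontinuous_cone_weight_q.
  - exact: cWt.
  - exact: cWx.
  - exact: jcontinuous_cone_weight.
  - exact: cWtx.
  - exact: cWx.
  - exact: cWt.
  - exact: cWxx.
have sfl i t : supported N (flux N i t).
  apply: supportedD; last exact: sw.
  move=> x nB; have := swq t (fun=> 1) x nB; rewrite mulr1 => ->.
  by rewrite mulr0 mul0r.
have Ifl i t : integrableRn (flux N i t).
  exact: integrableRn_supported (jcontinuous_x (t := t) (cfl i)) (sfl i t).
apply: (derive_le0_nincr (fun t => integralRn (g t)) (fun t => integralRn (g' t))) => //.
  apply: continuous_subspaceT; apply: integralRn_continuous cg _ => t; exact: sw.
move=> t /andP[t0 tT]; split.
  apply: (integralRn_derive (g := g) (g' := g') (B := N) (u := 0) (v := T)) => //.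
  - by rewrite t0.
  - by move=> s; exact: sw.
  move=> s x /andP[s0 _].
  have := has_derive_mul _ _ _ _ _ _
    (has_derive_cone_weight_t k N x (has_derive_shrink s0)) (has_derive_energy x s0).
  by move=> /has_derive_eq; apply; rewrite /g' addrC mulrC [X in X + _]mulrC [X in _ + X]mulrC.
apply: (@le_trans _ _ (integralRn (fun x => \sum_i 2 * flux N i t x))).
  apply: le_integralRn => [||x].
  - exact: integrableRn_supported (jcontinuous_x (t := t) cg') (sg' t).
  - by apply: integrableRn_sum => i; exact: integrableRnZ.
  - exact: energy_flux_le.
rewrite integralRn_sum; last by move=> i; exact: integrableRnZ.
rewrite big1// => i _; rewrite integralRnZ//.
rewrite (@integralRn_partial0 _ _ i (fun x => w N t x * (Wt t x * Wx i t x)) _ N) ?mulr0//.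
- exact: jcontinuous_x (cfl i).
- move=> x; apply: has_derive_eq.
    apply: has_derive_mul; first exact: has_derive_cone_weight_x.
    apply: has_derive_mul; [exact: wave_dxt HW _ _ _|exact: wave_dxx HW _ _ _].
  by rewrite /flux; ring.
Qed.

End Energy.

(** * Decay of the solution and the equation of its Fourier coefficients *)

Section Decay.
Set Implicit Arguments.
Unset Strict Implicit.
Context {R : realType}.

Lemma integrableRn_monotone n (f : nat -> 'rV[R]_n -> R) g K :
  (forall N, continuous (f N)) -> continuous g ->
  (forall N x, 0 <= f N x) -> (forall x, nondecreasing_seq (f ^~ x)) ->
  (forall x, f N x @[N --> \oo] --> g x) ->
  (forall N, integrableRn (f N)) -> (forall N, integralRn (f N) <= K) ->
  integrableRn g /\ integralRn g <= K.
Proof.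
move=> cf cg f0 fnd fg If fK.
have mE (h : 'rV[R]_n -> R) : continuous h -> measurable_fun setT (fun p => (h (@rowt R n p))%:E).
  by move=> ch; apply/measurable_EFinP; exact: continuous_measurable_rowt.
have g0 x : 0 <= g x.
  have := cvgP _ (fg x) => cv; rewrite -(cvg_lim _ (fg x))//.
  by apply: limr_ge => //; near=> N; exact: f0.
have IK N : (\int[lebesgue_tuple n]_p (f N (rowt p))%:E <= K%:E)%E.
  have := fK N; rewrite -lee_fin /integralRn /Rintegral fineK//.
  by have := If N; exact: integrable_fin_num.
have := @cvg_monotone_convergence _ _ R (lebesgue_tuple n) setT measurableT
  (fun N p => (f N (rowt p))%:E).
move=> /(_ (fun N => mE _ (cf N))) H.
have {}H : (\int[lebesgue_tuple n]_p (f N (rowt p))%:E)%E @[N --> \oo] -->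
    (\int[lebesgue_tuple n]_p (g (rowt p))%:E)%E.
  rewrite (_ : (\int[lebesgue_tuple n]_p (g (rowt p))%:E)%E =
    (\int[lebesgue_tuple n]_(p in setT)
      limn (fun N => (f N (rowt p))%:E))%E); last first.
    apply: eq_integral => p _; rewrite EFin_lim; last exact: cvgP (fg _).
    by congr (_%:E); apply/esym/cvg_lim.
  apply: H => [N p _|p _ N M NM]; first by rewrite lee_fin.
  by rewrite lee_fin; exact: fnd.
have gK : (\int[lebesgue_tuple n]_p (g (rowt p))%:E <= K%:E)%E.
  by apply: cvge_le H; near=> N; exact: IK.
have Ig : integrableRn g.
  apply/integrableP; split; first exact: mE.
  under eq_integral do rewrite /= ger0_norm//.
  by rewrite (le_lt_trans gK)// ltry.
split => //; rewrite -lee_fin /integralRn /Rintegral fineK//.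
exact: integrable_fin_num Ig.
Unshelve. all: by end_near. Qed.

Definition cutoff n (N : R) (x : 'rV[R]_n) : R := pos (1 - bracket x / N) ^+ 2.

Definition cutoff_x n (N : R) (i : 'I_n) (x : 'rV[R]_n) : R :=
  2 * pos (1 - bracket x / N) * (- (2 * x ord0 i / N)).

Lemma has_derive_cutoff n N i (x : 'rV[R]_n) :
  has_derive x (delta_mx ord0 i) (cutoff N) (cutoff_x N i x).
Proof.
apply: (has_derive_comp (fun y => pos y ^+ 2) (fun x => 1 - bracket x / N)).
  exact: has_derive_pos_sqr.
apply: has_derive_eq; first by repeat first [exact: has_derive_bracket|derive_step].
by rewrite /=; ring.
Qed.

Lemma cvg_harmonic_dist (u : nat -> R) (l c : R) :
  (forall N, `|u N - l| <= c * harmonic N) -> u N @[N --> \oo] --> l.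
Proof.
move=> ul; have c0 : c * harmonic N @[N --> \oo] --> (0 : R).
  by rewrite -[X in _ --> X](mulr0 c); apply: cvgMl_tmp; exact: cvg_harmonic.
apply: (@squeeze_cvgr _ _ _ _ (fun N => l - c * harmonic N) (fun N => l + c * harmonic N)).
- by near=> N; have := ul N; rewrite ler_distl.
- by rewrite -[X in _ --> X]subr0; apply: cvgB c0; exact: cvg_cst.
- by rewrite -[X in _ --> X]addr0; apply: cvgD c0; exact: cvg_cst.
Unshelve. all: by end_near. Qed.

Section CutoffBounds.
Variables (n : nat) (N : R).
Hypothesis N0 : 0 < N.
Implicit Type x : 'rV[R]_n.

Let c0 x : 0 <= bracket x / N.
Proof. by rewrite divr_ge0 ?ltW// bracket_gt0. Qed.

Lemma cutoff_itv x : 0 <= cutoff N x <= 1.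
Proof.
rewrite sqr_ge0 /cutoff /pos; have := c0 x; move: (_ / _) => y y0.
by case: (leP 0 (1 - y)) => ? /=; nra.
Qed.

Lemma cutoff_ge x : 1 - 2 * bracket x / N <= cutoff N x.
Proof.
rewrite /cutoff /pos -mulrA; have := c0 x; move: (_ / _) => y y0.
by case: (leP 0 (1 - y)) => ?; nra.
Qed.

(** The gradient is of size |x_i| / N, and |x_i| <= Q: integrability of Q times the solution is what
    makes the cutoff error O(1/N). *)
Lemma normr_cutoff_x i x : `|cutoff_x N i x| <= 4 / N * bracket x.
Proof.
have p0 := pos_ge0 (1 - bracket x / N).
have p1 : pos (1 - bracket x / N) <= 1.
  by rewrite /pos; have := c0 x; move: (_ / _) => y y0; case: (leP 0 (1 - y)) => ?; lra.
rewrite (_ : 4 / N * bracket x = 2 * 1 * (2 * bracket x / N)); last by ring.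
rewrite normrM normrN (ger0_norm (mulr_ge0 _ p0))//.
apply: ler_pM => //; first by rewrite mulr_ge0.
  by rewrite ler_wpM2l.
rewrite normrM (@ger0_norm _ N^-1) ?invr_ge0 ?(ltW N0)// ler_wpM2r ?invr_ge0 ?(ltW N0)//.
rewrite normrM ger0_norm// ler_wpM2l//.
apply: le_trans (coord_sqr_le_bracket x i).
by rewrite ler_norml; apply/andP; split; nra.
Qed.

Let nbox0 x : ~ box N x -> pos (1 - bracket x / N) = 0.
Proof.
move=> nB; apply/max_idPl; rewrite subr_le0 ler_pdivlMr// mul1r leNgt.
by apply/negP => /ltW /box_bracket.
Qed.

Lemma supported_cutoff (f : 'rV[R]_n -> R) : supported N (fun x => cutoff N x * f x).
Proof. by move=> x nB; rewrite /cutoff nbox0// expr0n mul0r. Qed.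

Lemma supported_cutoff_x i (f : 'rV[R]_n -> R) :
  supported N (fun x => cutoff_x N i x * f x).
Proof. by move=> x nB; rewrite /cutoff_x nbox0// mulr0 !mul0r. Qed.

Let cp : continuous (fun x => pos (1 - bracket x / N)).
Proof.
apply: (contComp (h := pos)); first exact: continuous_pos.
by repeat cont_step; exact: continuous_bracket.
Qed.

Lemma continuous_cutoff : continuous (cutoff N : 'rV[R]_n -> R).
Proof. exact: contX cp. Qed.

Lemma continuous_cutoff_x i : continuous (cutoff_x N i : 'rV[R]_n -> R).
Proof.
by rewrite /cutoff_x; repeat cont_step; [exact: cp|exact: continuous_coord].
Qed.

End CutoffBounds.

Variables (n : nat) (mu : R) (W Wt Wtt : R -> 'rV[R]_n -> R).
Variables (Wx Wtx Wxx : 'I_n -> R -> 'rV[R]_n -> R).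
Hypothesis mu0 : 0 < mu.
Hypothesis HW : wave_solution mu W Wt Wtt Wx Wtx Wxx.
Local Notation S := (energy W Wt Wx).
Variable C : R.
Hypothesis decay0 : forall x, bracket x ^+ n.+2 * S 0 x <= C * wprod x.

(** The cone weight with k = n + 1, divided by u^(n+3) N^2, is Q^(n+2) pos(u - Q/N)^2, which
    increases with N to u^2 Q^(n+2). Monotone convergence applies because at time 0 the undivided
    weight is at most N^2 Q^(n+2). The two powers of u give the exponent n + 5. *)
Lemma weighted_energy_le T : 0 <= T ->
  integrableRn (fun x => bracket x ^+ n.+2 * S T x) /\
  integralRn (fun x => bracket x ^+ n.+2 * S T x) <=
    C * integralRn (@wprod R n) / shrink T ^+ n.+3.+2.
Proof.
move=> T0; set u := shrink T.
have u0 : 0 < u by exact: expR_gt0.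
have cS t : continuous (S t) := jcontinuous_x (t := t) (jcontinuous_energy HW).
have cb := @continuous_bracket R n.
pose f N (x : 'rV[R]_n) :=
  bracket x ^+ n.+2 * pos (u - bracket x / N.+1%:R) ^+ 2 * S T x.
pose g (x : 'rV[R]_n) := bracket x ^+ n.+2 * u ^+ 2 * S T x.
have fE N x : f N x = (u ^+ n.+3 * N.+1%:R ^+ 2)^-1 *
    (cone_weight n.+1 N.+1%:R u x * S T x).
  have N0 : 0 < N.+1%:R :> R by rewrite ltr0n.
  rewrite /f /cone_weight.
  have -> : pos (u * N.+1%:R - bracket x) = N.+1%:R * pos (u - bracket x / N.+1%:R).
    rewrite /pos maxr_pMr ?ltW// mulr0; congr (Num.max _ _).
    by field; rewrite gt_eqF//; lra.
  have U0 : u ^+ n.+3 != 0 by rewrite expf_neq0// gt_eqF.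
  move: (u ^+ n.+3) (N.+1%:R : R) N0 U0 (pos _) => U M /lt0r_neq0 M0 U0 p.
  by rewrite exprMn; field; rewrite M0.
have Iw N t : integrableRn (fun x => cone_weight n.+1 N.+1%:R (shrink t) x * S t x).
  apply: integrableRn_supported (supported_cone_weight _ _ _ (shrink_itv t)) => //.
  apply: contM (cS t); rewrite /cone_weight; repeat cont_step; first exact: cb.
  by apply: (contComp (h := pos)); [exact: continuous_pos|repeat cont_step].
have cf N : continuous (f N).
  rewrite /f; repeat cont_step; [exact: cb| |exact: cS].
  by apply: (contComp (h := pos)); [exact: continuous_pos|repeat cont_step].
have cg : continuous g by rewrite /g; repeat cont_step; [exact: cb|exact: cS].
have f0 N x : 0 <= f N x.
  apply: mulr_ge0 (energy_ge0 _ _ _ _ _); apply: mulr_ge0 (sqr_ge0 _).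
  by rewrite exprn_ge0// ltW// bracket_gt0.
have If N : integrableRn (f N).
  by rewrite (funext (fE N)); apply: integrableRnZ; exact: Iw.
have Iwp : integrableRn (@wprod R n) by exact: integrable_wprod.
have [] := @integrableRn_monotone n f g
  (C * integralRn (@wprod R n) / u ^+ n.+3) cf cg f0 _ _ If _.
- move=> x N M NM; rewrite /f ler_wpM2r ?energy_ge0// ler_wpM2l//.
    by rewrite exprn_ge0// ltW// bracket_gt0.
  rewrite ler_sqr ?nnegrE ?pos_ge0// /pos.
  have : bracket x / M.+1%:R <= bracket x / N.+1%:R.
    by rewrite ler_wpM2l ?(ltW (bracket_gt0 _))// lef_pV2 ?posrE ?ltr0n// ler_nat.
  move: (_ / _) (_ / _) => p q; rewrite ge_max !le_max lexx/= => pq.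
  by apply/orP; right; lra.
- move=> x; rewrite /f /g; apply: cvgMr_tmp; apply: cvgMl_tmp.
  have -> : u ^+ 2 = pos (u - bracket x * 0) ^+ 2.
    by rewrite mulr0 subr0; congr (_ ^+ 2); apply/esym/max_idPr/ltW.
  have cp2 : continuous (fun y : R => pos y ^+ 2) by exact: contX continuous_pos.
  have cN : u - bracket x * harmonic N @[N --> \oo] --> u - bracket x * 0.
    by apply: cvgB; [exact: cvg_cst|apply: cvgMl_tmp; exact: cvg_harmonic].
  exact: (cvg_comp _ _ cN (cp2 _)).
- move=> N; rewrite (funext (fE N)) integralRnZ; last exact: Iw.
  have N0 : 0 < N.+1%:R :> R by rewrite ltr0n.
  have le1 := weighted_energy_nincr mu0 HW n.+1 (ltW N0) T0.
  have le2 : integralRn (fun x => cone_weight n.+1 N.+1%:R (shrink 0) x * S 0 x) <=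
      integralRn (fun x : 'rV[R]_n => N.+1%:R ^+ 2 * C * wprod x).
    apply: le_integralRn; [exact: Iw|exact: integrableRnZ|].
    move=> x; rewrite -mulrA; apply: le_trans (ler_wpM2l (sqr_ge0 _) (decay0 x)).
    have c1 : shrink 0 = 1 :> R by rewrite /shrink /pos maxxx mulr0 expR0.
    rewrite /cone_weight c1 expr1n !mul1r [_ * pos _ ^+ 2]mulrC -mulrA.
    have Q0 := bracket_gt0 x.
    apply: ler_wpM2r; first by rewrite mulr_ge0 ?energy_ge0// exprn_ge0// ltW.
    by rewrite ler_sqr ?nnegrE ?pos_ge0 ?(ltW N0)// /pos ge_max (ltW N0) gerBl ltW.
  rewrite integralRnZ// in le2; have un0 : 0 < u ^+ n.+3 by exact: exprn_gt0.
  rewrite ler_pdivrMl; last by rewrite mulr_gt0// exprn_gt0.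
  apply: le_trans (le_trans le1 le2) _.
  rewrite le_eqVlt; apply/orP; left; apply/eqP.
  by move: (u ^+ n.+3) un0 => U /lt0r_neq0 U0; field.
move=> Ig gK; have gE x : bracket x ^+ n.+2 * S T x = u ^- 2 * g x.
  by rewrite /g; field; rewrite gt_eqF.
rewrite (funext gE); split; first exact: integrableRnZ.
have -> : u ^+ n.+3.+2 = u ^+ 2 * u ^+ n.+3 by rewrite -exprD.
have u2 : 0 <= u ^- 2 by rewrite invr_ge0 sqr_ge0.
rewrite integralRnZ//; apply: le_trans (ler_wpM2l u2 gK) _.
by rewrite mulrCA -invfM.
Qed.

Lemma shrink_antitone s t : s <= t -> shrink t <= shrink s :> R.
Proof.
move=> st; rewrite ler_expR ler_nM2l; last lra.
by rewrite /pos ge_max !le_max lexx st orbT.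
Qed.

(* [2 Q |f| <= Q^(n+2) f^2 + Q^(-n)], and [Q^(-n)] is integrable. *)
Lemma wave_decay T : 0 <= T -> exists2 K, 0 <= K &
  forall t (f : 'rV[R]_n -> R), 0 <= t <= T -> continuous f -> (forall x, f x ^+ 2 <= S t x) ->
    integrableRn (fun x => bracket x * `|f x|) /\
    integralRn (fun x => bracket x * `|f x|) <= K.
Proof.
move=> T0; set I := integralRn (@wprod R n).
have Iwp : integrableRn (@wprod R n) by exact: integrable_wprod.
have I0 : 0 <= I.
  rewrite -[leLHS](mul0r I) -integralRnZ//; apply: le_integralRn => //.
    exact: integrableRnZ.
  by move=> x; rewrite mul0r ltW// wprod_gt0.
(* Since [shrink] is nonincreasing, its value at T serves all t <= T; the maximum with 0 keeps the
   bound monotone when C is negative. *)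
exists (2^-1 * (Num.max 0 C * I / shrink T ^+ n.+3.+2 + I)).
  rewrite mulr_ge0// addr_ge0// divr_ge0 ?exprn_ge0 ?expR_ge0// mulr_ge0//.
  by rewrite le_max lexx.
move=> t f /andP[t0 tT] cf fS; have [IS SK] := weighted_energy_le t0.
have I2 : integrableRn (fun x => 2^-1 * (bracket x ^+ n.+2 * S t x + wprod x)).
  by apply: integrableRnZ; exact: integrableRnD.
have cbf : continuous (fun x => bracket x * `|f x|).
  apply: contM; first exact: continuous_bracket.
  by apply: contComp cf; exact: norm_continuous.
have fle x : bracket x * `|f x| <= 2^-1 * (bracket x ^+ n.+2 * S t x + wprod x).
  have Q0 := bracket_gt0 x; rewrite ler_pdivlMl//.
  apply: le_trans (lerD (ler_wpM2l (exprn_ge0 _ (ltW Q0)) (fS x)) (bracket_expn_wprod x)).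
  have Qn0 : 0 < bracket x ^+ n by exact: exprn_gt0.
  rewrite -(ler_pM2l Qn0) mulrDr divff ?gt_eqF//.
  have := sqr_ge0 (bracket x ^+ n * bracket x * `|f x| - 1).
  have -> : bracket x ^+ n.+2 = bracket x ^+ n * bracket x ^+ 2 by rewrite -exprD addn2.
  rewrite sqrrB1 !exprMn real_normK ?num_real//.
  move: (bracket x ^+ n) (bracket x) (f x) `|f x| => q b y z; lra.
have Ibf : integrableRn (fun x => bracket x * `|f x|).
  apply: (integrable_cont_le cbf _ I2) => p; rewrite ger0_norm//.
  by rewrite mulr_ge0// ltW// bracket_gt0.
split => //; apply: le_trans (le_integralRn Ibf I2 fle) _.
rewrite integralRnZ; last exact: integrableRnD.
rewrite integralRnD// ler_wpM2l// lerD2r; apply: le_trans SK _.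
have sT0 : 0 < shrink T by exact: expR_gt0.
apply: (@le_trans _ _ (Num.max 0 C * I / shrink t ^+ n.+3.+2)).
  rewrite ler_wpM2r ?invr_ge0 ?exprn_ge0 ?expR_ge0// ler_wpM2r//.
  by rewrite le_max lexx orbT.
rewrite ler_wpM2l//; first by rewrite mulr_ge0// le_max lexx.
rewrite lef_pV2 ?posrE ?exprn_gt0 ?expR_gt0//.
by rewrite lerXn2r ?nnegrE ?expR_ge0// shrink_antitone.
Qed.

Lemma weighted_bound (c f : 'rV[R]_n -> R) a K : continuous c -> continuous f ->
  0 <= a -> (forall x, `|c x| <= a * bracket x) ->
  integrableRn (fun x => bracket x * `|f x|) /\
    integralRn (fun x => bracket x * `|f x|) <= K ->
  integrableRn (fun x => c x * f x) /\ `|integralRn (fun x => c x * f x)| <= a * K.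
Proof.
move=> cc cf a0 ca [If fK].
have le1 x : `|c x * f x| <= a * (bracket x * `|f x|).
  by rewrite normrM mulrA ler_wpM2r.
have I1 : integrableRn (fun x => c x * f x).
  exact: (integrable_cont_le (contM cc cf) (fun p => le1 _) (integrableRnZ a If)).
split => //; apply: le_trans (normr_integralRn I1 (integrableRnZ a If) le1) _.
by rewrite integralRnZ// ler_wpM2l.
Qed.

Lemma wave_integrable (c : 'rV[R]_n -> R) t : 0 <= t -> continuous c ->
  (forall x, `|c x| <= 1) ->
  integrableRn (fun x => c x * W t x) /\ integrableRn (fun x => c x * Wt t x).
Proof.
move=> t0 cc c1; have [K _ HK] := wave_decay t0.
have tt : 0 <= t <= t by rewrite t0 lexx.
have cQ x : `|c x| <= 1 * bracket x by rewrite mul1r (le_trans (c1 x))// bracket_ge1.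
have S0 x : 0 <= \sum_i Wx i t x ^+ 2 by apply: sumr_ge0 => i _; exact: sqr_ge0.
have cW := jcontinuous_x (t := t) (wave_cont HW).
have cWt := jcontinuous_x (t := t) (wave_cont_t HW).
split.
  have KW x : W t x ^+ 2 <= S t x by rewrite lerDr addr_ge0 ?sqr_ge0.
  by have [] := weighted_bound cc cW ler01 cQ (HK t _ tt cW KW).
have KWt x : Wt t x ^+ 2 <= S t x by rewrite /energy -addrA lerDl addr_ge0 ?sqr_ge0.
by have [] := weighted_bound cc cWt ler01 cQ (HK t _ tt cWt KWt).
Qed.

(** The pair stands for cos(x.xi) and -sin(x.xi), or for sin(x.xi) and cos(x.xi). *)
Variables (e e' : 'rV[R]_n -> R) (xi : 'rV[R]_n).
Hypotheses (ce : continuous e) (ce' : continuous e').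
Hypotheses (e1 : forall x, `|e x| <= 1) (e'1 : forall x, `|e' x| <= 1).
Hypothesis de : forall i (x : 'rV[R]_n), has_derive x (delta_mx ord0 i) e (xi ord0 i * e' x).
Hypothesis de' : forall i (x : 'rV[R]_n),
  has_derive x (delta_mx ord0 i) e' (- (xi ord0 i * e x)).

Let wcoef N t := integralRn (fun x => cutoff N x * (e x * W t x)).
Let wcoef_t N t := integralRn (fun x => cutoff N x * (e x * Wt t x)).
(** The terms of the integration by parts in which the derivative falls on the cutoff. *)
Let remainder N t :=
  \sum_i integralRn (fun x => cutoff_x N i x * (xi ord0 i * e' x * W t x - e x * Wx i t x)).

Let jc (f : 'rV[R]_n -> R) := @jcontinuous_cstt R n f.

Let jcutoff N (f : R -> 'rV[R]_n -> R) : jcontinuous f ->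
  jcontinuous (fun t x => cutoff N x * (e x * f t x)).
Proof.
move=> cf; rewrite /jcontinuous; repeat cont_step; last exact: cf.
- by apply: jc; exact: continuous_cutoff.
- exact: jc ce.
Qed.

Lemma wcoef_ode N : 0 < N -> continuous (wcoef N) /\ continuous (wcoef_t N) /\
  forall t : R, 0 < t -> has_derive t 1 (wcoef N) (wcoef_t N t) /\
    has_derive t 1 (wcoef_t N) (- (mu / (1 + t)) * wcoef_t N t -
      (\sum_i xi ord0 i ^+ 2) * wcoef N t + remainder N t).
Proof.
move=> N0.
have cW := wave_cont HW; have cWt := wave_cont_t HW; have cWtt := wave_cont_tt HW.
have cWx := wave_cont_x HW; have cWxx := wave_cont_xx HW.
have sc f := supported_cutoff (n := n) N0 f.
split; first by apply: (integralRn_continuous (B := N)) => [|t]; [exact: jcutoff|exact: sc].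
split; first by apply: (integralRn_continuous (B := N)) => [|t]; [exact: jcutoff|exact: sc].
move=> t t0; split.
  apply: (integralRn_derive (B := N) (u := 0) (v := t + 1)
    (g := fun t x => cutoff N x * (e x * W t x))
    (g' := fun t x => cutoff N x * (e x * Wt t x))) => //.
  - by rewrite t0 ltrDl ltr01.
  - exact: jcutoff.
  - exact: jcutoff.
  move=> s x /andP[s0 _]; apply: has_derive_eq.
    by repeat first [exact: (wave_dt HW _ s0)|derive_step].
  by rewrite /=; ring.
have -> : - (mu / (1 + t)) * wcoef_t N t -
    (\sum_i xi ord0 i ^+ 2) * wcoef N t + remainder N t =
    integralRn (fun x => cutoff N x * (e x * Wtt t x)).
  have Ic (f : 'rV[R]_n -> R) : continuous f -> integrableRn (fun x => cutoff N x * (e x * f x)).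
    move=> cf; apply: integrableRn_supported (sc _).
    by apply: contM; [exact: continuous_cutoff|exact: contM].
  have Ix i (f : 'rV[R]_n -> R) : continuous f -> integrableRn (fun x => cutoff_x N i x * f x).
    move=> cf; apply: integrableRn_supported (supported_cutoff_x N0 i _).
    by apply: contM => //; exact: continuous_cutoff_x.
  have cWt' := jcontinuous_x (t := t) cWt.
  have cW' := jcontinuous_x (t := t) cW.
  have cWx' i := jcontinuous_x (t := t) (cWx i).
  have cWxx' i := jcontinuous_x (t := t) (cWxx i).
  have parts i : integralRn (fun x => cutoff N x * (e x * Wxx i t x)) =
      integralRn (fun x => cutoff_x N i x * (xi ord0 i * e' x * W t x - e x * Wx i t x)) -
      xi ord0 i ^+ 2 * wcoef N t.
    (* Green's identity: the field e dW - W de, cut off, performs both integrations by parts at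
       once. Its cross terms cancel, and the second derivative of e is -xi_i^2 e. *)
    pose F x := cutoff N x * (e x * Wx i t x - xi ord0 i * (e' x * W t x)).
    pose A x := cutoff N x * (e x * Wxx i t x).
    pose B x := cutoff_x N i x * (xi ord0 i * e' x * W t x - e x * Wx i t x).
    pose D x := xi ord0 i ^+ 2 * (cutoff N x * (e x * W t x)).
    have cB : continuous (fun x => xi ord0 i * e' x * W t x - e x * Wx i t x).
      by repeat cont_step.
    have IA : integrableRn A by exact: Ic.
    have IB : integrableRn B by exact: Ix.
    have ID : integrableRn D by apply: integrableRnZ; exact: Ic.
    have sB : supported N B by exact: supported_cutoff_x.
    have c0 (x : 'rV[R]_n) : ~ box N x -> cutoff N x = 0.
      by move=> nB; have := sc (fun=> 1) x nB; rewrite mulr1.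
    have sD : supported N D by move=> x nB; rewrite /D c0// mul0r mulr0.
    have : integralRn (fun x => A x - (B x - D x)) = 0.
      apply: (@integralRn_partial0 _ _ i F _ N).
      - rewrite /A /B /D; repeat cont_step => //; try exact: continuous_cutoff.
        exact: continuous_cutoff_x.
      - move=> x; apply: has_derive_eq.
          repeat first [exact: has_derive_cutoff|exact: de|exact: de'|
            exact: (wave_dx HW)|exact: (wave_dxx HW)|derive_step].
        by rewrite /= /A /B /D; ring.
      - exact: sc.
      - by move=> x nB; rewrite /A c0// mul0r sB// sD// !subr0.
    rewrite integralRnB//; last exact: integrableRnB.
    rewrite integralRnB// integralRnZ; last exact: Ic.
    by move/eqP; rewrite subr_eq0 => /eqP.
  have -> : integralRn (fun x => cutoff N x * (e x * Wtt t x)) =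
     integralRn (fun x => \sum_i cutoff N x * (e x * Wxx i t x) -
       mu / (1 + t) * (cutoff N x * (e x * Wt t x))).
    apply: eq_integralRn => x; rewrite (wave_eq HW _ t0) -mulr_sumr -mulr_sumr; ring.
  rewrite integralRnB; last 2 first.
  - by apply: integrableRn_sum => i; exact: Ic.
  - by apply: integrableRnZ; exact: Ic.
  rewrite integralRn_sum; last by move=> i; exact: Ic.
  rewrite integralRnZ; last exact: Ic.
  rewrite (eq_bigr _ (fun i _ => parts i)) sumrB -mulr_suml /remainder /wcoef_t /wcoef; ring.
apply: (integralRn_derive (B := N) (u := 0) (v := t + 1)
  (g := fun t x => cutoff N x * (e x * Wt t x))
  (g' := fun t x => cutoff N x * (e x * Wtt t x))) => //.
- by rewrite t0 ltrDl ltr01.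
- exact: jcutoff.
- exact: jcutoff.
move=> s x /andP[s0 _]; apply: has_derive_eq.
  by repeat first [exact: (wave_dtt HW _ s0)|derive_step].
by rewrite /=; ring.
Qed.

Theorem wave_fourier s rho T : 0 < s -> s ^+ 2 = \sum_i xi ord0 i ^+ 2 ->
  mu = 1 - 2 * rho -> 0 <= T ->
  integralRn (fun x => e x * W T x) =
    phi1 rho s T * integralRn (fun x => e x * W 0 x) +
    phi2 rho s T * integralRn (fun x => e x * Wt 0 x).
Proof.
move=> s0 sE muE T0; have [K K0 HK] := wave_decay T0.
have cW := wave_cont HW; have cWt := wave_cont_t HW; have cWx := wave_cont_x HW.
have cW' t := jcontinuous_x (t := t) cW.
have cWt' t := jcontinuous_x (t := t) cWt.
have cWx' i t := jcontinuous_x (t := t) (cWx i).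
have KW t : 0 <= t <= T -> integrableRn (fun x => bracket x * `|W t x|) /\
    integralRn (fun x => bracket x * `|W t x|) <= K.
  move=> tT; apply: (HK t _ tT (cW' t)) => x; rewrite lerDr addr_ge0 ?sqr_ge0//.
  by apply: sumr_ge0 => i _; exact: sqr_ge0.
have KWt t : 0 <= t <= T -> integrableRn (fun x => bracket x * `|Wt t x|) /\
    integralRn (fun x => bracket x * `|Wt t x|) <= K.
  move=> tT; apply: (HK t _ tT (cWt' t)) => x; rewrite /energy -addrA lerDl addr_ge0 ?sqr_ge0//.
  by apply: sumr_ge0 => i _; exact: sqr_ge0.
have KWx i t : 0 <= t <= T -> integrableRn (fun x => bracket x * `|Wx i t x|) /\
    integralRn (fun x => bracket x * `|Wx i t x|) <= K.
  move=> tT; apply: (HK t _ tT (cWx' i t)) => x; rewrite /energy (bigD1 i)//= addrCA -addrA lerDl.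
  rewrite !addr_ge0 ?sqr_ge0//.
  by apply: sumr_ge0 => j _; exact: sqr_ge0.
have eQ x : `|e x| <= 1 * bracket x by rewrite mul1r (le_trans (e1 x))// bracket_ge1.
(* Removing the cutoff costs at most 2K/N, because 1 - [cutoff] <= 2Q/N. *)
have lim (f : 'rV[R]_n -> R) : continuous f ->
    integrableRn (fun x => bracket x * `|f x|) /\
      integralRn (fun x => bracket x * `|f x|) <= K ->
    integralRn (fun x => cutoff N.+1%:R x * (e x * f x)) @[N --> \oo] -->
      integralRn (fun x => e x * f x).
  move=> cf Kf; apply: (@cvg_harmonic_dist _ _ (2 * K)) => N.
  have N0 : 0 < N.+1%:R :> R by rewrite ltr0n.
  have cc := @continuous_cutoff n N.+1%:R.
  have [Ief _] := weighted_bound ce cf ler01 eQ Kf.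
  have Icf : integrableRn (fun x => cutoff N.+1%:R x * (e x * f x)).
    apply: integrableRn_supported (supported_cutoff N0 _).
    by apply: contM => //; exact: contM.
  rewrite -integralRnB//.
  rewrite (_ : (fun x => _) = (fun x => (cutoff N.+1%:R x - 1) * e x * f x)); last first.
    by apply/funext => x; ring.
  rewrite [leRHS](_ : _ = 2 / N.+1%:R * K); last by rewrite /harmonic /=; ring.
  have [|||_ //] := @weighted_bound (fun x => (cutoff N.+1%:R x - 1) * e x) f
    (2 / N.+1%:R) K _ cf _ _ Kf.
  - by repeat cont_step.
  - by rewrite divr_ge0.
  - move=> x; rewrite normrM; apply: le_trans (ler_piMr _ (e1 x)) _ => //.
    have /andP[c0 c1] := cutoff_itv N0 x; have := cutoff_ge N0 x.
    by move=> h; rewrite ler0_norm ?subr_le0// opprB [leRHS]mulrAC lerBlDr -lerBlDl.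
have remB N t : 0 < N -> 0 <= t <= T ->
    `|remainder N t| <= 4 * K * (\sum_i (`|xi ord0 i| + 1)) / N.
  move=> N0 tT; apply: le_trans (ler_norm_sum _ _ _) _.
  rewrite [_ * K * _]mulrC -mulrA mulr_suml; apply: ler_sum => i _.
  have cc := @continuous_cutoff_x n N i.
  have [|||I1 B1] := @weighted_bound (fun x => cutoff_x N i x * (xi ord0 i * e' x)) (W t)
    (`|xi ord0 i| * (4 / N)) K _ (cW' t) _ _ (KW t tT).
  - by repeat cont_step.
  - by rewrite mulr_ge0// divr_ge0// ltW.
  - move=> x; rewrite mulrCA normrM -[leRHS]mulrA ler_wpM2l// normrM.
    apply: le_trans (normr_cutoff_x N0 i x); exact: ler_piMr.
  have [|||I2 B2] := @weighted_bound (fun x => cutoff_x N i x * e x) (Wx i t)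
    (4 / N) K _ (cWx' i t) _ _ (KWx i t tT).
  - by repeat cont_step.
  - by rewrite divr_ge0// ltW.
  - move=> x; rewrite normrM; apply: le_trans (normr_cutoff_x N0 i x); exact: ler_piMr.
  rewrite (_ : (fun x => _) = (fun x => cutoff_x N i x * (xi ord0 i * e' x) * W t x -
    cutoff_x N i x * e x * Wx i t x)); last by apply/funext => x; ring.
  rewrite integralRnB//; apply: le_trans (ler_normB _ _) _.
  by apply: le_trans (lerD B1 B2) _; lra.
have sq (Tt : Type) (F : set_system Tt) (FF : Filter F) (u : Tt -> R) (l : R) :
    u @ F --> l -> u N ^+ 2 @[N --> F] --> l ^+ 2.
  by move=> ul; rewrite expr2; under eq_fun do rewrite expr2; exact: cvgM.
(* The order is left free: a = rho settles a non-integer rho, and a -> rho an integer one. In both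
   cases the right-hand side becomes 0 because mu = 1 - 2 rho. *)
have P a : a \isn't a Num.int ->
    s ^+ 2 * (integralRn (fun x => e x * W T x) -
      (phi1 a s T * integralRn (fun x => e x * W 0 x) +
       phi2 a s T * integralRn (fun x => e x * Wt 0 x))) ^+ 2 <=
    expR ((2 * `|1 - 2 * a| + 1) * T) * ((`|1 - 2 * a - mu| * K) ^+ 2 * T).
  move=> aN; set b := 1 - 2 * a.
  pose c := 4 * K * (\sum_i (`|xi ord0 i| + 1)).
  pose y N t := phi1 a s t * wcoef N 0 + phi2 a s t * wcoef_t N 0.
  have PN N : s ^+ 2 * (wcoef N.+1%:R T - y N.+1%:R T) ^+ 2 <=
      expR ((2 * `|b| + 1) * T) * ((c * harmonic N + `|b - mu| * K) ^+ 2 * T).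
    have : 0 < N.+1%:R :> R by rewrite ltr0n.
    rewrite [harmonic N]/(N.+1%:R^-1); move: (N.+1%:R : R) => {}N N0.
    have [cH [cK HK']] := wcoef_ode N0.
    have [z [y0 z0 yz]] := multiplier_ode _ _ (wcoef N 0) (wcoef_t N 0) aN s0.
    (* The function [y N] has damping b / (1 + t) instead of mu / (1 + t), and the same data at t =
       0. The discrepancy enters as the forcing (b - mu) / (1 + t) [wcoef_t], bounded by |b - mu| K
       since the cutoff and e are at most 1 in absolute value. *)
    have := @oscillator_stability R T `|b| s (c / N + `|b - mu| * K)
      (fun t => wcoef N t - y N t) (fun t => wcoef_t N t - z t)
      (fun t => b / (1 + t)) (fun t => remainder N t + (b - mu) / (1 + t) * wcoef_t N t).
    rewrite z0 subrr expr0n /= [y N 0]y0 subrr expr0n mulr0 !add0r; apply=> //.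
    - apply: continuous_in_subspaceT => t; rewrite inE/= in_itv/= => /andP[t0 _].
      apply: cvgB; first exact: cH.
      have t1 : -1 < t by lra.
      exact: has_derive1_continuous (yz t t1).1.
    - apply: continuous_in_subspaceT => t; rewrite inE/= in_itv/= => /andP[t0 _].
      apply: cvgB; first exact: cK.
      have t1 : -1 < t by lra.
      exact: has_derive1_continuous (yz t t1).2.
    - move=> t /andP[t0 tT]; have t1 : -1 < t by lra.
      have [dH dK] := HK' t t0; have [dy dz] := yz t t1.
      split; first exact: has_derive_sub.
      apply: has_derive_eq (has_derive_sub _ _ _ _ _ _ dK dz) _.
      by rewrite /b sE -[phi1 _ _ _ * _ + _]/(y N t); field; lra.
    - move=> t /andP[t0 _]; rewrite normrM ler_piMr//.
      rewrite ger0_norm ?invr_ge0 ?invf_le1//; lra.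
    - move=> t /andP[t0 tT]; have tT' : 0 <= t <= T by rewrite !ltW.
      apply: le_trans (ler_normD _ _) _; apply: lerD; first exact: remB.
      rewrite !normrM -mulrA ler_wpM2l// -[leRHS]mul1r ler_pM//.
        rewrite ger0_norm ?invr_ge0 ?invf_le1//; lra.
      have [||_] := @weighted_bound (fun x => cutoff N x * e x) (Wt t) 1 K _
        (cWt' t) ler01 _ (KWt t tT').
      + by repeat cont_step; first exact: continuous_cutoff.
      + move=> x; apply: le_trans (eQ x); rewrite normrM ler_piMl//.
        by have /andP[c0 c1] := cutoff_itv N0 x; rewrite ger0_norm.
      rewrite mul1r /wcoef_t; apply: le_trans; rewrite le_eqVlt; apply/orP; left.
      by apply/eqP; congr (`|_|); apply: eq_integralRn => x; rewrite mulrA.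
  have T0T : 0 <= T <= T by rewrite T0 lexx.
  have OT : 0 <= (0 : R) <= T by apply/andP.
  have L0 := lim _ (cW' 0) (KW 0 OT).
  have L1 := lim _ (cWt' 0) (KWt 0 OT).
  have LT := lim _ (cW' T) (KW T T0T).
  apply: (ler_cvg_to
    (f := fun N => s ^+ 2 * (wcoef N.+1%:R T - y N.+1%:R T) ^+ 2)
    (g := fun N => expR ((2 * `|b| + 1) * T) * ((c * harmonic N + `|b - mu| * K) ^+ 2 * T))
    (a := \oo)); last by near=> N; exact: PN.
    apply: cvgMl_tmp; apply: sq; apply: cvgB; first exact: LT.
    by apply: cvgD; apply: cvgMl_tmp; [exact: L0|exact: L1].
  apply: cvgMl_tmp; apply: cvgMr_tmp; apply: sq.
  rewrite -[X in _ --> X]add0r; apply: cvgD; last exact: cvg_cst.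
  by rewrite -[X in _ --> X](mulr0 c); apply: cvgMl_tmp; exact: cvg_harmonic.
have : s ^+ 2 * (integralRn (fun x => e x * W T x) -
      (phi1 rho s T * integralRn (fun x => e x * W 0 x) +
       phi2 rho s T * integralRn (fun x => e x * Wt 0 x))) ^+ 2 <=
    expR ((2 * `|1 - 2 * rho| + 1) * T) * ((`|1 - 2 * rho - mu| * K) ^+ 2 * T).
  have [/intrP[m rhoE]|] := boolP (rho \is a Num.int); last exact: P.
  rewrite rhoE; have [c1 c2] := phi_cvg m _ _ s0 T0.
  have ca : a @[a --> (m%:~R : R)^'] --> (m%:~R : R) by apply: cvg_within_filter; exact: cvg_id.
  have cb : 1 - 2 * a @[a --> (m%:~R : R)^'] --> (1 - 2 * m%:~R : R).
    by apply: cvgB; [exact: cvg_cst|exact: cvgMl_tmp].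
  apply: (ler_cvg_to (a := (m%:~R : R)^')
    (f := fun a => s ^+ 2 * (integralRn (fun x => e x * W T x) -
      (phi1 a s T * integralRn (fun x => e x * W 0 x) +
       phi2 a s T * integralRn (fun x => e x * Wt 0 x))) ^+ 2)
    (g := fun a => expR ((2 * `|1 - 2 * a| + 1) * T) * ((`|1 - 2 * a - mu| * K) ^+ 2 * T)));
    last by apply: filterS (near_nonint m).
    apply: cvgMl_tmp; apply: sq; apply: cvgB; first exact: cvg_cst.
    by apply: cvgD; apply: cvgMr_tmp; [exact: c1|exact: c2].
  apply: cvgM.
    have cM : (2 * `|1 - 2 * a| + 1) * T @[a --> (m%:~R : R)^'] -->
        (2 * `|1 - 2 * m%:~R| + 1 : R) * T.
      apply: cvgMr_tmp; apply: cvgD; last exact: cvg_cst.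
      by apply: cvgMl_tmp; exact: cvg_norm.
    exact: (cvg_comp _ _ cM (@continuous_expR R _)).
  apply: cvgMr_tmp; apply: sq; apply: cvgMr_tmp; apply: cvg_norm.
  by apply: cvgB => //; exact: cvg_cst.
rewrite muE subrr normr0 mul0r expr0n mul0r mulr0 pmulr_rle0 ?exprn_gt0// => le0.
apply/eqP; rewrite -subr_eq0 -sqrf_eq0 eq_le le0; exact: sqr_ge0.
Unshelve. all: by end_near. Qed.

End Decay.

(** * Classical solutions with Schwartz data *)

Section ClassicalSolution.
Set Implicit Arguments.
Unset Strict Implicit.
Context {R : realType}.

Lemma MVT_has_derive (f df : R -> R) a b : a < b ->
  (forall x : R, a <= x <= b -> has_derive x 1 f (df x)) ->
  exists2 c, a <= c <= b & f b - f a = df c * (b - a).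
Proof.
move=> ab fdf; have [||c cab E] := @MVT _ f df a b ab.
- by move=> x; rewrite in_itv/= => /andP[ax xb]; apply: fdf; rewrite !ltW.
- apply: continuous_in_subspaceT => x; rewrite inE/= in_itv/= => xab.
  exact: has_derive1_continuous (fdf x xab).
by exists c => //; move: cab; rewrite in_itv/= => /andP[ac cb]; rewrite !ltW.
Qed.

(** Schwarz's theorem: the second difference over a square of side k is k^2 times either mixed
    derivative at some point of the square. It is needed because [Ck_ge0] makes both mixed
    derivatives continuous without identifying them. *)
Lemma mixed_derivatives (g gs gh gsh ghs : R -> R -> R) (t : R) : 0 < t ->
  (forall s h : R, 0 < s -> has_derive s 1 (g ^~ h) (gs s h)) ->
  (forall s h : R, 0 < s -> has_derive h 1 (g s) (gh s h)) ->
  (forall s h : R, 0 < s -> has_derive h 1 (gs s) (gsh s h)) ->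
  (forall s h : R, 0 < s -> has_derive s 1 (gh ^~ h) (ghs s h)) ->
  continuous (fun p : R * R => gsh p.1 p.2) ->
  continuous (fun p : R * R => ghs p.1 p.2) -> gsh t 0 = ghs t 0.
Proof.
move=> t0 ds dh dsh dhs c1 c2; apply/eqP; rewrite -subr_eq0 -normr_eq0.
rewrite eq_le normr_ge0 andbT; apply/ler_addgt0Pl => e e0; rewrite addr0.
have e2 : 0 < e / 2 by exact: divr_gt0.
have /cvgrPdist_le /(_ _ e2) /nbhs_ballP[d1 /= d10 B1] := c1 (t, 0).
have /cvgrPdist_le /(_ _ e2) /nbhs_ballP[d2 /= d20 B2] := c2 (t, 0).
pose k := Num.min d1 d2 / 2.
have d0 : 0 < Num.min d1 d2 by rewrite lt_min d10.
have k0 : 0 < k by exact: divr_gt0.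
have kd : k < Num.min d1 d2 by rewrite /k ltr_pdivrMr//; lra.
have := kd; rewrite lt_min => /andP[kd1 kd2].
have tk : t < t + k by lra.
have bl d s h : k < d -> t <= s <= t + k -> 0 <= h <= k -> ball (t, 0 : R) d (s, h).
  move=> kd' /andP[ts sk] /andP[h0 hk]; split; rewrite /ball/=.
    by rewrite ltr_distlC; apply/andP; split; lra.
  by rewrite sub0r normrN ger0_norm//; lra.
have [s1 s1I E1] : exists2 c, t <= c <= t + k &
    (g (t + k) k - g (t + k) 0) - (g t k - g t 0) = (gs c k - gs c 0) * (t + k - t).
  have := @MVT_has_derive (fun s => g s k - g s 0) (fun s => gs s k - gs s 0) _ _ tk.
  apply=> x /andP[tx _]; apply: has_derive_sub; apply: ds; exact: lt_le_trans tx.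
have s10 : 0 < s1 by case/andP: s1I => ts _; exact: lt_le_trans ts.
have [h1 h1I F1] : exists2 c, 0 <= c <= k & gs s1 k - gs s1 0 = gsh s1 c * (k - 0).
  by apply: MVT_has_derive => // x _; exact: dsh.
have [h2 h2I E2] : exists2 c, 0 <= c <= k &
    (g (t + k) k - g t k) - (g (t + k) 0 - g t 0) = (gh (t + k) c - gh t c) * (k - 0).
  have := @MVT_has_derive (fun h => g (t + k) h - g t h) (fun h => gh (t + k) h - gh t h) _ _ k0.
  apply=> x _; apply: has_derive_sub; apply: dh => //; exact: lt_trans tk.
have [s2 s2I F2] : exists2 c, t <= c <= t + k &
    gh (t + k) h2 - gh t h2 = ghs c h2 * (t + k - t).
  apply: (MVT_has_derive (f := gh ^~ h2)) => // x /andP[tx _].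
  apply: dhs; exact: lt_le_trans tx.
have E : gsh s1 h1 = ghs s2 h2.
  have kk : k * k != 0 by rewrite mulf_neq0// gt_eqF.
  apply: (mulIf kk); rewrite F1 in E1; rewrite F2 in E2; lra.
have A1 := B1 _ (bl _ _ _ kd1 s1I h1I); have A2 := B2 _ (bl _ _ _ kd2 s2I h2I).
rewrite /= in A1 A2.
rewrite (_ : _ - _ = (gsh t 0 - gsh s1 h1) - (ghs t 0 - ghs s2 h2)); last by rewrite E; ring.
apply: le_trans (ler_normB _ _) _; lra.
Qed.

Lemma derive_ge0_has_derive (g : R -> R) (t : R) : 0 < t -> derivable_ge0 g t ->
  has_derive t 1 g (derive_ge0 g t).
Proof.
rewrite /derivable_ge0 /derive_ge0 => t0 cv; apply: cvg_has_derive.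
set q := fun s : R => (g s - g t) / (s - t) in cv *.
have E h : h^-1 *: (g (h *: 1 + t) - g t) = q (h + t).
  by rewrite /q addrK [h *: 1]mulr1 mulrC.
under eq_fun do rewrite E.
apply: (cvg_comp (fun h : R => h + t) q _ cv).
move=> P /nbhs_ballP[e /= e0 eP]; apply/nbhs_ballP; exists (Num.min e t).
  by rewrite /= lt_min e0.
move=> h; rewrite /ball/= sub0r normrN lt_min => /andP[he ht] h0.
apply: eP => /=.
- by rewrite /ball/= opprD addrCA subrr addr0 normrN.
- by rewrite -subr_eq0 addrK.
- by move: ht; rewrite ltr_norml => /andP[? _]; lra.
Qed.

(** Composition with the continuous retraction of the line onto [0, +oo[ turns continuity up to the
    boundary into continuity for all times. *)
Lemma within_ge0_jcontinuous n (f : R -> 'rV[R]_n -> R) :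
  {within [set p : R * 'rV[R]_n | 0 <= p.1], continuous (fun p => f p.1 p.2)} ->
  jcontinuous (fun t x => f (pos t) x).
Proof.
move=> /subspace_continuousP cf p.
have cr : continuous (fun p : R * 'rV[R]_n => (pos p.1, p.2)).
  apply: contPair; last by move=> q; exact: cvg_snd.
  exact: jcontinuous_cstx continuous_pos.
have := cf (pos p.1, p.2) (pos_ge0 _).
apply: (cvg_comp (fun p : R * 'rV[R]_n => (pos p.1, p.2))) => P DP.
have H : nbhs p (fun q : R * 'rV[R]_n => 0 <= pos q.1 -> P (pos q.1, q.2)) := cr p _ DP.
have {}H : nbhs p (fun q : R * 'rV[R]_n => P (pos q.1, q.2)).
  by apply: filterS H => q; apply; exact: pos_ge0.
exact: H.
Qed.

Lemma has_derive_pos (f : R -> R) (t d : R) : 0 < t ->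
  has_derive t 1 f d -> has_derive t 1 (fun s => f (pos s)) d.
Proof.
move=> t0; apply: near_eq_has_derive; near=> s; congr f; apply/esym/max_idPr.
by near: s; apply: filterS (lt_nbhsr t0) => s /ltW.
Unshelve. all: by end_near. Qed.

Lemma derivable_has_derive (V : normedModType R) (f : V -> R) x v :
  derivable f x v -> has_derive x v f ('D_v f x).
Proof. exact: derivableP. Qed.

Variables (n : nat) (mu : R) (w : R -> 'rV[R]_n -> R).
Hypothesis Cw : Ck_ge0 2 w.

Let wt t x := derive_ge0 (w ^~ x) t.
Let wtt t x := derive_ge0 (wt ^~ x) t.

Hypothesis eqw : forall t x, 0 < t ->
  wtt t x - \sum_i partial i (partial i (w t)) x + mu / (1 + t) * wt t x = 0.

Lemma classical_wave_solution : wave_solution mu (fun t x => w (pos t) x)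
  (fun t x => wt (pos t) x) (fun t x => wtt (pos t) x)
  (fun i t x => partial i (w (pos t)) x) (fun i t x => partial i (wt (pos t)) x)
  (fun i t x => partial i (partial i (w (pos t))) x).
Proof.
have [cw [dw [cwt [dwt [cwtt _] xwt cwtx]] xw cwx]] := Cw.
have posE (t : R) : 0 < t -> pos t = t by move=> t0; apply/max_idPr/ltW.
have dW (t : R) x : 0 < t -> has_derive t 1 (fun s => w (pos s) x) (wt (pos t) x).
  move=> t0; apply: (has_derive_pos (f := w ^~ x)) => //; rewrite posE//.
  by apply: derive_ge0_has_derive => //; apply: dw; exact: ltW.
have dWx i (t : R) x : 0 < t -> has_derive t 1 (fun s => partial i (w (pos s)) x)
    (derive_ge0 (fun s => partial i (w s) x) (pos t)).
  move=> t0; apply: (has_derive_pos (f := fun s => partial i (w s) x)) => //; rewrite posE//.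
  have [_ [d _ _ _]] := cwx i.
  by apply: derive_ge0_has_derive => //; apply: d; exact: ltW.
have jWtx i : jcontinuous (fun t x => partial i (wt (pos t)) x).
  exact: (within_ge0_jcontinuous (f := fun t x => partial i (wt t) x)) (cwtx i).1.
have jWxt i : jcontinuous (fun t x => derive_ge0 (fun s => partial i (w s) x) (pos t)).
  have [_ [_ [d _] _ _]] := cwx i.
  exact: (within_ge0_jcontinuous (f := fun t x => derive_ge0 (fun s => partial i (w s) x) t)) d.
split.
- exact: (within_ge0_jcontinuous (f := w)) cw.
- exact: (within_ge0_jcontinuous (f := wt)) cwt.
- exact: (within_ge0_jcontinuous (f := wtt)) cwtt.
- by move=> i; exact: (within_ge0_jcontinuous (f := fun t x => partial i (w t) x)) (cwx i).1.
- exact: jWtx.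
- move=> i; have [_ [_ _ _ d]] := cwx i; have [d' _] := d i.
  exact: (within_ge0_jcontinuous (f := fun t x => partial i (partial i (w t)) x)) d'.
- exact: dW.
- move=> t x t0; apply: (has_derive_pos (f := wt ^~ x)) => //; rewrite posE//.
  by apply: derive_ge0_has_derive => //; apply: dwt; exact: ltW.
- move=> i t x t0.
  (* The record wants the derivative of [wt] in x, while the definition of class C^2 provides the
     t-derivative of the partial derivative of w; [mixed_derivatives], along the line through x in
     the i-th direction, equates them. *)
  suff -> : partial i (wt (pos t)) x =
      derive_ge0 (fun s => partial i (w s) x) (pos t) by exact: dWx.
  pose l (h : R) := h *: delta_mx ord0 i + x : 'rV[R]_n.
  have cl : continuous (fun p : R * R => (p.1, l p.2)).
    apply: contPair; first by move=> q; exact: cvg_fst.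
    apply: continuous_rV => j.
    apply: (continuous_ext (f := fun p : R * R =>
      p.2 * (delta_mx ord0 i : 'rV[R]_n) ord0 j + x ord0 j)) => [p|].
      by rewrite !mxE.
    by repeat cont_step; move=> q; exact: cvg_snd.
  have line (f : 'rV[R]_n -> R) (h : R) : derivable f (l h) (delta_mx ord0 i) ->
      has_derive h 1 (fun h => f (l h)) (partial i f (l h)).
    move=> /derivable_has_derive/has_derive_line; rewrite /l => df.
    apply/has_derive_line; rewrite (_ : (fun k => _) =
      (fun k : R => f (k *: delta_mx ord0 i + (h *: delta_mx ord0 i + x))))//.
    by apply/funext => k; rewrite [k *: 1]mulr1 scalerDl addrA.
  have := @mixed_derivatives (fun s h => w (pos s) (l h)) (fun s h => wt (pos s) (l h))
    (fun s h => partial i (w (pos s)) (l h)) (fun s h => partial i (wt (pos s)) (l h))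
    (fun s h => derive_ge0 (fun r => partial i (w r) (l h)) (pos s)) t t0.
  rewrite /l scale0r add0r; apply.
  - by move=> s h s0; exact: dW.
  - by move=> s h s0; apply: (line (w (pos s))); apply: xw; exact: pos_ge0.
  - by move=> s h s0; apply: (line (wt (pos s))); apply: xwt; exact: pos_ge0.
  - by move=> s h s0; exact: dWx.
  - exact: contT cl (jWtx i).
  - exact: contT cl (jWxt i).
- by move=> i t x; apply: derivable_has_derive; apply: xw; exact: pos_ge0.
- by move=> i t x; apply: derivable_has_derive; apply: xwt; exact: pos_ge0.
- move=> i t x; apply: derivable_has_derive; have [_ [_ _ d _]] := cwx i.
  by apply: d; exact: pos_ge0.
- move=> t x t0; rewrite posE//; have /eqP := eqw x t0.
  by rewrite addrAC subr_eq0 => /eqP <-; rewrite addrK.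
Qed.

End ClassicalSolution.

(** * Decay of Schwartz data in powers of Q *)

Section RapidDecay.
Set Implicit Arguments.
Unset Strict Implicit.
Context {R : realType}.

(** Q is at most n + 1 times the maximum of 1 and the x_i^2, and the m-th power of this maximum is
    one of the terms added on the right. Monomials in a single coordinate therefore suffice to
    control powers of Q. *)
Lemma bracket_expn_le n m (x : 'rV[R]_n) :
  bracket x ^+ m <= n.+1%:R ^+ m * (1 + \sum_i x ord0 i ^+ (2 * m)).
Proof.
have s0 : 0 <= \sum_i x ord0 i ^+ (2 * m).
  by apply: sumr_ge0 => i _; rewrite exprM exprn_ge0// sqr_ge0.
suff [y [yx ym]] : exists y : R, bracket x <= n.+1%:R * y /\
    y ^+ m <= 1 + \sum_i x ord0 i ^+ (2 * m).
  apply: le_trans (lerXn2r _ _ _ yx) _; rewrite ?nnegrE ?(ltW (bracket_gt0 _))//.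
    exact: le_trans (ltW (bracket_gt0 x)) yx.
  by rewrite exprMn ler_wpM2l// exprn_ge0.
have bnd y : 1 <= y -> (forall i, x ord0 i ^+ 2 <= y) -> bracket x <= n.+1%:R * y.
  move=> y1 xy; rewrite /bracket -natr1 mulrDl mul1r addrC lerD//.
  rewrite -[n in n%:R](card_ord n) mulr_natl -sumr_const; apply: ler_sum => i _.
  exact: xy.
have [[i0 i01]|x1] := pselect (exists i, 1 < x ord0 i ^+ 2).
  have [i _ imax] := arg_maxP (fun i => x ord0 i ^+ 2) (erefl (xpredT i0)).
  have i1 : 1 <= x ord0 i ^+ 2 by apply: le_trans (ltW i01) _; exact: imax.
  exists (x ord0 i ^+ 2); split; first by apply: bnd => // k; exact: imax.
  rewrite -exprM (bigD1 i)//= addrCA lerDl addr_ge0// sumr_ge0// => k _.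
  by rewrite exprM exprn_ge0// sqr_ge0.
exists 1; split; last by rewrite expr1n lerDl.
by apply: bnd => // i; rewrite leNgt; apply/negP => xi; apply: x1; exists i.
Qed.

Definition decays n m (f : 'rV[R]_n -> R) :=
  exists C : R, forall x, `|bracket x ^+ m * f x| <= C.

Lemma rapid_decay n m (f : 'rV[R]_n -> R) :
  (forall alpha : 'I_n -> nat, exists C : R, forall x : 'rV[R]_n,
    `|\prod_i x ord0 i ^+ alpha i * f x| <= C) -> decays m f.
Proof.
move=> fC; have [C0 HC0] := fC (fun=> 0%N).
have /choice[C HC] : forall i, exists C : R, forall x : 'rV[R]_n,
    `|x ord0 i ^+ (2 * m) * f x| <= C.
  move=> i; have [C HC] := fC (fun j => if j == i then (2 * m)%N else 0%N).
  exists C => x; have := HC x; rewrite (bigD1 i)//= eqxx big1 ?mulr1// => j ji.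
  by rewrite (negPf ji) expr0.
exists (n.+1%:R ^+ m * (C0 + \sum_i C i)) => x.
have b0 : 0 <= bracket x ^+ m by rewrite exprn_ge0// ltW// bracket_gt0.
rewrite normrM (ger0_norm b0).
apply: le_trans (ler_wpM2r _ (bracket_expn_le m x)) _ => //.
rewrite -mulrA ler_wpM2l ?exprn_ge0// mulrDl mul1r; apply: lerD.
  by have := HC0 x; rewrite big1 ?mul1r// => i _; rewrite expr0.
rewrite mulr_suml; apply: ler_sum => i _; have := HC i x; rewrite normrM.
by rewrite ger0_norm// exprM exprn_ge0// sqr_ge0.
Qed.

Lemma schwartz_decay n (f : 'rV[R]_n -> R[i]) s m : schwartz f ->
  decays m (partials s (fun y => complex.Re (f y))) /\
  decays m (partials s (fun y => complex.Im (f y))).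
Proof.
move=> [_ _ H]; split; apply: rapid_decay => alpha; have [C HC] := H alpha s; exists C => x.
  have := HC x; rewrite /componentwise; move: (partials s _ x) (partials s _ x) => a b.
  move=> /(le_trans (normc_ge_Re _)); rewrite /= mul0r subr0; by rewrite lecR.
have := HC x; rewrite /componentwise; move: (partials s _ x) (partials s _ x) => a b.
rewrite normc_def /= !mul0r addr0 lecR -[X in _ -> X <= _]sqrtr_sqr; apply: le_trans.
by rewrite ler_wsqrtr// lerDr sqr_ge0.
Qed.

(** Q^(n+2) f^2 is (Q^(n+1) f)^2 Q^(-n), and Q^(-n) is at most [wprod]: hence the n + 1 powers of Q
    asked of the data. *)
Lemma energy_decay n (W Wt : R -> 'rV[R]_n -> R) (Wx : 'I_n -> R -> 'rV[R]_n -> R) t :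
  decays n.+1 (W t) -> decays n.+1 (Wt t) -> (forall i, decays n.+1 (Wx i t)) ->
  exists C : R, forall x, bracket x ^+ n.+2 * energy W Wt Wx t x <= C * wprod x.
Proof.
have sqr_bound (f : 'rV[R]_n -> R) : decays n.+1 f ->
    exists C : R, forall x, bracket x ^+ n.+2 * f x ^+ 2 <= C * wprod x.
  move=> [C HC]; exists (C ^+ 2) => x; have Q0 := bracket_gt0 x.
  apply: le_trans (ler_wpM2l (sqr_ge0 C) (bracket_expn_wprod x)).
  rewrite ler_pdivlMr ?exprn_gt0//.
  have -> : bracket x ^+ n.+2 * f x ^+ 2 * bracket x ^+ n =
      (bracket x ^+ n.+1 * f x) ^+ 2.
    by rewrite mulrAC -exprD exprMn -exprM; congr (_ ^+ _ * _); lia.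
  rewrite -[(_ * _) ^+ 2]real_normK ?num_real// lerXn2r ?nnegrE//.
  exact: le_trans (HC x).
move=> /sqr_bound[C0 H0] /sqr_bound[C1 H1] H.
have /choice[C HC] : forall i, exists C : R, forall x,
    bracket x ^+ n.+2 * Wx i t x ^+ 2 <= C * wprod x.
  by move=> i; exact: sqr_bound (H i).
exists (C1 + \sum_i C i + C0) => x.
rewrite /energy !mulrDl !mulrDr; apply: lerD => //; apply: lerD => //.
by rewrite mulr_sumr mulr_suml; apply: ler_sum => i _.
Qed.

End RapidDecay.

(** * Fourier transform of the solution *)

Local Open Scope complex_scope.

Section Transform.
Set Implicit Arguments.
Unset Strict Implicit.
Context {R : realType}.

Lemma has_derive_dotp n (i : 'I_n) (x xi : 'rV[R]_n) :
  has_derive x (delta_mx ord0 i) (fun y => dotp y xi) (xi ord0 i).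
Proof.
apply: has_derive_eq.
  by apply: has_derive_bigsum => j; apply: has_derive_mul;
    [exact: has_derive_coord|exact: has_derive_cst].
rewrite (bigD1 i)//= eqxx mulr1 mulr0 add0r big1 ?addr0// => j ji.
by rewrite eq_sym (negPf ji) !mulr0 addr0.
Qed.

Lemma continuous_dotp n (xi : 'rV[R]_n) : continuous (fun y => dotp y xi).
Proof.
rewrite /dotp; apply: contSum => i.
by apply: contM; [exact: continuous_coord|exact: contC].
Qed.

Lemma enorm_sqr n (x : 'rV[R]_n) : enorm x ^+ 2 = \sum_i x ord0 i ^+ 2.
Proof. by rewrite /enorm sqr_sqrtr// sumr_ge0// => i _; rewrite -expr2 sqr_ge0. Qed.

Lemma enorm_gt0 n (x : 'rV[R]_n) : x != 0 -> 0 < enorm x.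
Proof.
move=> x0; rewrite lt0r sqrtr_ge0 andbT; apply: contra x0 => /eqP n0.
apply/eqP/rowP => i; rewrite mxE; apply/eqP; rewrite -sqrf_eq0.
have := enorm_sqr x; rewrite n0 expr0n => /esym/eqP.
by rewrite psumr_eq0 => [/allP/(_ i)|j _]; [rewrite mem_index_enum; apply|exact: sqr_ge0].
Qed.

Lemma classical_fourier n (mu rho : R) (w : R -> 'rV[R]_n -> R) (xi : 'rV[R]_n) (T : R) :
  0 < mu -> mu = 1 - 2 * rho -> Ck_ge0 2 w ->
  (forall t x, 0 < t -> derive_ge0 (fun s => derive_ge0 (w ^~ x) s) t -
    \sum_i partial i (partial i (w t)) x + mu / (1 + t) * derive_ge0 (w ^~ x) t = 0) ->
  decays n.+1 (w 0) -> decays n.+1 (fun x => derive_ge0 (w ^~ x) 0) ->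
  (forall i, decays n.+1 (partial i (w 0))) -> xi != 0 -> 0 <= T ->
  let w' x := derive_ge0 (w ^~ x) 0 in
  forall c, c = @cos R \/ c = @sin R ->
  [/\ integrableRn (fun x => c (dotp x xi) * w T x),
      integrableRn (fun x => c (dotp x xi) * w 0 x),
      integrableRn (fun x => c (dotp x xi) * w' x) &
      integralRn (fun x => c (dotp x xi) * w T x) =
        phi1 rho (enorm xi) T * integralRn (fun x => c (dotp x xi) * w 0 x) +
        phi2 rho (enorm xi) T * integralRn (fun x => c (dotp x xi) * w' x)].
Proof.
move=> mu0 muE Cw eqw dw0 dw1 dwx xi0 T0 w' c cE.
have HW := classical_wave_solution Cw eqw.
have p0 : pos (0 : R) = 0 by rewrite /pos maxxx.
have pT : pos T = T by exact/max_idPr.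
have [C decay0] : exists C : R, forall x, bracket x ^+ n.+2 *
    energy (fun t x => w (pos t) x) (fun t x => derive_ge0 (w ^~ x) (pos t))
      (fun i t x => partial i (w (pos t)) x) 0 x <= C * wprod x.
  by apply: energy_decay => [||i] /=; rewrite p0//; exact: dwx.
have cd := @continuous_dotp n xi.
have ccos : continuous (fun x : 'rV[R]_n => cos (dotp x xi)).
  exact: contComp (@continuous_cos R) cd.
have csin : continuous (fun x : 'rV[R]_n => sin (dotp x xi)).
  exact: contComp (@continuous_sin R) cd.
have dcos i (x : 'rV[R]_n) : has_derive x (delta_mx ord0 i) (fun x => cos (dotp x xi))
    (- (xi ord0 i * sin (dotp x xi))).
  apply: has_derive_eq (has_derive_comp _ _ _ _ _ _ (has_derive_cos _) (has_derive_dotp i x xi)) _.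
  by rewrite mulNr mulrC.
have dsin i (x : 'rV[R]_n) : has_derive x (delta_mx ord0 i) (fun x => sin (dotp x xi))
    (xi ord0 i * cos (dotp x xi)).
  apply: has_derive_eq (has_derive_comp _ _ _ _ _ _ (has_derive_sin _) (has_derive_dotp i x xi)) _.
  by rewrite mulrC.
have bcos (x : 'rV[R]_n) : `|cos (dotp x xi)| <= 1 by rewrite ler_norml cos_geN1 cos_le1.
have bsin (x : 'rV[R]_n) : `|sin (dotp x xi)| <= 1 by rewrite ler_norml sin_geN1 sin_le1.
have s0 := enorm_gt0 xi0; have sE := enorm_sqr xi.
have cc : continuous (fun x : 'rV[R]_n => c (dotp x xi)) by case: cE => ->.
have bc (x : 'rV[R]_n) : `|c (dotp x xi)| <= 1 by case: cE => ->.
have [IT _] := wave_integrable mu0 HW decay0 T0 cc bc.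
have [I0 I1] := wave_integrable mu0 HW decay0 (lexx 0) cc bc.
rewrite pT in IT; rewrite p0 in I0 I1; split => //.
case: cE => cE; rewrite cE.
  have := @wave_fourier R n mu _ _ _ _ _ _ mu0 HW C decay0 (fun x => cos (dotp x xi))
    (fun x => - sin (dotp x xi)) xi ccos (contN csin) bcos _ _ _ (enorm xi) rho T s0 sE muE T0.
  rewrite pT p0; apply.
  - by move=> x; rewrite normrN.
  - by move=> i x; rewrite mulrN.
  - by move=> i x; apply: has_derive_opp.
have := @wave_fourier R n mu _ _ _ _ _ _ mu0 HW C decay0 (fun x => sin (dotp x xi))
  (fun x => cos (dotp x xi)) xi csin ccos bsin bcos dsin dcos (enorm xi) rho T s0 sE muE T0.
by rewrite pT p0.
Qed.

Lemma det2E (a b c d : R[i]) : det2 a b c d = a * d - b * c.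
Proof.
rewrite /det2 (expand_det_row _ ord0) !big_ord_recl big_ord0 /cofactor.
by rewrite !det_mx11 !mxE /=; ring.
Qed.

Lemma Phi1E n rho t (xi : 'rV[R]_n) : Phi1 rho t 0 xi = (phi1 rho (enorm xi) t)%:C.
Proof.
rewrite /Phi1 det2E /hankel_minus /hankel_plus /phi1 !addr0 !mul1r powR1 divr1.
move: (besselJ _ (enorm xi)) (besselY _ (enorm xi)) (besselJ rho _) (besselY rho _).
move=> J1 Y1 J2 Y2; apply/eqP; rewrite eq_complex; apply/andP; split; apply/eqP => /=; by field.
Qed.

Lemma Phi2E n rho t (xi : 'rV[R]_n) : Phi2 rho t 0 xi = (phi2 rho (enorm xi) t)%:C.
Proof.
rewrite /Phi2 det2E /hankel_minus /hankel_plus /phi2 !addr0 !mul1r powR1 divr1.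
move: (besselJ rho ((1 + t) * _)) (besselY rho ((1 + t) * _)) (besselJ rho _) (besselY rho _).
move=> J2 Y2 J1 Y1; apply/eqP; rewrite eq_complex; apply/andP; split; apply/eqP => /=; by field.
Qed.

Lemma Re_wave (A L D : R[i]) k :
  complex.Re (A - L + k%:C * D) = complex.Re A - complex.Re L + k * complex.Re D.
Proof. by case: A L D => [? ?] [? ?] [? ?] /=; rewrite mul0r subr0. Qed.

Lemma Im_wave (A L D : R[i]) k :
  complex.Im (A - L + k%:C * D) = complex.Im A - complex.Im L + k * complex.Im D.
Proof. by case: A L D => [? ?] [? ?] [? ?] /=; rewrite mul0r addr0. Qed.

Lemma complex_combination (k p q a b c d a' b' c' d' : R) :
  k%:C * ((p * a + q * a' + (p * b + q * b')) +i* (p * c + q * c' - (p * d + q * d'))) =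
  p%:C * (k%:C * ((a + b) +i* (c - d))) + q%:C * (k%:C * ((a' + b') +i* (c' - d'))).
Proof.
by apply/eqP; rewrite eq_complex; apply/andP; split; apply/eqP => /=; ring.
Qed.

Lemma Re_sum (I : Type) (r : seq I) (f : I -> R[i]) :
  complex.Re (\sum_(i <- r) f i) = \sum_(i <- r) complex.Re (f i).
Proof.
elim: r => [|i r IH]; first by rewrite !big_nil.
by rewrite !big_cons -IH; case: (f i) (\sum_(j <- r) f j) => ? ? [].
Qed.

Lemma Im_sum (I : Type) (r : seq I) (f : I -> R[i]) :
  complex.Im (\sum_(i <- r) f i) = \sum_(i <- r) complex.Im (f i).
Proof.
elim: r => [|i r IH]; first by rewrite !big_nil.
by rewrite !big_cons -IH; case: (f i) (\sum_(j <- r) f j) => ? ? [].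
Qed.

End Transform.

Theorem theorem2p1 (R : realType) (n : nat) (mu rho : R)
  (v1 v2 : 'rV[R]_n -> R[i]) (v : R -> 'rV[R]_n -> R[i]) :
  (1 <= n)%N -> 0 < mu -> rho = - ((mu - 1) / 2) ->
  schwartz v1 -> schwartz v2 ->
  solves_cauchy mu v1 v2 v ->
  forall (t : R) (xi : 'rV[R]_n), 0 <= t -> xi != 0 ->
    fourier (v t) xi =
      Phi1 rho t 0 xi * fourier v1 xi + Phi2 rho t 0 xi * fourier v2 xi.
Proof.
move=> _ mu0 rhoE S1 S2 [CR CI eqv ini1 ini2] t xi t0 xi0.
have muE : mu = 1 - 2 * rho by rewrite rhoE; lra.
pose a s x := complex.Re (v s x); pose b s x := complex.Im (v s x).
have a0 : a 0 = (fun x => complex.Re (v1 x)) by apply/funext => x; rewrite /a ini1.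
have b0 : b 0 = (fun x => complex.Im (v1 x)) by apply/funext => x; rewrite /b ini1.
have a1 : (fun x => derive_ge0 (a ^~ x) 0) = (fun x => complex.Re (v2 x)).
  by apply/funext => x; rewrite -ini2.
have b1 : (fun x => derive_ge0 (b ^~ x) 0) = (fun x => complex.Im (v2 x)).
  by apply/funext => x; rewrite -ini2.
have eqa s x : 0 < s -> derive_ge0 (fun r => derive_ge0 (a ^~ x) r) s -
    \sum_i partial i (partial i (a s)) x + mu / (1 + s) * derive_ge0 (a ^~ x) s = 0.
  move=> s0; have := congr1 (@complex.Re R) (eqv s x (ltW s0)).
  by rewrite Re_wave /laplacian Re_sum.
have eqb s x : 0 < s -> derive_ge0 (fun r => derive_ge0 (b ^~ x) r) s -
    \sum_i partial i (partial i (b s)) x + mu / (1 + s) * derive_ge0 (b ^~ x) s = 0.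
  move=> s0; have := congr1 (@complex.Im R) (eqv s x (ltW s0)).
  by rewrite Im_wave /laplacian Im_sum.
have da : decays n.+1 (a 0) by rewrite a0; have [] := schwartz_decay [::] n.+1 S1.
have db : decays n.+1 (b 0) by rewrite b0; have [] := schwartz_decay [::] n.+1 S1.
have da1 : decays n.+1 (fun x => derive_ge0 (a ^~ x) 0).
  by rewrite a1; have [] := schwartz_decay [::] n.+1 S2.
have db1 : decays n.+1 (fun x => derive_ge0 (b ^~ x) 0).
  by rewrite b1; have [] := schwartz_decay [::] n.+1 S2.
have dax i : decays n.+1 (partial i (a 0)).
  by rewrite a0; have [] := schwartz_decay [:: i] n.+1 S1.
have dbx i : decays n.+1 (partial i (b 0)).
  by rewrite b0; have [] := schwartz_decay [:: i] n.+1 S1.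
have Fa := classical_fourier mu0 muE CR eqa da da1 dax xi0 t0.
have Fb := classical_fourier mu0 muE CI eqb db db1 dbx xi0 t0.
have [ac1 ac2 ac3 acE] := Fa _ (or_introl erefl).
have [as1 as2 as3 asE] := Fa _ (or_intror erefl).
have [bc1 bc2 bc3 bcE] := Fb _ (or_introl erefl).
have [bs1 bs2 bs3 bsE] := Fb _ (or_intror erefl).
(* Real and imaginary parts of the integral of exp(-i x.xi) (f + i g). The four integrals obey the
   same formula with the real coefficients [phi1] and [phi2], hence so does their complex
   combination. *)
pose fou (f g : 'rV[R]_n -> R) : R[i] :=
  (integralRn (fun x => cos (dotp x xi) * f x) + integralRn (fun x => sin (dotp x xi) * g x)) +i*
  (integralRn (fun x => cos (dotp x xi) * g x) - integralRn (fun x => sin (dotp x xi) * f x)).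
have fouE (f : 'rV[R]_n -> R[i]) (fr fi : 'rV[R]_n -> R) :
    fr = (fun x => complex.Re (f x)) -> fi = (fun x => complex.Im (f x)) ->
    integrableRn (fun x => cos (dotp x xi) * fr x) ->
    integrableRn (fun x => sin (dotp x xi) * fr x) ->
    integrableRn (fun x => cos (dotp x xi) * fi x) ->
    integrableRn (fun x => sin (dotp x xi) * fi x) ->
    fourier f xi = ((2 * pi) `^ (- (n%:R / 2)))%:C * fou fr fi.
  move=> -> -> I1 I2 I3 I4; rewrite /fourier /fou -!integralRnD// -integralRnB//; congr (_ * _).
  by rewrite /integralRnC; congr (_ +i* _); apply: eq_integralRn => x;
    rewrite /expi cosN sinN; case: (f x) => p q /=; ring.
rewrite Phi1E Phi2E (fouE _ (a t) (b t))//.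
rewrite (fouE v1 (a 0) (b 0))// (fouE v2 _ _ (esym (esym a1)) (esym (esym b1)))//.
move: (_ `^ _) => k; rewrite /fou acE asE bcE bsE.
exact: complex_combination.
Qed.
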